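(* Let $\alpha\in(0,1)$ be an irrational bounded density number and let $\lambda\in\mathbb{R}\setminus\{0\}$. Then there exist $C>0$ and $\mu>0$ such that for all $\theta\in[0,1)$, all $E\in\Sigma_{\lambda,\alpha}$ and all $n\in\mathbb{N}$, $$\|M(\lambda,E,v^n_{\alpha,\theta})\|\le C n^{\mu}.$$
   Context: Write $\alpha=[a_1,a_2,\dots]$ for the continued fraction expansion $\alpha=1/(a_1+1/(a_2+\cdots))$; $\alpha$ is a bounded density number if $\limsup_{n\to\infty}\frac1n\sum_{j=1}^n a_j<\infty$. For $\theta\in[0,1)$ let $v_{\alpha,\theta}(n)=\chi_{[1-\alpha,1)}(n\alpha+\theta\bmod 1)$, $n\in\mathbb{Z}$, and let $v^n_{\alpha,\theta}$ be the word $v_{\alpha,\theta}(1)\dots v_{\alpha,\theta}(n)$. Let $H_{\lambda,\alpha,\theta}$ act on $\ell^2(\mathbb{Z})$ by $(Hu)(n)=u(n+1)+u(n-1)+\lambda v_{\alpha,\theta}(n)u(n)$; its spectrum is independent of $\theta$ and is denoted $\Sigma_{\lambda,\alpha}$. For $a\in\mathbb{R}$, $E\in\mathbb{C}$ let $T(\lambda,E,a)=\begin{pmatrix}E-\lambda a&-1\\1&0\end{pmatrix}$ and for a word $w=w_1\dots w_n$ over $\{0,1\}$ let $M(\lambda,E,w)=T(\lambda,E,w_n)\cdots T(\lambda,E,w_1)$. $\|\cdot\|$ is the operator norm with respect to the Euclidean norm on $\mathbb{C}^2$. *)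

(* Defs.v *)
From Stdlib Require Import Reals ZArith List.
From Coquelicot Require Import Coquelicot.
Open Scope R_scope.

Definition frac (x : R) : R := x - IZR (Int_part x).

(* Continued fraction digits a_1, a_2, ... of alpha in (0,1) via the Gauss map:
   x_1 = alpha, a_k = floor (1/x_k), x_{k+1} = frac (1/x_k).
   gauss_iter alpha k = x_{k+1}, cf_digit alpha k = a_{k+1}. *)
Fixpoint gauss_iter (alpha : R) (k : nat) : R :=
  match k with
  | O => alpha
  | S k' => frac (/ gauss_iter alpha k')
  end.

Definition cf_digit (alpha : R) (k : nat) : R :=
  IZR (Int_part (/ gauss_iter alpha k)).

Definition bounded_density (alpha : R) : Prop :=
  Rbar_lt (LimSup_seq (fun k : nat => sum_f_R0 (cf_digit alpha) k / INR (S k))) p_infty.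

Definition sturm (alpha theta : R) (n : Z) : R :=
  let x := frac (IZR n * alpha + theta) in
  if Rle_dec (1 - alpha) x then (if Rlt_dec x 1 then 1 else 0) else 0.

Definition sturm_word (alpha theta : R) (n : nat) : list R :=
  map (fun k : nat => sturm alpha theta (Z.of_nat k)) (seq 1 n).

Record M2 : Type := mkM2 { m11 : C; m12 : C; m21 : C; m22 : C }.

Definition M2mul (A B : M2) : M2 :=
  mkM2 (Cplus (Cmult (m11 A) (m11 B)) (Cmult (m12 A) (m21 B)))
       (Cplus (Cmult (m11 A) (m12 B)) (Cmult (m12 A) (m22 B)))
       (Cplus (Cmult (m21 A) (m11 B)) (Cmult (m22 A) (m21 B)))
       (Cplus (Cmult (m21 A) (m12 B)) (Cmult (m22 A) (m22 B))).

Definition M2id : M2 := mkM2 (RtoC 1) (RtoC 0) (RtoC 0) (RtoC 1).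

Definition transfer (lambda : R) (E : C) (a : R) : M2 :=
  mkM2 (Cminus E (RtoC (lambda * a))) (RtoC (-1)) (RtoC 1) (RtoC 0).

Definition transfer_word (lambda : R) (E : C) (w : list R) : M2 :=
  fold_left (fun acc a => M2mul (transfer lambda E a) acc) w M2id.

Definition vnorm (v : C * C) : R :=
  sqrt (Cmod (fst v) ^ 2 + Cmod (snd v) ^ 2).

Definition M2apply (A : M2) (v : C * C) : C * C :=
  (Cplus (Cmult (m11 A) (fst v)) (Cmult (m12 A) (snd v)),
   Cplus (Cmult (m21 A) (fst v)) (Cmult (m22 A) (snd v))).

(* operator norm: sup of |A v| over unit vectors v (finite for 2x2 matrices) *)
Definition opnorm (A : M2) : R :=
  real (Lub_Rbar (fun r => exists v : C * C, vnorm v = 1 /\ r = vnorm (M2apply A v))).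

Definition l2 (u : Z -> C) : Prop :=
  ex_series (fun k : nat => Cmod (u (Z.of_nat k)) ^ 2) /\
  ex_series (fun k : nat => Cmod (u (- Z.of_nat (S k))%Z) ^ 2).

Definition l2norm2 (u : Z -> C) : R :=
  Series (fun k : nat => Cmod (u (Z.of_nat k)) ^ 2) +
  Series (fun k : nat => Cmod (u (- Z.of_nat (S k))%Z) ^ 2).

Definition Hop (lambda alpha theta : R) (u : Z -> C) : Z -> C :=
  fun n => Cplus (Cplus (u (n + 1)%Z) (u (n - 1)%Z))
                 (Cmult (RtoC (lambda * sturm alpha theta n)) (u n)).

Definition in_resolvent (lambda alpha theta : R) (E : C) : Prop :=
  exists G : (Z -> C) -> (Z -> C),
    (forall u, l2 u -> l2 (G u)) /\
    (exists K : R, forall u, l2 u -> l2norm2 (G u) <= K * l2norm2 u) /\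
    (forall u, l2 u ->
       G (fun n => Cminus (Hop lambda alpha theta u n) (Cmult E (u n))) = u) /\
    (forall u, l2 u ->
       (fun n => Cminus (Hop lambda alpha theta (G u) n) (Cmult E (G u n))) = u).

Definition spectrum_theta (lambda alpha theta : R) (E : C) : Prop :=
  ~ in_resolvent lambda alpha theta E.

(* Sigma_{lambda,alpha}: spectrum of H_{lambda,alpha,theta}, which is independent
   of theta; we take the union over theta in [0,1) (equal to each of them). *)
Definition Sigma (lambda alpha : R) (E : C) : Prop :=
  exists theta, 0 <= theta < 1 /\ spectrum_theta lambda alpha theta E.

(* Main.v *)
Require Import Defs.
From Stdlib Require Import Reals ZArith List Lra Lia Classical FunctionalExtensionality.
From Coquelicot Require Import Coquelicot.
Open Scope R_scope.

(* The letter at x is floor (x + alpha) - floor x, so with D = q alpha - p the word read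
   from x has period q as long as its orbit avoids the points where floor (x + D) differs
   from floor x.  Best approximation properties of the convergents q_k control how often
   this happens.

   Traces.  For the convergent lengths the trace depends only on E; the traces x_k satisfy
   the trace map and have the Fricke invariant 4 + lambda^2.  Either they are bounded by a
   constant depending only on lambda and a bound for |E|, or an escape condition holds at
   some level and then persists with traces growing to infinity.

   Spectrum.  Along a square of length 2q centered at p, solutions of H u = E u satisfy
   U(p+q) + U(p-q) = tr U(p).  Every p or p + 1 is the center of a square of length 2q or
   2r with q = q_k, r = q_k + q_(k-1).  If E escapes, both traces are huge for suitable k,
   and summing over p gives ||u|| <= c ||(H - E) u||.  As H - E is normal, it is inverted
   by a Neumann series for (H - E)* (H - E), so E is not in the spectrum.

   Growth.  For E in the spectrum the traces are therefore bounded.  Cayley-Hamilton turns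
   a period inside a word into a linear recursion for norms of shorter words.  A word of
   length at most q_(k+1) contains at most one break of the period q_k, and the words
   around the break are covered by runs of period q_k + q_(k-1) and q_(k-1).  This bounds
   norms at level k + 1 by D^(a_(k+1) + a_k + 5) times those at level k, hence by
   D^(c (a_1 + ... + a_k)), which is at most exponential in k for bounded density and thus
   polynomial in q_k. *)

(** * Two-by-two matrices *)

(** The length r = q_k + q_(k-1) is the device that handles breaks. A break of the period q_k is an
    orbit point separated from its translate by an integer. The displacements of q_k and r have
    opposite signs, and this keeps breaks of period r away from a break of period q_k. The traces
    for r form the third coordinate of the trace map, so they escape or stay bounded together with
    those for q_k; both the spectral and the growth half rely on this.

    E is complex in the definition of the spectrum and is never shown to be real. As H is symmetric,
    H - E and its adjoint differ by the scalar E - conj E, hence commute, and for a normal operator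
    a lower bound alone yields a bounded inverse. Escape depends on E only, so it excludes E from
    the spectrum for every theta at once.

    The final constants may depend neither on E nor on theta. Energies with |E| >= |lambda| + 3 are
    therefore removed first, by diagonal dominance; after that the bounds on traces and on single
    steps depend on lambda alone. *)

Definition M2det (A : M2) : C := (m11 A * m22 A - m12 A * m21 A)%C.
Definition M2tr (A : M2) : C := (m11 A + m22 A)%C.
(** The adjugate serves as the inverse in determinant one; being linear in the entries, it needs no
    division. *)
Definition M2adj (A : M2) : M2 := mkM2 (m22 A) (- m12 A)%C (- m21 A)%C (m11 A).
(** Chosen because it is submultiplicative, dominates [opnorm], and takes the same value on a matrix
    and its adjugate, so that a word and its inverse have equal norms. *)
Definition M2norm (A : M2) : R :=
  Cmod (m11 A) + Cmod (m12 A) + Cmod (m21 A) + Cmod (m22 A).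

Ltac m2_ring :=
  intros; repeat match goal with A : M2 |- _ => destruct A end;
  unfold M2mul, M2adj, M2id, M2det, M2tr in *; simpl in *;
  first [ ring | f_equal; ring ].

Lemma M2mul_assoc A B D : M2mul A (M2mul B D) = M2mul (M2mul A B) D.
Proof. m2_ring. Qed.

Lemma M2mul_1l A : M2mul M2id A = A.
Proof. m2_ring. Qed.

Lemma M2mul_1r A : M2mul A M2id = A.
Proof. m2_ring. Qed.

Lemma M2adj_mul A B : M2adj (M2mul A B) = M2mul (M2adj B) (M2adj A).
Proof. m2_ring. Qed.

Lemma M2det_mul A B : M2det (M2mul A B) = (M2det A * M2det B)%C.
Proof. m2_ring. Qed.

Lemma M2det_adj A : M2det (M2adj A) = M2det A.
Proof. m2_ring. Qed.

Lemma M2det_id : M2det M2id = RtoC 1.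
Proof. m2_ring. Qed.

Lemma M2tr_mul_comm A B : M2tr (M2mul A B) = M2tr (M2mul B A).
Proof. m2_ring. Qed.

Lemma M2mul_adj_l A : M2det A = RtoC 1 -> M2mul (M2adj A) A = M2id.
Proof.
  destruct A as [a b c d]; unfold M2det, M2mul, M2adj, M2id; simpl; intros H.
  f_equal; try ring; rewrite <- H; ring.
Qed.

Lemma M2mul_adj_r A : M2det A = RtoC 1 -> M2mul A (M2adj A) = M2id.
Proof.
  destruct A as [a b c d]; unfold M2det, M2mul, M2adj, M2id; simpl; intros H.
  f_equal; try ring; rewrite <- H; ring.
Qed.

Lemma M2mul_cancel A B : M2det A = RtoC 1 -> M2mul (M2adj A) (M2mul A B) = B.
Proof. intros H. now rewrite M2mul_assoc, M2mul_adj_l, M2mul_1l. Qed.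

Lemma M2mul_cancel' A B : M2det A = RtoC 1 -> M2mul A (M2mul (M2adj A) B) = B.
Proof. intros H. now rewrite M2mul_assoc, M2mul_adj_r, M2mul_1l. Qed.

(** Replace the first A by tr A - A^(-1); the second term is then conjugate to B. *)
Lemma M2tr_ABA A B :
  M2det A = RtoC 1 ->
  M2tr (M2mul A (M2mul B A)) = (M2tr A * M2tr (M2mul B A) - M2tr B)%C.
Proof.
  destruct A as [a b c d], B as [x y z t]; unfold M2det, M2tr, M2mul; simpl; intros H.
  replace (x + t)%C with (RtoC 1 * (x + t))%C by ring. rewrite <- H. ring.
Qed.

Lemma M2norm_ge0 A : 0 <= M2norm A.
Proof.
  unfold M2norm.
  pose proof (Cmod_ge_0 (m11 A)); pose proof (Cmod_ge_0 (m12 A));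
  pose proof (Cmod_ge_0 (m21 A)); pose proof (Cmod_ge_0 (m22 A)); lra.
Qed.

Lemma Cmod_mul_add a b c d :
  Cmod (a * b + c * d) <= Cmod a * Cmod b + Cmod c * Cmod d.
Proof.
  eapply Rle_trans. apply Cmod_triangle. rewrite !Cmod_mult. lra.
Qed.

Lemma M2norm_mul A B : M2norm (M2mul A B) <= M2norm A * M2norm B.
Proof.
  destruct A as [a b c d], B as [x y z t]; unfold M2norm, M2mul; simpl.
  pose proof (Cmod_mul_add a x b z); pose proof (Cmod_mul_add a y b t).
  pose proof (Cmod_mul_add c x d z); pose proof (Cmod_mul_add c y d t).
  pose proof (Cmod_ge_0 a); pose proof (Cmod_ge_0 b); pose proof (Cmod_ge_0 c);
  pose proof (Cmod_ge_0 d); pose proof (Cmod_ge_0 x); pose proof (Cmod_ge_0 y);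
  pose proof (Cmod_ge_0 z); pose proof (Cmod_ge_0 t).
  nra.
Qed.

Lemma M2norm_adj A : M2norm (M2adj A) = M2norm A.
Proof. unfold M2norm, M2adj; simpl. rewrite !Cmod_opp. ring. Qed.

Definition M2lin (x : C) (A B : M2) : M2 :=
  mkM2 (x * m11 A - m11 B)%C (x * m12 A - m12 B)%C
       (x * m21 A - m21 B)%C (x * m22 A - m22 B)%C.

Lemma Cmod_lin x a b : Cmod (x * a - b) <= Cmod x * Cmod a + Cmod b.
Proof.
  unfold Cminus. eapply Rle_trans. apply Cmod_triangle.
  rewrite Cmod_mult, Cmod_opp. lra.
Qed.

Lemma M2norm_lin x A B : M2norm (M2lin x A B) <= Cmod x * M2norm A + M2norm B.
Proof.
  unfold M2norm, M2lin; simpl.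
  pose proof (Cmod_lin x (m11 A) (m11 B)); pose proof (Cmod_lin x (m12 A) (m12 B)).
  pose proof (Cmod_lin x (m21 A) (m21 B)); pose proof (Cmod_lin x (m22 A) (m22 B)).
  lra.
Qed.

Lemma cayley_hamilton_l A B :
  M2det A = RtoC 1 -> M2mul A B = M2lin (M2tr A) B (M2mul (M2adj A) B).
Proof.
  destruct A as [a b c d], B as [x y z t]; unfold M2det, M2tr, M2mul, M2lin, M2adj; simpl; intros H.
  f_equal; ring.
Qed.

Lemma cayley_hamilton_r A B :
  M2det A = RtoC 1 -> M2mul B A = M2lin (M2tr A) B (M2mul B (M2adj A)).
Proof.
  destruct A as [a b c d], B as [x y z t]; unfold M2det, M2tr, M2mul, M2lin, M2adj; simpl; intros H.
  f_equal; ring.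
Qed.

Lemma Rle_sqrt_sum x y : 0 <= x -> 0 <= y -> sqrt (x ^ 2 + y ^ 2) <= x + y.
Proof.
  intros Hx Hy. rewrite <- (sqrt_pow2 (x + y)) by lra. apply sqrt_le_1_alt. nra.
Qed.

Lemma vnorm_unit_le v : vnorm v = 1 -> Cmod (fst v) <= 1 /\ Cmod (snd v) <= 1.
Proof.
  unfold vnorm. intros H.
  assert (H2 : Cmod (fst v) ^ 2 + Cmod (snd v) ^ 2 = 1).
  { rewrite <- (sqrt_sqrt (Cmod (fst v) ^ 2 + Cmod (snd v) ^ 2)).
    - rewrite H; ring.
    - pose proof (pow2_ge_0 (Cmod (fst v))); pose proof (pow2_ge_0 (Cmod (snd v))); lra. }
  pose proof (Cmod_ge_0 (fst v)); pose proof (Cmod_ge_0 (snd v)).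
  split; nra.
Qed.

Lemma opnorm_le_M2norm A : opnorm A <= M2norm A.
Proof.
  unfold opnorm.
  set (S := fun r => exists v : C * C, vnorm v = 1 /\ r = vnorm (M2apply A v)).
  assert (Hub : Rbar_le (Lub_Rbar S) (M2norm A)).
  { apply (proj2 (Lub_Rbar_correct S)). intros r (v & Hv & ->). simpl.
    destruct (vnorm_unit_le v Hv) as [H1 H2]. destruct v as [s t]; simpl in *.
    unfold vnorm, M2apply; simpl fst; simpl snd.
    eapply Rle_trans. apply Rle_sqrt_sum; apply Cmod_ge_0.
    pose proof (Cmod_mul_add (m11 A) s (m12 A) t).
    pose proof (Cmod_mul_add (m21 A) s (m22 A) t).
    pose proof (Cmod_ge_0 (m11 A)); pose proof (Cmod_ge_0 (m12 A)).
    pose proof (Cmod_ge_0 (m21 A)); pose proof (Cmod_ge_0 (m22 A)).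
    unfold M2norm. nra. }
  (* [Hub] rules out [p_infty], and [real] would turn [m_infty] into 0. *)
  destruct (Lub_Rbar S) as [r| |]; simpl in *; try easy.
  apply M2norm_ge0.
Qed.

(** * Rotation by alpha and continued fractions *)

Lemma Int_part_le x : IZR (Int_part x) <= x < IZR (Int_part x) + 1.
Proof. destruct (base_Int_part x); lra. Qed.

Lemma Int_part_unique x z : IZR z <= x < IZR z + 1 -> Int_part x = z.
Proof.
  intros H. pose proof (Int_part_le x) as H'.
  assert (Int_part x < z + 1)%Z by (apply lt_IZR; rewrite plus_IZR; lra).
  assert (z < Int_part x + 1)%Z by (apply lt_IZR; rewrite plus_IZR; lra).
  lia.
Qed.

Lemma Int_part_addZ x z : Int_part (x + IZR z) = (Int_part x + z)%Z.
Proof.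
  apply Int_part_unique. rewrite plus_IZR. pose proof (Int_part_le x). lra.
Qed.

Section Sturmian.
Context (alpha : R).

Definition irrational := forall p q : Z, (q > 0)%Z -> alpha <> IZR p / IZR q.
Definition disp (q p : Z) : R := IZR q * alpha - IZR p.
(* Letters q steps apart agree where neither x nor x + alpha is bad. *)
Definition bad (q p : Z) (x : R) : Prop := Int_part (x + disp q p) <> Int_part x.

(* The second approximant is allowed to be (0, 1), the formal convergent 1/0. *)
Definition adjacent (q p q' p' : Z) : Prop :=
  (1 <= q)%Z /\ (0 <= q')%Z /\ (Z.abs (p * q' - p' * q) = 1)%Z /\
  disp q p * disp q' p' < 0.

Lemma disp_add q p q' p' : disp (q + q') (p + p') = disp q p + disp q' p'.
Proof. unfold disp. rewrite !plus_IZR. ring. Qed.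

Lemma irrational_disp : irrational -> forall q p, (0 < q)%Z -> disp q p <> 0.
Proof.
  intros Hirr q p Hq H. apply (Hirr p q). lia. unfold disp in H.
  assert (0 < IZR q) by (apply IZR_lt; lia). field_simplify_eq; lra.
Qed.

(* In the lattice basis given by two adjacent approximants, an integer point with
   0 < n < q + q' has coordinates i, j of opposite signs, so that its displacement
   i D + j D' does not cancel. *)
Lemma best_approximation q p q' p' n m :
  adjacent q p q' p' -> (0 < n < q + q')%Z ->
  disp q p * disp q p <= disp n m * disp q p \/
  disp q' p' * disp q' p' <= disp n m * disp q' p'.
Proof.
  intros (Hq & Hq' & Hdet & Hs) Hn.
  (* [e] is the determinant of the basis, equal to 1 or -1, so Cramer's rule gives integer
     coordinates. *)
  set (e := (p * q' - p' * q)%Z) in *.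
  set (i := (e * (m * q' - n * p'))%Z). set (j := (e * (n * p - m * q))%Z).
  assert (He : (e * e = 1)%Z) by nia.
  assert (En : (n = i * q + j * q')%Z).
  { transitivity (e * e * n)%Z. rewrite He; ring. unfold i, j. unfold e at 2. ring. }
  assert (Em : (m = i * p + j * p')%Z).
  { transitivity (e * e * m)%Z. rewrite He; ring. unfold i, j. unfold e at 2. ring. }
  assert (Ev : disp n m = IZR i * disp q p + IZR j * disp q' p').
  { unfold disp. rewrite En, Em, !plus_IZR, !mult_IZR. ring. }
  clearbody i j. rewrite Ev. clear Ev Em Hdet.
  destruct (Z_le_gt_dec 1 i) as [Hi|Hi]; destruct (Z_le_gt_dec 1 j) as [Hj|Hj].
  - exfalso. nia.
  - left. apply IZR_le in Hi. assert (Hj' : IZR j <= 0) by (apply IZR_le; lia). nra.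
  - right. apply IZR_le in Hj. assert (Hi' : IZR i <= 0) by (apply IZR_le; lia). nra.
  - exfalso. nia.
Qed.

Lemma bad_witness q p x : bad q p x ->
  exists m : Z, (0 < disp q p /\ x < IZR m <= x + disp q p) \/
                (disp q p < 0 /\ x + disp q p < IZR m <= x).
Proof.
  unfold bad. intros H. set (d := disp q p) in *.
  pose proof (Int_part_le x) as H1. pose proof (Int_part_le (x + d)) as H2.
  assert (Hc : (Int_part (x + d) < Int_part x)%Z \/ (Int_part x < Int_part (x + d))%Z) by lia.
  destruct Hc as [Hc|Hc].
  - exists (Int_part x). right.
    assert (IZR (Int_part (x + d)) + 1 <= IZR (Int_part x)).
    { rewrite <- plus_IZR. apply IZR_le. lia. }
    lra.
  - exists (Int_part (x + d)). left.
    assert (IZR (Int_part x) + 1 <= IZR (Int_part (x + d))).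
    { rewrite <- plus_IZR. apply IZR_le. lia. }
    lra.
Qed.

Lemma not_bad_between q p x z :
  IZR z <= x < IZR z + 1 -> IZR z <= x + disp q p < IZR z + 1 -> ~ bad q p x.
Proof.
  unfold bad. intros H1 H2 H. apply H.
  rewrite (Int_part_unique _ _ H1), (Int_part_unique _ _ H2). reflexivity.
Qed.

Lemma bad_addZ q p x z : bad q p (x + IZR z) <-> bad q p x.
Proof.
  unfold bad. replace (x + IZR z + disp q p) with (x + disp q p + IZR z) by ring.
  rewrite !Int_part_addZ. split; intros H H'; apply H; lia.
Qed.

(** Combining the two integers that witness badness gives an integer pair with denominator q - c
    whose displacement lies strictly between D and D', which have opposite signs. For 0 < q - c < q
    + q' this contradicts [best_approximation]. *)
Lemma bad_bad_far q p q' p' x c :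
  adjacent q p q' p' -> bad q p x -> bad q' p' (x + IZR c * alpha) ->
  ~ (- q' < c < q)%Z.
Proof.
  intros Hadj H1 H2 Hc.
  destruct (bad_witness _ _ _ H1) as [m Hm]. destruct (bad_witness _ _ _ H2) as [m' Hm'].
  pose proof (best_approximation q p q' p' (q - c) (p + m - m') Hadj ltac:(lia)) as HB.
  destruct Hadj as (_ & _ & _ & Hs).
  assert (E : disp (q - c) (p + m - m') = disp q p - IZR c * alpha - IZR m + IZR m').
  { unfold disp. rewrite !minus_IZR, plus_IZR. ring. }
  rewrite E in HB. clear E.
  set (d := disp q p) in *. set (d' := disp q' p') in *. set (y := IZR c * alpha) in *.
  destruct Hm as [Hm|Hm]; destruct Hm' as [Hm'|Hm']; destruct HB as [HB|HB]; nra.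
Qed.

(** Both orbit points have an integer within |D| on the same side, so n has a displacement smaller
    than |D| in modulus, hence smaller than both approximants allow for n < q + q''. *)
Lemma bad_spacing q p q'' p'' x n :
  adjacent q p q'' p'' -> Rabs (disp q p) <= Rabs (disp q'' p'') ->
  bad q p x -> bad q p (x + IZR n * alpha) -> (0 < n)%Z -> (q + q'' <= n)%Z.
Proof.
  intros Hadj Habs H1 H2 Hn.
  destruct (Z_lt_le_dec n (q + q'')) as [Hlt|]; [exfalso|assumption].
  destruct (bad_witness _ _ _ H1) as [m Hm]. destruct (bad_witness _ _ _ H2) as [m' Hm'].
  pose proof (best_approximation q p q'' p'' n (m' - m) Hadj ltac:(lia)) as HB.
  destruct Hadj as (_ & _ & _ & Hs).
  assert (E : disp n (m' - m) = IZR n * alpha + IZR m - IZR m').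
  { unfold disp. rewrite !minus_IZR. ring. }
  rewrite E in HB. clear E.
  set (d := disp q p) in *. set (d' := disp q'' p'') in *. set (y := IZR n * alpha) in *.
  assert (Habs2 : d * d <= d' * d').
  { pose proof (Rabs_pos d). rewrite <- (Rabs_pos_eq (d * d)), <- (Rabs_pos_eq (d' * d')) by nra.
    rewrite !Rabs_mult. nra. }
  assert (Hlt2 : - Rabs d < y + IZR m - IZR m' < Rabs d).
  { unfold Rabs. destruct (Rcase_abs d); lra. }
  set (w := y + IZR m - IZR m') in *.
  assert (Hw : w * w < d * d).
  { unfold Rabs in Hlt2. destruct (Rcase_abs d); nra. }
  pose proof (pow2_ge_0 (w - d)). pose proof (pow2_ge_0 (w - d')).
  destruct HB; nra.
Qed.

Context (Hirr : irrational) (H01 : 0 < alpha < 1).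

Definition quot (k : nat) : Z := Int_part (/ gauss_iter alpha k).

Fixpoint conv (u v : Z) (k : nat) : Z :=
  match k with
  | O => u
  | S O => v
  | S (S i as j) => (quot i * conv u v j + conv u v i)%Z
  end.

(* Indices are shifted by one: [cfq (S k)], [cfp (S k)] are the usual q_k, p_k; [cfq 0] is
   q_(-1) = 0. *)
Definition cfq := conv 0 1.
Definition cfp := conv 1 0.
Definition cfd (k : nat) : R := disp (cfq k) (cfp k).

Lemma cfq_rec k : cfq (S (S k)) = (quot k * cfq (S k) + cfq k)%Z.
Proof. reflexivity. Qed.

Lemma cfp_rec k : cfp (S (S k)) = (quot k * cfp (S k) + cfp k)%Z.
Proof. reflexivity. Qed.

Lemma cfd_rec k : cfd (S (S k)) = IZR (quot k) * cfd (S k) + cfd k.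
Proof.
  unfold cfd. rewrite cfq_rec, cfp_rec. unfold disp.
  rewrite !plus_IZR, !mult_IZR. ring.
Qed.

(** The ratio of consecutive displacements is minus the Gauss iterate. This ties the digits to the
    convergents and makes the displacements alternate in sign; irrationality keeps the iterates away
    from 0. *)
Lemma gauss_invariant k :
  (0 <= cfq k)%Z /\ (1 <= cfq (S k))%Z /\ cfd k <> 0 /\
  0 < gauss_iter alpha k < 1 /\ cfd (S k) = - gauss_iter alpha k * cfd k.
Proof.
  induction k as [|k (H1 & H2 & H3 & H4 & H5)].
  - unfold cfd, cfq, cfp, disp; simpl. repeat split; try lia; lra.
  - set (g := gauss_iter alpha k) in *.
    assert (Hg : 1 < / g) by (rewrite <- Rinv_1; apply Rinv_lt_contravar; lra).
    assert (Hq : (1 <= quot k)%Z).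
    { unfold quot; fold g. pose proof (Int_part_le (/ g)).
      assert (0 < Int_part (/ g))%Z by (apply lt_IZR; lra). lia. }
    assert (Hq2 : (1 <= cfq (S (S k)))%Z) by (rewrite cfq_rec; nia).
    assert (Hd1 : cfd (S k) <> 0) by (apply irrational_disp; [assumption|lia]).
    assert (Hd2 : cfd (S (S k)) <> 0) by (apply irrational_disp; [assumption|lia]).
    assert (E : cfd (S (S k)) = - gauss_iter alpha (S k) * cfd (S k)).
    { rewrite cfd_rec. simpl gauss_iter. unfold frac. fold (quot k). fold g.
      rewrite H5. field. lra. }
    assert (Hge : 0 <= gauss_iter alpha (S k) < 1).
    { simpl. fold g. unfold frac. pose proof (Int_part_le (/ g)). lra. }
    repeat split; try lia; try assumption; try lra.
    destruct (Req_dec (gauss_iter alpha (S k)) 0) as [H|H]; [|lra].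
    exfalso. apply Hd2. rewrite E, H. ring.
Qed.

Lemma quot_ge1 k : (1 <= quot k)%Z.
Proof.
  destruct (gauss_invariant k) as (_ & _ & _ & Hg & _).
  assert (1 < / gauss_iter alpha k) by (rewrite <- Rinv_1; apply Rinv_lt_contravar; lra).
  unfold quot. pose proof (Int_part_le (/ gauss_iter alpha k)).
  assert (0 < Int_part (/ gauss_iter alpha k))%Z by (apply lt_IZR; lra). lia.
Qed.

Lemma cfq_ge0 k : (0 <= cfq k)%Z.
Proof. apply (gauss_invariant k). Qed.

Lemma cfq_ge1 k : (1 <= cfq (S k))%Z.
Proof. apply (gauss_invariant k). Qed.

Lemma cf_det k : (Z.abs (cfp (S k) * cfq k - cfp k * cfq (S k)) = 1)%Z.
Proof.
  induction k as [|k IH]. reflexivity.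
  rewrite cfq_rec, cfp_rec. rewrite <- IH, <- Z.abs_opp. f_equal. ring.
Qed.

(** Intermediate convergents: m = 0 gives [cfq k], and m = [quot k] gives [cfq (S (S k))]. *)
Definition cfq' (k m : nat) : Z := (cfq k + Z.of_nat m * cfq (S k))%Z.
Definition cfp' (k m : nat) : Z := (cfp k + Z.of_nat m * cfp (S k))%Z.

Lemma cfd'_eq k m : disp (cfq' k m) (cfp' k m) = cfd k + INR m * cfd (S k).
Proof.
  unfold cfd, disp, cfq', cfp'. rewrite !plus_IZR, !mult_IZR, <- !INR_IZR_INZ. ring.
Qed.

(** With g the Gauss iterate, c = 1/g - m. It is positive up to m = floor (1/g) because 1/g is not
    an integer, and it exceeds 1 for smaller m. *)
Lemma cfd'_sign k m : (Z.of_nat m <= quot k)%Z -> exists c, 0 < c /\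
  disp (cfq' k m) (cfp' k m) = - c * cfd (S k) /\ IZR (quot k) - INR m < c.
Proof.
  intros Hm. rewrite cfd'_eq.
  destruct (gauss_invariant k) as (_ & _ & Hd & Hg & E).
  destruct (gauss_invariant (S k)) as (_ & _ & _ & Hg' & E').
  set (g := gauss_iter alpha k) in *.
  assert (Hlt : IZR (quot k) < / g).
  { simpl in Hg'. unfold frac in Hg'. fold (quot k) in Hg'. fold g in Hg'. lra. }
  assert (INR m <= IZR (quot k)) by (rewrite INR_IZR_INZ; apply IZR_le; lia).
  exists (/ g - INR m). repeat split; try lra.
  rewrite E. field. lra.
Qed.

Lemma cf_adjacent k m : (Z.of_nat m <= quot k)%Z ->
  adjacent (cfq (S k)) (cfp (S k)) (cfq' k m) (cfp' k m).
Proof.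
  intros Hm. destruct (cfd'_sign k m Hm) as (c & Hc & E & _).
  pose proof (cfq_ge0 k). pose proof (cfq_ge1 k).
  repeat split; try lia.
  - unfold cfq'. nia.
  - rewrite <- (cf_det k). f_equal. unfold cfq', cfp'. ring.
  - rewrite E. fold (cfd (S k)).
    assert (cfd (S k) <> 0) by (apply irrational_disp; [assumption|lia]).
    assert (0 < cfd (S k) * cfd (S k)) by nra. nra.
Qed.

Lemma cfd'_abs k m : (Z.of_nat m < quot k)%Z ->
  Rabs (cfd (S k)) < Rabs (disp (cfq' k m) (cfp' k m)).
Proof.
  intros Hm. destruct (cfd'_sign k m ltac:(lia)) as (c & Hc & E & Hlt).
  rewrite E, Rabs_mult, Rabs_Ropp, (Rabs_pos_eq c) by lra.
  assert (cfd (S k) <> 0) by (apply (gauss_invariant (S k))).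
  pose proof (Rabs_pos_lt _ H).
  assert (INR m + 1 <= IZR (quot k)).
  { rewrite INR_IZR_INZ, <- plus_IZR. apply IZR_le. lia. }
  nra.
Qed.

Lemma cfd_sum_le k : Rabs (cfd (S k)) + Rabs (cfd (S (S k))) <= Rabs (cfd k).
Proof.
  destruct (gauss_invariant (S k)) as (_ & _ & _ & Hg & E).
  pose proof (cfd_rec k) as Er. rewrite E in Er.
  replace (cfd k) with (- ((IZR (quot k) + gauss_iter alpha (S k)) * cfd (S k))) by lra.
  rewrite E, Rabs_mult, !Rabs_Ropp, Rabs_mult.
  pose proof (IZR_le _ _ (quot_ge1 k)). pose proof (Rabs_pos (cfd (S k))).
  rewrite !Rabs_pos_eq with (x := gauss_iter alpha (S k)) by lra.
  rewrite Rabs_pos_eq with (x := IZR (quot k) + gauss_iter alpha (S k)) by lra. nra.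
Qed.

Lemma cfd_abs_le1 k : Rabs (cfd k) <= 1.
Proof.
  destruct k as [|k].
  - unfold cfd, disp, cfq, cfp; simpl. rewrite Rmult_0_l, Rminus_0_l, Rabs_Ropp, Rabs_R1. lra.
  - induction k as [|k IH].
    + unfold cfd, disp, cfq, cfp; simpl. rewrite Rabs_pos_eq; lra.
    + pose proof (cfd_sum_le k). pose proof (Rabs_pos (cfd (S k))).
      pose proof (cfd_sum_le (S k)). pose proof (Rabs_pos (cfd (S (S (S k))))).
      lra.
Qed.

(* [|D| + |D'| <= 1] fails only for the formal convergent (0, 1). *)
Lemma cfd'_sum k m : (Z.of_nat m <= quot k)%Z -> (1 <= k + m)%nat ->
  Rabs (cfd (S k)) + Rabs (disp (cfq' k m) (cfp' k m)) <= 1.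
Proof.
  intros Hm Hkm. destruct (cfd'_sign k m Hm) as (c & Hc & E & _).
  assert (Hd : cfd (S k) <> 0) by (apply (gauss_invariant (S k))).
  assert (Es : Rabs (cfd (S k)) + Rabs (disp (cfq' k m) (cfp' k m)) =
               Rabs (cfd k) - (INR m - 1) * Rabs (cfd (S k))).
  { rewrite E, Rabs_mult, Rabs_Ropp, (Rabs_pos_eq c) by lra.
    assert (E2 : cfd k = - (c + INR m) * cfd (S k)).
    { rewrite cfd'_eq in E. lra. }
    rewrite E2, Rabs_mult, Rabs_Ropp, (Rabs_pos_eq (c + INR m)) by (pose proof (pos_INR m); lra).
    ring. }
  rewrite Es. pose proof (Rabs_pos (cfd (S k))). pose proof (pos_INR m).
  destruct k as [|k].
  - assert (1 <= INR m) by (change 1 with (INR 1); apply le_INR; lia).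
    pose proof (cfd_abs_le1 0). nra.
  - pose proof (cfd_sum_le k). pose proof (cfd_abs_le1 k). nra.
Qed.

(** * The transfer matrix cocycle *)

Context (lambda : R) (E : C).

(** Written with floors instead of an indicator function, so that equality of words follows from
    floors agreeing along the orbits up to a common integer; [letter_sturm] identifies it with
    [sturm]. *)
Definition letter (x : R) : R := IZR (Int_part (x + alpha) - Int_part x).
Definition step (x : R) : M2 := transfer lambda E (letter x).

Fixpoint steps (x : R) (n : nat) : M2 :=
  match n with
  | O => M2id
  | S m => M2mul (step (x + INR m * alpha)) (steps x m)
  end.

(* For n < 0 this is the inverse of a forward product, so that [coc_add] holds for all integers. *)
Definition coc (x : R) (n : Z) : M2 :=
  if (0 <=? n)%Z then steps x (Z.to_nat n)
  else M2adj (steps (x + IZR n * alpha) (Z.to_nat (- n))).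

Lemma det_step x : M2det (step x) = RtoC 1.
Proof. unfold step, transfer, M2det; simpl. ring. Qed.

Lemma det_steps x n : M2det (steps x n) = RtoC 1.
Proof.
  induction n as [|n IH]; simpl. apply M2det_id.
  rewrite M2det_mul, det_step, IH. ring.
Qed.

Lemma det_coc x n : M2det (coc x n) = RtoC 1.
Proof. unfold coc. destruct (0 <=? n)%Z; rewrite ?M2det_adj; apply det_steps. Qed.

Lemma steps_front x n : steps x (S n) = M2mul (steps (x + alpha) n) (step x).
Proof.
  induction n as [|n IH].
  - simpl. rewrite M2mul_1r, M2mul_1l. f_equal. ring.
  - change (steps x (S (S n))) with (M2mul (step (x + INR (S n) * alpha)) (steps x (S n))).
    rewrite IH, M2mul_assoc. f_equal. simpl steps.
    replace (x + alpha + INR n * alpha) with (x + INR (S n) * alpha) by (rewrite S_INR; ring).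
    reflexivity.
Qed.

Lemma coc_0 x : coc x 0 = M2id.
Proof. reflexivity. Qed.

Lemma coc_succ x n : coc x (n + 1) = M2mul (step (x + IZR n * alpha)) (coc x n).
Proof.
  unfold coc. destruct (Z.leb_spec 0 n) as [Hn|Hn].
  - replace (0 <=? n + 1)%Z with true by (symmetry; apply Z.leb_le; lia).
    replace (Z.to_nat (n + 1)) with (S (Z.to_nat n)) by lia. simpl.
    rewrite INR_IZR_INZ, Z2Nat.id by lia. reflexivity.
  - assert (Hm : exists m, (n = - Z.of_nat (S m))%Z) by (exists (Z.to_nat (- n) - 1)%nat; lia).
    destruct Hm as [m Hm].
    replace (Z.to_nat (- n)) with (S m) by lia. rewrite steps_front, M2adj_mul.
    rewrite M2mul_cancel' by apply det_step.
    destruct (Z.leb_spec 0 (n + 1)).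
    + assert (m = 0%nat) by lia. subst m. replace (Z.to_nat (n + 1)) with 0%nat by lia.
      simpl. unfold M2adj, M2id; simpl. f_equal; ring.
    + replace (Z.to_nat (- (n + 1))) with m by lia.
      rewrite plus_IZR. do 2 f_equal. ring.
Qed.

Lemma coc_add x m n : coc x (m + n) = M2mul (coc (x + IZR m * alpha) n) (coc x m).
Proof.
  revert n. apply Z.bi_induction.
  - intros ? ? ->. reflexivity.
  - now rewrite Z.add_0_r, coc_0, M2mul_1l.
  - intros n. unfold Z.succ.
    replace (m + (n + 1))%Z with (m + n + 1)%Z by ring.
    rewrite !coc_succ, <- M2mul_assoc, plus_IZR.
    replace (x + IZR m * alpha + IZR n * alpha) with (x + (IZR m + IZR n) * alpha) by ring.
    split.
    + intros ->. reflexivity.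
    + intros H. apply (f_equal (M2mul (M2adj (step (x + (IZR m + IZR n) * alpha))))) in H.
      now rewrite !M2mul_cancel in H by apply det_step.
Qed.

Lemma coc_1 x : coc x 1 = step x.
Proof. change 1%Z with (0 + 1)%Z. rewrite coc_succ, coc_0, M2mul_1r. f_equal. ring. Qed.

Lemma coc_opp x n : coc x (- n) = M2adj (coc (x - IZR n * alpha) n).
Proof.
  pose proof (coc_add x (- n) n) as H. rewrite Z.add_opp_diag_l, coc_0, opp_IZR in H.
  replace (x + - IZR n * alpha) with (x - IZR n * alpha) in H by ring.
  apply (f_equal (M2mul (M2adj (coc (x - IZR n * alpha) n)))) in H.
  rewrite M2mul_cancel, M2mul_1r in H by apply det_coc. easy.
Qed.

Lemma coc_ext x y n :
  (forall i, (0 <= i < n)%Z -> letter (x + IZR i * alpha) = letter (y + IZR i * alpha)) ->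
  (0 <= n)%Z -> coc x n = coc y n.
Proof.
  intros H Hn. revert n Hn H. apply (natlike_ind (fun n => _ -> coc x n = coc y n)).
  - reflexivity.
  - intros n Hn IH H. unfold Z.succ. rewrite !coc_succ, IH.
    + unfold step. rewrite H by lia. reflexivity.
    + intros i Hi. apply H. lia.
Qed.

(** n letters involve n + 1 floors, hence the closed range for i; every later statement about
    periods inherits it. *)
Lemma coc_ext_Int_part x y z n :
  (forall i, (0 <= i <= n)%Z ->
     Int_part (x + IZR i * alpha) = (Int_part (y + IZR i * alpha) + z)%Z) ->
  (0 <= n)%Z -> coc x n = coc y n.
Proof.
  intros H Hn. apply coc_ext; [|assumption]. intros i Hi. unfold letter.
  replace (x + IZR i * alpha + alpha) with (x + IZR (i + 1) * alpha) by (rewrite plus_IZR; ring).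
  replace (y + IZR i * alpha + alpha) with (y + IZR (i + 1) * alpha) by (rewrite plus_IZR; ring).
  rewrite !H by lia. f_equal. lia.
Qed.

Lemma coc_addZ x z n : coc (x + IZR z) n = coc x n.
Proof.
  destruct (Z_le_gt_dec 0 n) as [Hn|Hn].
  - apply coc_ext_Int_part with (z := z); [|assumption]. intros i _.
    replace (x + IZR z + IZR i * alpha) with (x + IZR i * alpha + IZR z) by ring.
    apply Int_part_addZ.
  - replace n with (- (- n))%Z by ring. rewrite !(coc_opp _ (- n)). f_equal.
    replace (x + IZR z - IZR (- n) * alpha) with (x - IZR (- n) * alpha + IZR z) by ring.
    apply coc_ext_Int_part with (z := z); [|lia]. intros i _.
    replace (x - IZR (- n) * alpha + IZR z + IZR i * alpha)
      with (x - IZR (- n) * alpha + IZR i * alpha + IZR z) by ring.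
    apply Int_part_addZ.
Qed.

Lemma coc_period q p x n : (0 <= n)%Z ->
  (forall i, (0 <= i <= n)%Z -> ~ bad q p (x + IZR i * alpha)) ->
  coc (x + IZR q * alpha) n = coc x n.
Proof.
  intros Hn H. apply coc_ext_Int_part with (z := p); [|assumption].
  intros i Hi. destruct (Z.eq_dec (Int_part (x + IZR i * alpha + disp q p)) (Int_part (x + IZR i * alpha))) as [e|e].
  - rewrite <- e, <- Int_part_addZ. f_equal. unfold disp. ring.
  - destruct (H i Hi e).
Qed.

(** Moving the window by one conjugates the matrix by the first letter, provided the letter entering
    is the one leaving. That letter is determined by two floors, hence the two conditions. *)
Lemma tr_rotate q p x : (0 <= q)%Z -> ~ bad q p x -> ~ bad q p (x + alpha) ->
  M2tr (coc (x + alpha) q) = M2tr (coc x q).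
Proof.
  intros Hq H1 H2.
  assert (Es : step (x + IZR q * alpha) = step x).
  { rewrite <- !coc_1. apply coc_period with (p := p); [lia|].
    intros i Hi. assert (Hc : i = 0%Z \/ i = 1%Z) by lia. destruct Hc as [->| ->].
    - now rewrite Rmult_0_l, Rplus_0_r.
    - now rewrite Rmult_1_l. }
  pose proof (coc_add x 1 q) as Ha. rewrite Z.add_comm, coc_succ, coc_1, Es, Rmult_1_l in Ha.
  apply (f_equal (fun M => M2tr (M2mul (M2adj (step x)) M))) in Ha.
  rewrite M2mul_cancel in Ha by apply det_step. rewrite Ha.
  rewrite M2tr_mul_comm, <- M2mul_assoc, M2mul_adj_r by apply det_step. now rewrite M2mul_1r.
Qed.

Lemma tr_rotate_many q p x n : (0 <= q)%Z -> (0 <= n)%Z ->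
  (forall i, (0 <= i <= n)%Z -> ~ bad q p (x + IZR i * alpha)) ->
  M2tr (coc (x + IZR n * alpha) q) = M2tr (coc x q).
Proof.
  intros Hq Hn. revert n Hn. apply (natlike_ind (fun n => _ -> _)).
  - intros _. f_equal. f_equal. ring.
  - intros n Hn IH H. rewrite <- IH by (intros i Hi; apply H; lia).
    unfold Z.succ.
    replace (x + IZR (n + 1) * alpha) with (x + IZR n * alpha + alpha) by (rewrite plus_IZR; ring).
    apply tr_rotate with (p := p); [assumption|apply H; lia|].
    replace (x + IZR n * alpha + alpha) with (x + IZR (n + 1) * alpha) by (rewrite plus_IZR; ring).
    apply H; lia.
Qed.

Lemma argmin_range (f : Z -> R) (n : nat) (a : Z) :
  exists j, (a <= j <= a + Z.of_nat n)%Z /\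
    forall i, (a <= i <= a + Z.of_nat n)%Z -> f j <= f i.
Proof.
  induction n as [|n (j & Hj & H)].
  - exists a. split; [lia|]. intros i Hi. replace i with a by lia. lra.
  - destruct (Rle_dec (f j) (f (a + Z.of_nat (S n))%Z)) as [H1|H1].
    + exists j. split; [lia|]. intros i Hi.
      destruct (Z.eq_dec i (a + Z.of_nat (S n))) as [->|]; [assumption|apply H; lia].
    + exists (a + Z.of_nat (S n))%Z. split; [lia|]. intros i Hi.
      destruct (Z.eq_dec i (a + Z.of_nat (S n))) as [->|]; [lra|].
      assert (f j <= f i) by (apply H; lia). lra.
Qed.

(* The orbit point with the smallest fractional part reaches an integer before any other
   orbit point crosses one. *)
Lemma coc_lower x j n : (0 <= n)%Z ->
  (forall i, (0 <= i <= n)%Z -> frac (x + IZR j * alpha) <= frac (x + IZR i * alpha)) ->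
  coc x n = coc (x - frac (x + IZR j * alpha)) n.
Proof.
  intros Hn H. apply coc_ext_Int_part with (z := 0%Z); [|assumption].
  intros i Hi. rewrite Z.add_0_r. symmetry. apply Int_part_unique.
  specialize (H i Hi). unfold frac in *.
  pose proof (Int_part_le (x + IZR i * alpha)). pose proof (Int_part_le (x + IZR j * alpha)).
  lra.
Qed.

(** Sufficient conditions for the trace of a word of length q to be the same from every starting
    point that is not bad; see [tr_trc]. *)
Definition traceable (q p : Z) : Prop :=
  (1 <= q)%Z /\ Rabs (disp q p) < 1 /\
  exists q' p', adjacent q p q' p'.

(** Fewer than q steps cannot land between 0 and D modulo 1: [best_approximation] excludes the
    inside, irrationality the endpoints. *)
Lemma traceable_gap q p n m : traceable q p -> (0 < n < q)%Z ->
  ~ (0 < disp q p /\ 0 <= disp n m <= disp q p) /\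
  ~ (disp q p < 0 /\ disp q p <= disp n m <= 0).
Proof.
  intros (Hq & _ & q' & p' & Hadj) Hn.
  assert (Hn0 : disp n m <> 0) by (apply irrational_disp; [assumption|lia]).
  assert (Hne : disp n m <> disp q p).
  { intros Hne. apply (irrational_disp Hirr (q - n) (p - m)). lia.
    unfold disp in *. rewrite !minus_IZR. lra. }
  pose proof (best_approximation q p q' p' n m Hadj) as HB.
  destruct Hadj as (_ & Hq' & _ & Hs).
  specialize (HB ltac:(lia)). split; intros [H1 H2]; destruct HB; nra.
Qed.

(** Lower x until the lowest orbit point hits an integer, which leaves the word unchanged, then
    rotate the window to that integer. No point passed on the way is bad, by [traceable_gap]. *)
Lemma tr_canonical q p x : traceable q p -> ~ bad q p x ->
  M2tr (coc x q) = M2tr (coc (if Rlt_dec 0 (disp q p) then 0 else - alpha) q).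
Proof.
  intros Htr Hx. pose proof Htr as (Hq & Habs & _).
  assert (Hd : disp q p <> 0) by (apply irrational_disp; [assumption|lia]).
  destruct (Rlt_dec 0 (disp q p)) as [Hpos|Hneg].
  (* As x is not bad, x + q alpha lies D above x modulo 1, so the minimum over 0..q is attained
     before q. *)
  - destruct (argmin_range (fun i => frac (x + IZR i * alpha)) (Z.to_nat (q - 1)) 0) as (j & Hj & Hmin).
    rewrite Z2Nat.id in Hj, Hmin by lia.
    assert (Hq' : frac (x + IZR j * alpha) <= frac (x + IZR q * alpha)).
    { assert (H0 : frac (x + IZR j * alpha) <= frac (x + IZR 0 * alpha)) by (apply Hmin; lia).
      replace (x + IZR 0 * alpha) with x in H0 by ring.
      replace (x + IZR q * alpha) with (x + disp q p + IZR p) by (unfold disp; ring).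
      unfold frac at 2. rewrite Int_part_addZ, plus_IZR.
      replace (Int_part (x + disp q p)) with (Int_part x).
      unfold frac in *. lra.
      destruct (Z.eq_dec (Int_part (x + disp q p)) (Int_part x)) as [->|e]; [reflexivity|now destruct Hx]. }
    rewrite (coc_lower x j q).
    2: lia.
    2: { intros i Hi. destruct (Z.eq_dec i q) as [->|]; [assumption|apply Hmin; lia]. }
    set (c := x - frac (x + IZR j * alpha)).
    assert (Hc : c + IZR j * alpha = 0 + IZR (Int_part (x + IZR j * alpha))).
    { unfold c, frac. ring. }
    rewrite <- (tr_rotate_many q p c j); try lia.
    + rewrite Hc, coc_addZ. reflexivity.
    + intros i Hi Hb. replace (c + IZR i * alpha) with
        (- (IZR (j - i) * alpha) + IZR (Int_part (x + IZR j * alpha))) in Hb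
        by (rewrite minus_IZR; lra).
      apply bad_addZ in Hb.
      destruct (bad_witness _ _ _ Hb) as (m & Hm).
      destruct (Z.eq_dec (j - i) 0) as [H0|H0].
      * rewrite H0 in Hm.
        assert (Hd1 : disp q p < 1) by (apply Rabs_def2 in Habs; lra).
        assert (0 < m < 1)%Z by (split; apply lt_IZR; lra). lia.
      * destruct (traceable_gap q p (j - i) (- m) Htr ltac:(lia)) as [Hg _].
        apply Hg. unfold disp in *. rewrite opp_IZR. lra.
  - assert (Hneg' : disp q p < 0) by lra.
    (* Now x + q alpha lies below x modulo 1, so the minimum is attained at some j >= 1. The
       rotation stops one step before the integer, because for D < 0 the integer itself is bad. *)
    destruct (argmin_range (fun i => frac (x + IZR i * alpha)) (Z.to_nat (q - 1)) 1) as (j & Hj & Hmin).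
    rewrite Z2Nat.id in Hj, Hmin by lia.
    assert (Hq' : frac (x + IZR j * alpha) <= frac (x + IZR 0 * alpha)).
    { assert (H0 : frac (x + IZR j * alpha) <= frac (x + IZR q * alpha)) by (apply Hmin; lia).
      replace (x + IZR 0 * alpha) with x by ring.
      replace (x + IZR q * alpha) with (x + disp q p + IZR p) in H0 by (unfold disp; ring).
      unfold frac at 2 in H0. rewrite Int_part_addZ, plus_IZR in H0.
      replace (Int_part (x + disp q p)) with (Int_part x) in H0.
      unfold frac in *. lra.
      destruct (Z.eq_dec (Int_part (x + disp q p)) (Int_part x)) as [->|e]; [reflexivity|now destruct Hx]. }
    rewrite (coc_lower x j q).
    2: lia.
    2: { intros i Hi. destruct (Z.eq_dec i 0) as [->|]; [assumption|apply Hmin; lia]. }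
    set (c := x - frac (x + IZR j * alpha)).
    assert (Hc : c + IZR j * alpha = 0 + IZR (Int_part (x + IZR j * alpha))).
    { unfold c, frac. ring. }
    rewrite <- (tr_rotate_many q p c (j - 1)); try lia.
    + replace (c + IZR (j - 1) * alpha) with (- alpha + IZR (Int_part (x + IZR j * alpha)))
        by (rewrite minus_IZR; lra).
      now rewrite coc_addZ.
    + intros i Hi Hb. replace (c + IZR i * alpha) with
        (- (IZR (j - i) * alpha) + IZR (Int_part (x + IZR j * alpha))) in Hb
        by (rewrite minus_IZR; lra).
      apply bad_addZ in Hb.
      destruct (bad_witness _ _ _ Hb) as (m & Hm).
      destruct (Z.eq_dec (j - i) q) as [H0|H0].
      * rewrite H0 in Hm.
        assert (Hd1 : -1 < disp q p) by (apply Rabs_def2 in Habs; lra).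
        unfold disp in *.
        assert (0 < m + p < 1)%Z by (split; apply lt_IZR; rewrite plus_IZR; lra). lia.
      * destruct (traceable_gap q p (j - i) (- m) Htr ltac:(lia)) as [_ Hg].
        apply Hg. unfold disp in *. rewrite opp_IZR. lra.
Qed.

(** * Traces along convergents *)

(* The base point and its translate by the displacement both lie in (0, 1), so it is not bad. *)
Definition trc (q p : Z) : C := M2tr (coc ((1 - disp q p) / 2) q).

Lemma tr_trc q p x : traceable q p -> ~ bad q p x -> M2tr (coc x q) = trc q p.
Proof.
  intros Htr Hx. unfold trc. rewrite (tr_canonical q p x Htr Hx).
  symmetry. apply tr_canonical; [assumption|].
  destruct Htr as (_ & Habs & _). apply Rabs_def2 in Habs.
  apply not_bad_between with (z := 0%Z); lra.
Qed.

Lemma adjacent_sym q p q' p' :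
  (1 <= q')%Z -> adjacent q p q' p' -> adjacent q' p' q p.
Proof.
  intros H (H1 & H2 & H3 & H4). repeat split; try lia; try lra.
Qed.

Lemma adjacent_add q p q' p' : adjacent q p q' p' ->
  Rabs (disp q p) < Rabs (disp q' p') -> adjacent q p (q + q') (p + p').
Proof.
  intros (H1 & H2 & H3 & H4) Habs. repeat split; try lia.
  rewrite disp_add. unfold Rabs in Habs.
  destruct (Rcase_abs (disp q p)), (Rcase_abs (disp q' p')); nra.
Qed.

(** From a suitable point the word of length 2 q + q' reads A B A with A of length q and B of length
    q': the last block repeats the first since q + q' is a period there. [M2tr_ABA] then gives the
    trace map. *)
Lemma trace_relation q p q' p' :
  adjacent q p q' p' -> (1 <= q')%Z ->
  Rabs (disp q p) < Rabs (disp q' p') -> Rabs (disp q p) + Rabs (disp q' p') <= 1 ->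
  trc (q + (q + q')) (p + (p + p')) = (trc q p * trc (q + q') (p + p') - trc q' p')%C.
Proof.
  intros Hadj Hq' Hlt Hsum.
  pose proof (adjacent_sym _ _ _ _ Hq' Hadj) as Hadj'.
  pose proof (adjacent_add _ _ _ _ Hadj Hlt) as Hadjs.
  assert (Hq : (1 <= q)%Z) by apply Hadj.
  assert (Hadjs' : adjacent (q + q') (p + p') q p) by (apply adjacent_sym; [lia|assumption]).
  set (d := disp q p). set (d' := disp q' p').
  fold d d' in Hlt, Hsum.
  assert (Hdd : d * d' < 0) by apply Hadj.
  assert (Hsigns : (0 < d /\ d < - d' /\ d - d' <= 1) \/ (d < 0 /\ - d < d' /\ d' - d <= 1)).
  { unfold Rabs in Hlt, Hsum. destruct (Rcase_abs d), (Rcase_abs d'); nra. }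
  assert (Hds : disp (q + q') (p + p') = d + d') by apply disp_add.
  assert (Hdt : disp (q + (q + q')) (p + (p + p')) = d + (d + d')).
  { now rewrite disp_add, Hds. }
  assert (Tq : traceable q p).
  { repeat split; auto. fold d; apply Rabs_def1; lra. now exists q', p'. }
  assert (Tq' : traceable q' p').
  { repeat split; auto. fold d'; apply Rabs_def1; lra. now exists q, p. }
  assert (Ts : traceable (q + q') (p + p')).
  { repeat split; auto. lia. rewrite Hds; apply Rabs_def1; lra. now exists q, p. }
  assert (Tt : traceable (q + (q + q')) (p + (p + p'))).
  { repeat split; auto. lia. rewrite Hdt; apply Rabs_def1; lra.
    assert (Hne : d + (d + d') <> 0).
    { rewrite <- Hdt. apply irrational_disp; [assumption|lia]. }
    destruct Hadj as (_ & _ & Hdet & _).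
    (* D and D + D' have opposite signs, so one of the two is opposite to 2 D + D'. *)
    destruct (Rlt_dec (d * (d + (d + d'))) 0) as [Hs|Hs].
    - exists q, p. repeat split; try lia. rewrite Hdt; fold d. lra.
    - exists (q + q')%Z, (p + p')%Z. repeat split; try lia. rewrite Hdt, Hds. nra. }
  (* Both x and x + D = - D / 2 lie on the same side of 0, and so do the endpoints for q' and for 2
     q + q'; the half-integer multiples keep all of them off the integers. *)
  set (x := - (3 / 2 * d)).
  assert (Bq : ~ bad q p x).
  { apply not_bad_between with (z := if Rlt_dec 0 d then (-1)%Z else 0%Z);
      fold d; unfold x; destruct (Rlt_dec 0 d); lra. }
  assert (Bq' : ~ bad q' p' (x + IZR q * alpha)).
  { replace (x + IZR q * alpha) with (x + d + IZR p) by (unfold d, disp; ring).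
    rewrite bad_addZ.
    apply not_bad_between with (z := if Rlt_dec 0 d then (-1)%Z else 0%Z);
      fold d'; unfold x; destruct (Rlt_dec 0 d); lra. }
  assert (Bt : ~ bad (q + (q + q')) (p + (p + p')) x).
  { apply not_bad_between with (z := if Rlt_dec 0 d then (-1)%Z else 0%Z);
      rewrite ?Hdt; unfold x; destruct (Rlt_dec 0 d); lra. }
  assert (Bs : forall i, (0 <= i <= q)%Z -> ~ bad (q + q') (p + p') (x + IZR i * alpha)).
  { intros i Hi Hb. destruct (bad_witness _ _ _ Hb) as (m & Hm). rewrite Hds in Hm.
    set (n := (q - i)%Z).
    assert (En : IZR i * alpha = d + IZR p - IZR n * alpha).
    { unfold n, d, disp. rewrite minus_IZR. ring. }
    unfold x in Hm. rewrite En in Hm.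
    destruct (Z.eq_dec n 0) as [Hn|Hn].
    - rewrite Hn in Hm.
      assert (-1 < p - m < 1)%Z by (split; apply lt_IZR; rewrite minus_IZR; lra).
      assert (Hm0 : IZR m = IZR p) by (f_equal; lia). lra.
    - pose proof (best_approximation q p q' p' n (p - m) Hadj ltac:(lia)) as HB.
      assert (Ev : disp n (p - m) = IZR n * alpha - IZR p + IZR m)
        by (unfold disp; rewrite minus_IZR; ring).
      rewrite Ev in HB. fold d d' in HB. nra. }
  rewrite <- (tr_trc _ _ x Tt Bt), <- (tr_trc _ _ x Tq Bq), <- (tr_trc _ _ _ Tq' Bq').
  rewrite <- (tr_trc _ _ x Ts) by (specialize (Bs 0%Z ltac:(lia)); now rewrite Rmult_0_l, Rplus_0_r in Bs).
  rewrite (Z.add_comm q (q + q')), (coc_add x (q + q') q).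
  rewrite (coc_period _ (p + p')) by (assumption || lia).
  rewrite (coc_add x q q').
  apply M2tr_ABA, det_coc.
Qed.

(* Traces of M_(k-1), M_(k-1) M_k and M_(k-1) M_k^m in the usual notation. *)
Definition trx (k : nat) : C := trc (cfq k) (cfp k).
Definition trz (k : nat) : C := trc (cfq k + cfq (S k)) (cfp k + cfp (S k)).
Definition trm (k m : nat) : C := trc (cfq' k m) (cfp' k m).

Lemma trm_0 k : trm k 0 = trx k.
Proof. unfold trm, trx, cfq', cfp'. f_equal; ring. Qed.

Lemma trm_1 k : trm k 1 = trz k.
Proof. unfold trm, trz, cfq', cfp'. f_equal; ring. Qed.

Lemma trm_quot k : trm k (Z.to_nat (quot k)) = trx (S (S k)).
Proof.
  pose proof (quot_ge1 k).
  unfold trm, trx, cfq', cfp'. rewrite cfq_rec, cfp_rec, Z2Nat.id by lia.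
  f_equal; ring.
Qed.

Lemma trm_quot_S k : trm k (S (Z.to_nat (quot k))) = trz (S k).
Proof.
  pose proof (quot_ge1 k).
  unfold trm, trz, cfq', cfp'. rewrite cfq_rec, cfp_rec.
  rewrite Nat2Z.inj_succ, Z2Nat.id by lia. f_equal; ring.
Qed.

Lemma trx_0 : trx 0 = RtoC 2.
Proof.
  unfold trx, trc. change (cfq 0) with 0%Z. rewrite coc_0. unfold M2tr, M2id; simpl.
  rewrite <- RtoC_plus. reflexivity.
Qed.

Lemma letter_eq x a b :
  IZR a <= x < IZR a + 1 -> IZR b <= x + alpha < IZR b + 1 -> letter x = IZR (b - a).
Proof.
  intros Ha Hb. unfold letter.
  now rewrite (Int_part_unique _ _ Ha), (Int_part_unique _ _ Hb).
Qed.

Lemma coc_one_letter x b : letter x = b -> coc x 1 = transfer lambda E b.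
Proof. intros <-. apply coc_1. Qed.

(** The displacements alpha and alpha - 1 of the two approximants of length one select the letters 0
    and 1; this and [trz_0] are the initial data of the trace map. *)
Lemma trx_1 : trx 1 = E.
Proof.
  unfold trx, trc. change (cfq 1) with 1%Z. change (cfp 1) with 0%Z.
  rewrite (coc_one_letter _ 0).
  - unfold M2tr, transfer; simpl. rewrite Rmult_0_r. ring.
  - apply (letter_eq _ 0 0); unfold disp; lra.
Qed.

Lemma trz_0 : trz 0 = (E - RtoC lambda)%C.
Proof.
  unfold trz, trc. change (cfq 0 + cfq 1)%Z with 1%Z. change (cfp 0 + cfp 1)%Z with 1%Z.
  rewrite (coc_one_letter _ 1).
  - unfold M2tr, transfer; simpl. rewrite Rmult_1_r. ring.
  - apply (letter_eq _ 0 1); unfold disp; lra.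
Qed.

Lemma trm_0_2 : trm 0 2 = (E * (E - RtoC lambda) - RtoC 2)%C.
Proof.
  unfold trm, trc. change (cfq' 0 2) with 2%Z. change (cfp' 0 2) with 1%Z.
  set (x := (1 - disp 2 1) / 2). assert (Ex : x = 1 - alpha) by (unfold x, disp; field).
  change (coc x 2) with (coc x (1 + 1)). rewrite coc_add.
  rewrite (coc_one_letter x 1), (coc_one_letter _ 0).
  - unfold M2tr, M2mul, transfer. apply injective_projections; simpl; ring.
  - apply (letter_eq _ 1 1); lra.
  - apply (letter_eq _ 0 1); unfold disp; lra.
Qed.

Lemma trm_rec k m : (Z.of_nat m < quot k)%Z ->
  trm k (S (S m)) = (trx (S k) * trm k (S m) - trm k m)%C.
Proof.
  (* For k = m = 0 the second approximant is the formal convergent (0, 1), to which [trace_relation]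
     does not apply; this instance is computed directly. *)
  intros Hm. destruct (Nat.eq_dec (k + m) 0) as [H0|H0].
  - assert (k = 0%nat /\ m = 0%nat) as [-> ->] by lia.
    rewrite trm_0_2, trm_0, trm_1, trx_0, trx_1, trz_0. reflexivity.
  - pose proof (cf_adjacent k m ltac:(lia)) as Hadj.
    pose proof (cfq_ge0 k). pose proof (cfq_ge1 k).
    assert (Hq' : (1 <= cfq' k m)%Z).
    { unfold cfq'. destruct k as [|k]; [nia|].
      pose proof (cfq_ge1 k). nia. }
    pose proof (trace_relation _ _ _ _ Hadj Hq'
      (cfd'_abs k m Hm) (cfd'_sum k m ltac:(lia) ltac:(lia))) as HR.
    unfold trm, trx.
    replace (cfq' k (S (S m))) with (cfq (S k) + (cfq (S k) + cfq' k m))%Z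
      by (unfold cfq'; lia).
    replace (cfp' k (S (S m))) with (cfp (S k) + (cfp (S k) + cfp' k m))%Z
      by (unfold cfp'; lia).
    rewrite HR. f_equal. f_equal. f_equal; unfold cfq', cfp'; lia.
Qed.

(** * Escape and boundedness of the trace map *)

(** For x = tr A, y = tr B, z = tr AB in determinant one, this is the trace of the commutator of A
    and B, plus 2. *)
Definition fricke (x y z : C) : C := (x * x + y * y + z * z - x * y * z)%C.

Lemma fricke_quadratic_bound x y z s K :
  fricke x y z = RtoC s -> Cmod x <= K -> Cmod y <= K ->
  Cmod z * Cmod z <= Rabs s + 2 * (K * K) + K * K * Cmod z.
Proof.
  intros HI Hx Hy.
  assert (Ez : (z * z = (RtoC s + - (x * x)) + (- (y * y) + x * y * z))%C).
  { rewrite <- HI. unfold fricke. ring. }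
  rewrite <- Cmod_mult, Ez.
  pose proof (Cmod_triangle (RtoC s + - (x * x)) (- (y * y) + x * y * z)).
  pose proof (Cmod_triangle (RtoC s) (- (x * x))).
  pose proof (Cmod_triangle (- (y * y)) (x * y * z)).
  rewrite !Cmod_opp, !Cmod_mult, Cmod_R in *.
  pose proof (Cmod_ge_0 x); pose proof (Cmod_ge_0 y); pose proof (Cmod_ge_0 z).
  assert (Cmod x * Cmod x <= K * K) by nra. assert (Cmod y * Cmod y <= K * K) by nra.
  assert (Cmod x * Cmod y <= K * K) by nra.
  assert (Cmod x * Cmod y * Cmod z <= K * K * Cmod z) by nra. lra.
Qed.

(** The invariant is a monic quadratic in z whose coefficients are controlled by K and s. *)
Lemma fricke_bound x y z s K : 1 <= K ->
  fricke x y z = RtoC s -> Cmod x <= K -> Cmod y <= K ->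
  Cmod z <= Rabs s + 3 * (K * K).
Proof.
  intros HK HI Hx Hy. pose proof (fricke_quadratic_bound x y z s K HI Hx Hy).
  pose proof (Rabs_pos s).
  destruct (Rle_dec (Cmod z) (Rabs s + 3 * (K * K))) as [|Hn]; [assumption|exfalso].
  assert (1 <= K * K) by nra. assert (1 <= Cmod z) by lra. nra.
Qed.

Lemma Cmod_lin_ge x a b : Cmod x * Cmod a <= Cmod (x * a - b) + Cmod b.
Proof.
  rewrite <- Cmod_mult. replace (x * a)%C with ((x * a - b) + b)%C at 1 by ring.
  apply Cmod_triangle.
Qed.

Lemma quot_nat k : exists a, Z.to_nat (quot k) = S a /\ quot k = Z.of_nat (S a).
Proof.
  pose proof (quot_ge1 k). exists (Z.to_nat (quot k) - 1)%nat. lia.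
Qed.

(** Vieta: the recursion replaces one root of the invariant, as a quadratic in [trm k m], by the
    other. *)
Lemma trm_invariant k m : (Z.of_nat m <= quot k)%Z ->
  fricke (trm k 0) (trx (S k)) (trm k 1) = RtoC (4 + lambda * lambda) ->
  fricke (trm k m) (trx (S k)) (trm k (S m)) = RtoC (4 + lambda * lambda).
Proof.
  intros Hm H0. induction m as [|m IH]; [assumption|].
  rewrite <- IH by lia. rewrite (trm_rec k m) by lia.
  unfold fricke. ring.
Qed.

Lemma trace_invariant k : fricke (trx k) (trx (S k)) (trz k) = RtoC (4 + lambda * lambda).
Proof.
  induction k as [|k IH].
  - rewrite (trx_0), (trx_1), (trz_0).
    unfold fricke. apply injective_projections; simpl; ring.
  - pose proof (trm_invariant k (Z.to_nat (quot k))) as H.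
    rewrite trm_0, trm_1, trm_quot, trm_quot_S in H by assumption.
    rewrite <- H; [unfold fricke; ring| |assumption].
    pose proof (quot_ge1 k). lia.
Qed.

(** The last clause starts the monotonicity of m |-> |trm k m|. The threshold 3 makes it persist
    with a gain: |t''| >= 3 |t'| - |t| >= 2 |t'| whenever |t| <= |t'|. *)
Definition escapes (k : nat) : Prop :=
  3 <= Cmod (trx (S k)) /\ 3 <= Cmod (trz k) /\ Cmod (trx k) <= Cmod (trz k).

Lemma escapes_trm k m : escapes k -> (Z.of_nat m <= quot k)%Z ->
  Cmod (trm k m) <= Cmod (trm k (S m)) /\ Cmod (trz k) <= Cmod (trm k (S m)).
Proof.
  intros (H1 & H2 & H3) Hm. induction m as [|m IH].
  - rewrite trm_0, trm_1. lra.
  - destruct IH as [IH1 IH2]; [lia|].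
    rewrite (trm_rec k m) by lia.
    pose proof (Cmod_lin_ge (trx (S k)) (trm k (S m)) (trm k m)).
    nra.
Qed.

Lemma escapes_S k : escapes k ->
  escapes (S k) /\ Cmod (trz k) <= Cmod (trx (S (S k))) /\ 2 * Cmod (trz k) <= Cmod (trz (S k)).
Proof.
  intros He. destruct (quot_nat k) as (a & Ea & Eq).
  destruct (escapes_trm k a He) as [Ha1 Ha2]; [lia|].
  pose proof (trm_rec k a ltac:(lia)) as Hr.
  rewrite <- Ea in *. rewrite trm_quot in *|-.
  rewrite trm_quot_S in Hr by assumption.
  pose proof (Cmod_lin_ge (trx (S k)) (trx (S (S k))) (trm k a)) as Hge. rewrite <- Hr in Hge.
  destruct He as (H1 & H2 & H3). unfold escapes. nra.
Qed.

Lemma escapes_grow k j : escapes k ->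
  escapes (k + j) /\ 2 ^ j * 3 <= Cmod (trz (k + j)) /\ 2 ^ j * 3 <= Cmod (trx (S (S (k + j)))).
Proof.
  intros He. induction j as [|j (IH1 & IH2 & IH3)].
  - rewrite Nat.add_0_r. destruct (escapes_S k He) as (_ & Hx & _).
    destruct He as (H1 & H2 & H3). unfold escapes; simpl. lra.
  - rewrite Nat.add_succ_r. destruct (escapes_S _ IH1) as (H1 & H2 & H3).
    destruct (escapes_S _ H1) as (_ & H4 & _). simpl pow.
    repeat split; try apply H1; lra.
Qed.

Lemma escapes_large k N B : escapes k -> exists j, (N <= j)%nat /\
  B <= Cmod (trx (S j)) /\ B <= Cmod (trz j).
Proof.
  intros He.
  destruct (nfloor_ex (Rmax 0 B)) as [n [_ Hn]]; [apply Rmax_l|].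
  assert (HB : forall i, (n < i)%nat -> B <= 2 ^ i * 3).
  { intros i Hi. pose proof (Rmax_r 0 B).
    assert (H2 : INR i <= 2 ^ i).
    { clear. induction i as [|i IH]; [simpl; lra|]. rewrite S_INR; simpl.
      pose proof (pow_R1_Rle 2 i ltac:(lra)). lra. }
    assert (INR n + 1 <= INR i) by (rewrite <- S_INR; apply le_INR; lia).
    pose proof (pos_INR i). lra. }
  exists (S (k + (S n + N))). split; [lia|].
  destruct (escapes_grow k (S n + N) He) as (_ & _ & H3).
  destruct (escapes_grow k (S (S n + N)) He) as (_ & H2 & _).
  rewrite Nat.add_succ_r in H2.
  split; (eapply Rle_trans; [|eassumption]); apply HB; lia.
Qed.

(* If [trx (S (S k))] is large, non-escape forces m |-> trm k m to decrease in modulus, so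
   [trx k] is at least as large. *)
Lemma trx_bounded B : (forall k, ~ escapes k) -> Cmod E <= B ->
  forall n, Cmod (trx n) <= 33 + lambda * lambda + B.
Proof.
  intros Hne HB. pose proof (Cmod_ge_0 E) as HE0.
  assert (HL : 0 <= lambda * lambda) by nra.
  assert (Hpair : forall n, Cmod (trx n) <= 33 + lambda * lambda + B /\
                            Cmod (trx (S n)) <= 33 + lambda * lambda + B).
  2: { intros n. apply Hpair. }
  induction n as [|k [IH0 IH1]].
  - rewrite (trx_0), (trx_1), Cmod_R, Rabs_pos_eq by lra. lra.
  - split; [assumption|].
    destruct (Rle_dec (Cmod (trx (S (S k)))) (33 + lambda * lambda + B)) as [|Hbig]; [assumption|exfalso].
    apply Rnot_le_lt in Hbig.
    assert (Hz : Cmod (trz (S k)) < 3 \/ Cmod (trz (S k)) < Cmod (trx (S k))).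
    { specialize (Hne (S k)). unfold escapes in Hne.
      destruct (Rlt_dec (Cmod (trz (S k))) 3); [now left|].
      destruct (Rlt_dec (Cmod (trz (S k))) (Cmod (trx (S k)))); [now right|].
      exfalso. apply Hne. repeat split; lra. }
    (* If it is at most 3, so is [trz (S k)], and the invariant bounds [trx (S (S k))] by 4 +
       lambda^2 + 27; this accounts for the constant 33. *)
    destruct (Rle_dec (Cmod (trx (S k))) 3) as [Hsmall|Hc].
    + pose proof (trace_invariant (S k)) as HI.
      assert (HI' : fricke (trx (S k)) (trz (S k)) (trx (S (S k))) = RtoC (4 + lambda * lambda)).
      { rewrite <- HI. unfold fricke. ring. }
      pose proof (fricke_bound _ _ _ _ 3 ltac:(lra) HI' Hsmall ltac:(destruct Hz; lra)) as Hb.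
      rewrite Rabs_pos_eq in Hb by lra. lra.
    + apply Rnot_le_lt in Hc.
      assert (Hz' : Cmod (trz (S k)) < Cmod (trx (S k))) by (destruct Hz; lra). clear Hz.
      destruct (quot_nat k) as (a & Ea & Eq).
      assert (Hdown : forall i m, (m + i = a)%nat ->
        Cmod (trm k (S m)) <= Cmod (trm k m) /\ Cmod (trx (S (S k))) <= Cmod (trm k m)).
      { induction i as [|i IHi]; intros m Hm.
        - assert (m = a) by lia. subst m.
          pose proof (trm_rec k a ltac:(lia)) as Hr.
          rewrite <- Ea in *. rewrite trm_quot in * by assumption.
          rewrite trm_quot_S in Hr by assumption.
          replace (trm k a) with (trx (S k) * trx (S (S k)) - trz (S k))%C by (rewrite Hr; ring).
          pose proof (Cmod_lin_ge (trx (S k)) (trx (S (S k))) (trz (S k))). nra.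
        - destruct (IHi (S m)) as [H1 H2]; [lia|].
          pose proof (trm_rec k m ltac:(lia)) as Hr.
          replace (trm k m) with (trx (S k) * trm k (S m) - trm k (S (S m)))%C by (rewrite Hr; ring).
          pose proof (Cmod_lin_ge (trx (S k)) (trm k (S m)) (trm k (S (S m)))). nra. }
      destruct (Hdown a 0%nat eq_refl) as [_ H0]. rewrite trm_0 in H0. lra.
Qed.

Lemma traces_bounded B : (forall k, ~ escapes k) -> Cmod E <= B ->
  let K := 33 + lambda * lambda + B in
  forall n, Cmod (trx n) <= 5 + lambda * lambda + 3 * (K * K) /\
            Cmod (trz n) <= 5 + lambda * lambda + 3 * (K * K).
Proof.
  intros Hne HB K n. pose proof (trx_bounded B Hne HB) as Hx. fold K in Hx.
  pose proof (Cmod_ge_0 E). assert (HK : 1 <= K) by (unfold K; nra).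
  assert (K <= K * K) by nra.
  pose proof (Hx n).
  pose proof (fricke_bound _ _ _ _ K HK (trace_invariant n) (Hx n) (Hx (S n))) as Hz.
  rewrite Rabs_pos_eq in Hz by nra. nra.
Qed.

(** * Norm growth from one convergent to the next *)

Definition cnorm (x : R) (n : Z) : R := M2norm (coc x n).

Lemma cnorm_ge0 x n : 0 <= cnorm x n.
Proof. apply M2norm_ge0. Qed.

Lemma cnorm_opp x n : cnorm x (- n) = cnorm (x - IZR n * alpha) n.
Proof. unfold cnorm. now rewrite coc_opp, M2norm_adj. Qed.

(** Negative n is included so that a reduction by two periods may overshoot the word and leave the
    inverse of a shorter one. *)
Definition cbound (l : Z) (g : R) : Prop :=
  forall x n, (Z.abs n <= l)%Z -> cnorm x n <= g.

Lemma cbound_nonneg l g : (forall x n, (0 <= n <= l)%Z -> cnorm x n <= g) -> cbound l g.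
Proof.
  intros H x n Hn. destruct (Z_le_gt_dec 0 n).
  - apply H. lia.
  - replace n with (- (- n))%Z by ring. rewrite cnorm_opp. apply H. lia.
Qed.

Section Reduction.
Context (K : R) (q p : Z) (Htr : traceable q p) (HK : Cmod (trc q p) <= K).

(* Cayley-Hamilton for the last period; when L < 2 q the second term is the inverse of a
   shorter word. *)
Lemma reduce_periodic x L : (q <= L)%Z ->
  (forall i, (0 <= i <= L - q)%Z -> ~ bad q p (x + IZR i * alpha)) ->
  cnorm x L <= K * cnorm x (L - q) + cnorm (x + IZR q * alpha) (L - 2 * q).
Proof.
  intros HL H. unfold cnorm.
  set (y := x + IZR (L - q) * alpha).
  assert (Ea : coc x L = M2mul (coc y q) (coc x (L - q))).
  { unfold y. rewrite <- coc_add. f_equal. ring. }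
  assert (Eb : M2mul (M2adj (coc y q)) (coc x (L - q)) = coc (x + IZR q * alpha) (L - 2 * q)).
  { rewrite <- (coc_period q p x (L - q)) by (assumption || lia).
    replace (L - 2 * q)%Z with ((L - q) + - q)%Z by ring.
    rewrite coc_add, coc_opp. do 4 f_equal. unfold y. ring. }
  rewrite Ea, cayley_hamilton_l, Eb by apply det_coc.
  eapply Rle_trans. apply M2norm_lin.
  apply Rplus_le_compat_r, Rmult_le_compat_r; [apply M2norm_ge0|].
  unfold y. rewrite (tr_trc q p); [assumption|assumption|apply H; lia].
Qed.

(** Only the square at the right end has to be unbroken, so a break further left is harmless.
    [reduce_left] is the mirror image. *)
Lemma reduce_right x L : (0 <= q)%Z ->
  (forall i, (L - 2 * q <= i <= L - q)%Z -> ~ bad q p (x + IZR i * alpha)) ->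
  cnorm x L <= K * cnorm x (L - q) + cnorm x (L - 2 * q).
Proof.
  intros Hq H. unfold cnorm.
  set (y := x + IZR (L - q) * alpha).
  assert (Ea : coc x L = M2mul (coc y q) (coc x (L - q))).
  { unfold y. rewrite <- coc_add. f_equal. ring. }
  assert (Ey : coc y q = coc (x + IZR (L - 2 * q) * alpha) q).
  { replace y with (x + IZR (L - 2 * q) * alpha + IZR q * alpha)
      by (unfold y; rewrite !minus_IZR, mult_IZR; ring).
    apply coc_period with (p := p); [assumption|]. intros i Hi.
    replace (x + IZR (L - 2 * q) * alpha + IZR i * alpha)
      with (x + IZR (L - 2 * q + i) * alpha) by (rewrite plus_IZR; ring).
    apply H. lia. }
  assert (Eb : M2mul (M2adj (coc y q)) (coc x (L - q)) = coc x (L - 2 * q)).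
  { rewrite Ey. replace (L - q)%Z with (L - 2 * q + q)%Z by ring.
    rewrite coc_add. apply M2mul_cancel, det_coc. }
  rewrite Ea, cayley_hamilton_l, Eb by apply det_coc.
  eapply Rle_trans. apply M2norm_lin.
  apply Rplus_le_compat_r, Rmult_le_compat_r; [apply M2norm_ge0|].
  unfold y. rewrite (tr_trc q p); [assumption|assumption|apply H; lia].
Qed.

Lemma reduce_left x L : (0 <= q)%Z ->
  (forall i, (0 <= i <= q)%Z -> ~ bad q p (x + IZR i * alpha)) ->
  cnorm x L <= K * cnorm (x + IZR q * alpha) (L - q) + cnorm (x + IZR (2 * q) * alpha) (L - 2 * q).
Proof.
  intros Hq H. unfold cnorm.
  assert (Ea : coc x L = M2mul (coc (x + IZR q * alpha) (L - q)) (coc x q)).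
  { rewrite <- coc_add. f_equal. ring. }
  assert (Ey : coc (x + IZR q * alpha) q = coc x q) by (apply coc_period with (p := p); assumption).
  assert (Eb : M2mul (coc (x + IZR q * alpha) (L - q)) (M2adj (coc x q))
               = coc (x + IZR (2 * q) * alpha) (L - 2 * q)).
  { replace (L - q)%Z with (q + (L - 2 * q))%Z by ring.
    rewrite coc_add, Ey, <- M2mul_assoc, M2mul_adj_r, M2mul_1r by apply det_coc.
    f_equal. rewrite mult_IZR. ring. }
  rewrite Ea, cayley_hamilton_r, Eb by apply det_coc.
  eapply Rle_trans. apply M2norm_lin.
  apply Rplus_le_compat_r, Rmult_le_compat_r; [apply M2norm_ge0|].
  rewrite (tr_trc q p); [assumption|assumption|].
  specialize (H 0%Z ltac:(lia)). now rewrite Rmult_0_l, Rplus_0_r in H.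
Qed.

Lemma cnorm_periodic g j x L : cbound q g ->
  (0 <= L <= (Z.of_nat j + 1) * q)%Z ->
  (forall i, (0 <= i <= L - q)%Z -> ~ bad q p (x + IZR i * alpha)) ->
  cnorm x L <= (K + 1) ^ j * g.
Proof.
  intros Hg. assert (Hq : (1 <= q)%Z) by apply Htr.
  assert (HK0 : 0 <= K) by (eapply Rle_trans; [apply Cmod_ge_0|exact HK]).
  assert (Hg0 : 0 <= g) by (eapply Rle_trans; [apply (cnorm_ge0 0 0)|apply Hg; lia]).
  revert x L. induction j as [|j IH]; intros x L HL H.
  - simpl. rewrite Rmult_1_l. apply Hg. lia.
  - assert (Hp : 1 <= (K + 1) ^ j) by (apply pow_R1_Rle; lra).
    destruct (Z_le_gt_dec L q) as [Hs|Hs].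
    + assert (cnorm x L <= g) by (apply Hg; lia).
      assert (1 <= (K + 1) ^ (S j)) by (apply pow_R1_Rle; lra). nra.
    + eapply Rle_trans. apply reduce_periodic; [lia|assumption].
      assert (H1 : cnorm x (L - q) <= (K + 1) ^ j * g).
      { apply IH; [lia|]. intros i Hi. apply H. lia. }
      assert (H2 : cnorm (x + IZR q * alpha) (L - 2 * q) <= (K + 1) ^ j * g).
      { destruct (Z_le_gt_dec 0 (L - 2 * q)).
        - apply IH; [lia|]. intros i Hi.
          replace (x + IZR q * alpha + IZR i * alpha) with (x + IZR (q + i) * alpha)
            by (rewrite plus_IZR; ring).
          apply H. lia.
        - assert (cnorm (x + IZR q * alpha) (L - 2 * q) <= g) by (apply Hg; lia). nra. }
      rewrite <- tech_pow_Rmult, Rmult_assoc.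
      set (P := (K + 1) ^ j * g) in *. nra.
Qed.
End Reduction.

(** [bad_bad_far] excludes an open range of positions where periodicity needs a closed one; one
    letter at each end makes up the difference. *)
Lemma cnorm_strip (kap : R) x L : (forall y, M2norm (step y) <= kap) ->
  cnorm x L <= kap * kap * cnorm (x + IZR 1 * alpha) (L - 2).
Proof.
  intros Hk. unfold cnorm.
  assert (Ea : coc x L = M2mul (coc (x + IZR (L - 1) * alpha) 1)
                           (M2mul (coc (x + IZR 1 * alpha) (L - 2)) (coc x 1))).
  { rewrite <- !coc_add. replace (1 + (L - 2))%Z with (L - 1)%Z by ring.
    rewrite <- coc_add. f_equal. ring. }
  rewrite Ea, !coc_1.
  eapply Rle_trans. apply M2norm_mul.
  pose proof (M2norm_mul (coc (x + IZR 1 * alpha) (L - 2)) (step x)) as H.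
  pose proof (Hk x) as H1. pose proof (Hk (x + IZR (L - 1) * alpha)) as H2.
  set (s := M2norm (step x)) in *.
  set (t := M2norm (step (x + IZR (L - 1) * alpha))) in *.
  set (c := M2norm (coc (x + IZR 1 * alpha) (L - 2))) in *.
  assert (0 <= s) by apply M2norm_ge0. assert (0 <= t) by apply M2norm_ge0.
  assert (0 <= c) by apply M2norm_ge0.
  assert (c * s <= kap * c) by nra.
  assert (t * (kap * c) <= kap * (kap * c)) by (apply Rmult_le_compat_r; nra).
  nra.
Qed.

Lemma cfq_traceable k : traceable (cfq (S k)) (cfp (S k)).
Proof.
  repeat split; [now apply cfq_ge1| |].
  - destruct (gauss_invariant k) as (_ & _ & Hd & Hg & E1).
    change (Rabs (cfd (S k)) < 1).
    rewrite E1, Rabs_mult, Rabs_Ropp, Rabs_pos_eq by lra.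
    pose proof (cfd_abs_le1 k). pose proof (Rabs_pos_lt _ Hd). nra.
  - pose proof (quot_ge1 k).
    exists (cfq' k 0), (cfp' k 0). apply cf_adjacent; [assumption..|lia].
Qed.

Lemma cfq'_0 k : cfq' k 0 = cfq k /\ cfp' k 0 = cfp k.
Proof. unfold cfq', cfp'. split; ring. Qed.

Lemma cf_adjacent_prev k : adjacent (cfq (S k)) (cfp (S k)) (cfq k) (cfp k).
Proof.
  pose proof (quot_ge1 k). destruct (cfq'_0 k) as [<- <-].
  apply cf_adjacent; [assumption..|lia].
Qed.

Lemma cf_adjacent_mediant k :
  adjacent (cfq (S k)) (cfp (S k)) (cfq k + cfq (S k)) (cfp k + cfp (S k)).
Proof.
  pose proof (quot_ge1 k).
  replace (cfq k + cfq (S k))%Z with (cfq' k 1) by (unfold cfq'; ring).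
  replace (cfp k + cfp (S k))%Z with (cfp' k 1) by (unfold cfp'; ring).
  apply cf_adjacent; [assumption..|lia].
Qed.

Lemma cf_mediant_traceable k :
  traceable (cfq (S k) + cfq (S (S k))) (cfp (S k) + cfp (S (S k))).
Proof.
  pose proof (cfq_ge1 k). pose proof (cfq_ge1 (S k)).
  repeat split; [lia| |].
  - pose proof (cf_adjacent_mediant (S k)) as (_ & _ & _ & Hs).
    pose proof (cfq_traceable k) as (_ & Ha & _).
    pose proof (cfq_traceable (S k)) as (_ & Hb & _).
    rewrite disp_add in *. apply Rabs_def2 in Ha. apply Rabs_def2 in Hb.
    pose proof (cf_adjacent_prev (S k)) as (_ & _ & _ & Hp).
    set (d := disp (cfq (S (S k))) (cfp (S (S k)))) in *.
    set (e := disp (cfq (S k)) (cfp (S k))) in *.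
    apply Rabs_def1; nra.
  - exists (cfq (S (S k))), (cfp (S (S k))). apply adjacent_sym; [lia|]. apply cf_adjacent_mediant.
Qed.

(** Apply [bad_spacing] to the intermediate convergent with m = [quot k] - 1, the last one that is
    farther from 0; the two lengths add up to the next convergent. *)
Lemma bad_cf_spacing k x n :
  bad (cfq (S k)) (cfp (S k)) x -> bad (cfq (S k)) (cfp (S k)) (x + IZR n * alpha) ->
  (0 < n)%Z -> (cfq (S (S k)) <= n)%Z.
Proof.
  intros H1 H2 Hn. pose proof (quot_ge1 k) as Hq.
  destruct (quot_nat k) as (a & _ & Ea).
  pose proof (bad_spacing _ _ (cfq' k a) (cfp' k a) x n
    (cf_adjacent k a ltac:(lia))) as H.
  assert (H' : (cfq (S k) + cfq' k a <= n)%Z).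
  { apply H; try assumption. apply Rlt_le. apply (cfd'_abs k a). lia. }
  rewrite cfq_rec, Ea. unfold cfq' in H'. lia.
Qed.

Section Level.
Context (K kap : R) (HK0 : 0 <= K) (Hkap1 : 1 <= kap)
  (Hstep : forall y, M2norm (step y) <= kap)
  (Hx : forall i, Cmod (trx i) <= K)
  (Hz : forall i, Cmod (trz i) <= K).
Context (j : nat).
Local Notation q := (cfq (S (S j))).
Local Notation p := (cfp (S (S j))).
Local Notation q' := (cfq (S j)).
Local Notation p' := (cfp (S j)).
Local Notation a' := (Z.to_nat (quot j)).

(* Once one letter is removed on each side, the word lies in a run of period q'. *)
Lemma cnorm_core g x L b : cbound q' g ->
  bad q p (x + IZR b * alpha) -> (0 <= b <= q')%Z -> (b + q <= L <= b + q + q')%Z ->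
  cnorm x L <= kap * kap * ((K + 1) ^ (a' + 2) * g).
Proof.
  intros Hg Hb Hb0 HL.
  pose proof (cfq_ge1 j) as Hq'1. pose proof (cfq_ge1 (S j)) as Hq1.
  pose proof (quot_ge1 j) as Ha.
  eapply Rle_trans. apply cnorm_strip; exact Hstep.
  apply Rmult_le_compat_l; [nra|].
  destruct (Z_le_gt_dec 0 (L - 2)) as [HL2|HL2].
  2: { assert (cnorm (x + IZR 1 * alpha) (L - 2) <= g) by (apply Hg; lia).
       assert (0 <= g) by (eapply Rle_trans; [apply (cnorm_ge0 0 0)|apply Hg; lia]).
       assert (1 <= (K + 1) ^ (a' + 2)) by (apply pow_R1_Rle; lra). nra. }
  apply (cnorm_periodic K q' p' (cfq_traceable j) (Hx (S j))); [assumption| |].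
  - pose proof (cfq_rec j) as Hrec.
    assert (Hqj : (cfq j <= q')%Z).
    { destruct j as [|i]; [change (cfq 0) with 0%Z; lia|].
      rewrite (cfq_rec i). pose proof (quot_ge1 i).
      pose proof (cfq_ge1 i). pose proof (cfq_ge0 i). nia. }
    split; [assumption|].
    replace (Z.of_nat (a' + 2)) with (quot j + 2)%Z by lia. nia.
  - intros i Hi Hc.
    apply (bad_bad_far _ _ _ _ (x + IZR b * alpha) (1 + i - b) (cf_adjacent_prev (S j)) Hb).
    + replace (x + IZR b * alpha + IZR (1 + i - b) * alpha)
        with (x + IZR 1 * alpha + IZR i * alpha) by (rewrite minus_IZR, plus_IZR; ring).
      assumption.
    + lia.
Qed.

Definition core_const g := kap * kap * ((K + 1) ^ (a' + 3) * g).

(** The period q fails at the break, but r = q + q' persists across it by [bad_bad_far]. One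
    reduction by r leaves a word that misses the break and a middle piece that either misses it too
    or is short enough for [cnorm_core]. A word shorter than r is such a core itself. *)
Lemma cnorm_straddle g x L b : cbound q g ->
  bad q p (x + IZR b * alpha) ->
  (forall i, (0 <= i <= L - q)%Z -> i <> b -> ~ bad q p (x + IZR i * alpha)) ->
  (0 <= b <= q)%Z -> (b + q <= L <= b + 2 * q)%Z ->
  cnorm x L <= core_const g.
Proof.
  intros Hg Hb Huniq Hb0 HL.
  pose proof (cfq_ge1 j) as Hq'1. pose proof (cfq_ge1 (S j)) as Hq1.
  pose proof (quot_ge1 j) as Ha.
  assert (Hqq' : (q' <= q)%Z).
  { rewrite (cfq_rec j). pose proof (cfq_ge0 j). nia. }
  assert (Hg' : cbound q' g) by (intros y n Hn; apply Hg; lia).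
  assert (Hg0 : 0 <= g) by (eapply Rle_trans; [apply (cnorm_ge0 0 0)|apply Hg; lia]).
  set (g1 := kap * kap * ((K + 1) ^ (a' + 2) * g)).
  assert (Hg1 : (K + 1) * g <= g1).
  { unfold g1. rewrite pow_add. assert (1 <= (K + 1) ^ a') by (apply pow_R1_Rle; lra).
    assert (1 <= kap * kap) by nra. set (P := (K + 1) ^ a') in *.
    assert (K + 1 <= P * (K + 1) ^ 2) by (simpl; nra).
    assert (0 <= (K + 1) * g) by nra.
    assert ((K + 1) * g <= P * (K + 1) ^ 2 * g) by nra. nra. }
  assert (Eg1 : core_const g = (K + 1) * g1).
  { unfold core_const, g1. replace (a' + 3)%nat with (S (a' + 2)) by lia.
    rewrite <- tech_pow_Rmult. ring. }
  assert (Hg10 : 0 <= g1) by nra.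
  rewrite Eg1.
  assert (Hper : forall u w, (0 <= u)%Z -> (w <= L)%Z -> (0 <= w - u <= 2 * q)%Z ->
    (b < u \/ w < b + q)%Z -> cnorm (x + IZR u * alpha) (w - u) <= (K + 1) * g).
  { intros u w Hu Hw Huw Hside. rewrite <- (pow_1 (K + 1)).
    apply (cnorm_periodic K q p (cfq_traceable (S j)) (Hx (S (S j)))); [assumption|lia|].
    intros i Hi. replace (x + IZR u * alpha + IZR i * alpha) with (x + IZR (u + i) * alpha)
      by (rewrite plus_IZR; ring).
    apply Huniq; lia. }
  assert (Hcore : forall u w, (b - q' <= u <= b)%Z -> (b + q <= w <= b + q + q')%Z ->
    cnorm (x + IZR u * alpha) (w - u) <= g1).
  { intros u w Hu Hw. apply (cnorm_core g _ _ (b - u)); [assumption| |lia|lia].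
    replace (x + IZR u * alpha + IZR (b - u) * alpha) with (x + IZR b * alpha)
      by (rewrite minus_IZR; ring). assumption. }
  set (r := (q' + q)%Z).
  destruct (Z_le_gt_dec r L) as [HrL|HrL].
  - eapply Rle_trans.
    { apply (reduce_periodic K r (p' + p) (cf_mediant_traceable j) (Hz (S j))); [assumption|].
      intros i Hi Hc.
      apply (bad_bad_far _ _ _ _ (x + IZR b * alpha) (i - b) (cf_adjacent_mediant (S j)) Hb).
      - replace (x + IZR b * alpha + IZR (i - b) * alpha) with (x + IZR i * alpha)
          by (rewrite minus_IZR; ring). assumption.
      - unfold r in *. lia. }
    assert (H1 : cnorm x (L - r) <= g1).
    { specialize (Hper 0%Z (L - r)%Z). rewrite Rmult_0_l, Rplus_0_r, Z.sub_0_r in Hper.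
      eapply Rle_trans; [|exact Hg1]. apply Hper; unfold r in *; lia. }
    assert (H2 : cnorm (x + IZR r * alpha) (L - 2 * r) <= g1).
    { destruct (Z_le_gt_dec 0 (L - 2 * r)) as [Hs|Hs].
      - eapply Rle_trans; [|exact Hg1].
        replace (L - 2 * r)%Z with ((L - r) - r)%Z by ring. apply Hper; unfold r in *; lia.
      (* The length is negative here: this is the inverse of the overlap from L - r to r. *)
      - assert (Esym : cnorm (x + IZR r * alpha) (L - 2 * r)
                       = cnorm (x + IZR (L - r) * alpha) (r - (L - r))).
        { replace (L - 2 * r)%Z with (- (r - (L - r)))%Z by ring.
          rewrite cnorm_opp. f_equal. rewrite !minus_IZR. ring. }
        rewrite Esym.
        destruct (Z_lt_le_dec r (b + q)) as [Hr1|Hr1];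
          [eapply Rle_trans; [|exact Hg1]; apply Hper; unfold r in *; lia|].
        destruct (Z_lt_le_dec b (L - r)) as [Hr2|Hr2];
          [eapply Rle_trans; [|exact Hg1]; apply Hper; unfold r in *; lia|].
        apply Hcore; unfold r in *; lia. }
    nra.
  - assert (H1 : cnorm x L <= g1).
    { specialize (Hcore 0%Z L). rewrite Rmult_0_l, Rplus_0_r, Z.sub_0_r in Hcore.
      apply Hcore; unfold r in *; lia. }
    nra.
Qed.

(** By [bad_cf_spacing] the word has at most one break. Periods are removed on a side with a full
    square clear of the break, at a factor K + 1 each, until the break is near both ends and
    [cnorm_straddle] applies. *)
Lemma cnorm_level g m x L : cbound q g ->
  (0 <= L <= (Z.of_nat m + 1) * q)%Z -> (L <= cfq (S (S (S j))))%Z ->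
  cnorm x L <= (K + 1) ^ m * core_const g.
Proof.
  intros Hg. pose proof (cfq_ge1 (S j)) as Hq1.
  assert (Hg0 : 0 <= g) by (eapply Rle_trans; [apply (cnorm_ge0 0 0)|apply Hg; lia]).
  assert (HgH : g <= core_const g).
  { unfold core_const. assert (1 <= (K + 1) ^ (a' + 3)) by (apply pow_R1_Rle; lra).
    assert (1 <= kap * kap) by nra.
    assert (g <= (K + 1) ^ (a' + 3) * g) by nra. nra. }
  set (H := core_const g) in *.
  revert x L. induction m as [|m IH]; intros x L HL HLQ.
  - simpl. rewrite Rmult_1_l. assert (cnorm x L <= g) by (apply Hg; lia). lra.
  - assert (Hp : 1 <= (K + 1) ^ m) by (apply pow_R1_Rle; lra).
    assert (Hp' : 1 <= (K + 1) ^ (S m)) by (apply pow_R1_Rle; lra).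
    destruct (Z_le_gt_dec L q) as [Hs|Hs].
    { assert (cnorm x L <= g) by (apply Hg; lia). nra. }
    assert (Hsmall : forall y n, (Z.abs n <= q)%Z -> cnorm y n <= (K + 1) ^ m * H).
    { intros y n Hn. assert (cnorm y n <= g) by (apply Hg; lia). nra. }
    assert (Hcomb : forall u v, u <= (K + 1) ^ m * H -> v <= (K + 1) ^ m * H ->
      cnorm x L <= K * u + v -> cnorm x L <= (K + 1) ^ (S m) * H).
    { intros u v Hu Hv Huv. rewrite <- tech_pow_Rmult, Rmult_assoc. nra. }
    destruct (classic (exists b, (0 <= b <= L - q)%Z /\ bad q p (x + IZR b * alpha)))
      as [(b & Hb0 & Hb)|Hno].
    + assert (Huniq : forall i, (0 <= i <= L - q)%Z -> i <> b -> ~ bad q p (x + IZR i * alpha)).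
      { intros i Hi Hne Hc. destruct (Z_lt_le_dec b i).
        - assert (cfq (S (S (S j))) <= i - b)%Z; [|lia].
          apply (bad_cf_spacing (S j) (x + IZR b * alpha)); [assumption| |lia].
          replace (x + IZR b * alpha + IZR (i - b) * alpha) with (x + IZR i * alpha)
            by (rewrite minus_IZR; ring). assumption.
        - assert (cfq (S (S (S j))) <= b - i)%Z; [|lia].
          apply (bad_cf_spacing (S j) (x + IZR i * alpha)); [assumption| |lia].
          replace (x + IZR i * alpha + IZR (b - i) * alpha) with (x + IZR b * alpha)
            by (rewrite minus_IZR; ring). assumption. }
      (* The extra 1 makes the square at the right end start strictly after the break. *)
      destruct (Z_le_gt_dec (b + 2 * q + 1) L) as [Hr|Hr].
      { eapply Hcomb; [..|apply (reduce_right K q p (cfq_traceable (S j)) (Hx (S (S j))))].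
        - apply IH; lia.
        - apply IH; lia.
        - lia.
        - intros i Hi. apply Huniq; lia. }
      destruct (Z_le_gt_dec (q + 1) b) as [Hl|Hl].
      { eapply Hcomb; [..|apply (reduce_left K q p (cfq_traceable (S j)) (Hx (S (S j))))].
        - apply IH; lia.
        - apply IH; lia.
        - lia.
        - intros i Hi. apply Huniq; lia. }
      assert (cnorm x L <= H) by (apply cnorm_straddle with (b := b); [assumption..|lia|lia]).
      nra.
    + eapply Hcomb; [..|apply (reduce_periodic K q p (cfq_traceable (S j)) (Hx (S (S j))))].
      * apply IH; lia.
      * destruct (Z_le_gt_dec 0 (L - 2 * q)); [apply IH; lia|apply Hsmall; lia].
      * lia.
      * intros i Hi Hc. apply Hno. exists i. split; [lia|assumption].
Qed.

Lemma cbound_level g : cbound q g ->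
  cbound (cfq (S (S (S j))))
    ((K + 1) ^ Z.to_nat (quot (S j)) * core_const g).
Proof.
  intros Hg. apply cbound_nonneg. intros x n Hn.
  pose proof (quot_ge1 (S j)).
  pose proof (cfq_ge1 j) as Hq'1.
  apply cnorm_level; [assumption| |lia].
  rewrite (cfq_rec (S j)) in Hn.
  assert (Hqq' : (q' <= q)%Z).
  { rewrite (cfq_rec j). pose proof (cfq_ge0 j).
    pose proof (quot_ge1 j). nia. }
  rewrite Z2Nat.id by lia. lia.
Qed.
End Level.
End Sturmian.

(** * Bounded density *)

Section Density.
Context (alpha : R) (Hirr : irrational alpha) (H01 : 0 < alpha < 1).

Fixpoint quot_sum (k : nat) : nat :=
  match k with
  | O => Z.to_nat (quot alpha 0)
  | S i => quot_sum i + Z.to_nat (quot alpha (S i))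
  end.

Lemma quot_sum_digits k : INR (quot_sum k) = sum_f_R0 (cf_digit alpha) k.
Proof.
  assert (H : forall i, INR (Z.to_nat (quot alpha i)) = cf_digit alpha i).
  { intros i. pose proof (quot_ge1 alpha Hirr H01 i).
    rewrite INR_IZR_INZ, Z2Nat.id by lia. reflexivity. }
  induction k as [|k IH]; simpl.
  - apply H.
  - rewrite plus_INR, IH, H. reflexivity.
Qed.

Lemma eventually_bounded_nat (u : nat -> R) M N :
  (forall n, (N <= n)%nat -> u n <= M) -> exists B, forall n, u n <= B.
Proof.
  revert M. induction N as [|N IH]; intros M H.
  - exists M. intros n. apply H. lia.
  - apply (IH (Rmax M (u N))). intros n Hn.
    destruct (Nat.eq_dec n N) as [->|]; [apply Rmax_r|].
    eapply Rle_trans; [apply H; lia|apply Rmax_l].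
Qed.

Lemma bounded_density_quot_sum : bounded_density alpha ->
  exists B : nat, forall k, (quot_sum k <= B * S k)%nat.
Proof.
  unfold bounded_density. set (u := fun k : nat => sum_f_R0 (cf_digit alpha) k / INR (S k)).
  intros Hb. assert (Hl : is_LimSup_seq u (LimSup_seq u)) by (unfold LimSup_seq; apply proj2_sig).
  assert (He : exists M N, forall n, (N <= n)%nat -> u n <= M).
  { destruct (LimSup_seq u) as [l| |]; simpl in *; try easy.
    - destruct (Hl (mkposreal 1 Rlt_0_1)) as [_ [N HN]]. exists (l + 1), N.
      intros n Hn. apply Rlt_le. apply (HN n Hn).
    - destruct (Hl 0) as [N HN]. exists 0, N. intros n Hn. apply Rlt_le, HN, Hn. }
  destruct He as (M & N & He). destruct (eventually_bounded_nat u M N He) as [B HB].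
  destruct (nfloor_ex (Rmax 0 B)) as [m [_ Hm]]; [apply Rmax_l|].
  exists (S m). intros k. apply INR_le. rewrite quot_sum_digits, mult_INR.
  specialize (HB k). unfold u in HB. pose proof (Rmax_r 0 B).
  assert (Hk : 0 < INR (S k)) by (apply lt_0_INR; lia).
  apply (Rmult_le_compat_r (INR (S k))) in HB; [|lra].
  unfold Rdiv in HB. rewrite Rmult_assoc, Rinv_l, Rmult_1_r in HB by lra.
  rewrite (S_INR m). eapply Rle_trans; [exact HB|].
  apply Rmult_le_compat_r; lra.
Qed.

Lemma cfq_double k : (2 * cfq alpha (S k) <= cfq alpha (S (S (S k))))%Z.
Proof.
  pose proof (quot_ge1 alpha Hirr H01 k). pose proof (quot_ge1 alpha Hirr H01 (S k)).
  pose proof (cfq_ge1 alpha Hirr H01 k). pose proof (cfq_ge0 alpha Hirr H01 k).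
  assert (cfq alpha (S k) <= cfq alpha (S (S k)))%Z by (rewrite (cfq_rec alpha k); nia).
  rewrite (cfq_rec alpha (S k)). nia.
Qed.

(** This turns bounds exponential in the level into bounds polynomial in the length. *)
Lemma cfq_pow2 i : (2 ^ Z.of_nat i <= cfq alpha (S (2 * i)))%Z.
Proof.
  induction i as [|i IH].
  - simpl. change (cfq alpha 1) with 1%Z. lia.
  - replace (S (2 * S i)) with (S (S (S (2 * i)))) by lia.
    rewrite Nat2Z.inj_succ, Z.pow_succ_r by lia. pose proof (cfq_double (2 * i)). lia.
Qed.

Section Bound.
Context (lambda K kap : R) (HK0 : 0 <= K) (Hkap1 : 1 <= kap).

(** All that the growth estimate uses about E. K and kap are fixed beforehand, so the estimate is
    uniform in E. *)
Definition tame (E : C) : Prop :=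
  (forall y, M2norm (step alpha lambda E y) <= kap) /\
  (forall i, Cmod (trx alpha lambda E i) <= K) /\
  (forall i, Cmod (trz alpha lambda E i) <= K).

Lemma cnorm_le_pow E x n : (forall y, M2norm (step alpha lambda E y) <= kap) ->
  cnorm alpha lambda E x (Z.of_nat n) <= 2 * kap ^ n.
Proof.
  intros H. induction n as [|n IH].
  - unfold cnorm. change (Z.of_nat 0) with 0%Z. rewrite coc_0. unfold M2norm, M2id; simpl.
    rewrite Cmod_1, Cmod_0. lra.
  - unfold cnorm in *. rewrite Nat2Z.inj_succ. unfold Z.succ. rewrite coc_succ.
    eapply Rle_trans. apply M2norm_mul. simpl.
    pose proof (H (x + IZR (Z.of_nat n) * alpha)).
    pose proof (M2norm_ge0 (step alpha lambda E (x + IZR (Z.of_nat n) * alpha))).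
    pose proof (M2norm_ge0 (coc alpha lambda E x (Z.of_nat n))). nra.
Qed.

(** With a = [quot k] and a1 = [quot (S k)], a level costs the exponent a1 + a + 5. Subtracting the
    latest quotient from 7 [quot_sum k] keeps a in reserve for the next level, and the remaining a1
    + 5 is at most 6 a1. *)
Lemma cbound_all E k : tame E ->
  cbound alpha lambda E (cfq alpha (S (S k)))
    (2 * (kap * (K + 1)) ^ (7 * quot_sum k - Z.to_nat (quot alpha k))).
Proof.
  intros (Hs & Hx & Hz). set (W := kap * (K + 1)).
  assert (HW : 1 <= W) by (unfold W; nra).
  assert (HkW : kap <= W) by (unfold W; nra). assert (HKW : K + 1 <= W) by (unfold W; nra).
  assert (Hmono : forall m n, (m <= n)%nat -> W ^ m <= W ^ n) by (intros; apply Rle_pow; assumption).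
  assert (Hsum : forall i, (Z.to_nat (quot alpha i) <= quot_sum i)%nat) by (intros [|i]; simpl; lia).
  induction k as [|k IH].
  - apply cbound_nonneg. intros x n Hn.
    assert (E2 : cfq alpha 2 = quot alpha 0) by (rewrite (cfq_rec alpha 0); change (cfq alpha 1) with 1%Z; change (cfq alpha 0) with 0%Z; ring).
    rewrite E2 in Hn. replace n with (Z.of_nat (Z.to_nat n)) by lia.
    eapply Rle_trans. apply cnorm_le_pow; assumption.
    apply Rmult_le_compat_l; [lra|].
    eapply Rle_trans. apply pow_incr with (y := W); lra.
    apply Hmono. simpl. lia.
  - pose proof (cbound_level alpha Hirr H01 lambda E K kap HK0 Hkap1 Hs Hx Hz k _ IH) as H.
    intros x n Hn. eapply Rle_trans. apply H; assumption.
    unfold core_const. set (a := Z.to_nat (quot alpha k)) in *. set (a1 := Z.to_nat (quot alpha (S k))) in *.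
    assert (Ha1 : (1 <= a1)%nat) by (pose proof (quot_ge1 alpha Hirr H01 (S k)); lia).
    specialize (Hsum k). fold a in Hsum. simpl quot_sum. fold a1.
    set (s := quot_sum k) in *.
    assert (H1 : (K + 1) ^ a1 <= W ^ a1) by (apply pow_incr; lra).
    assert (H2 : (K + 1) ^ (a + 3) <= W ^ (a + 3)) by (apply pow_incr; lra).
    assert (H3 : kap * kap <= W ^ 2) by (simpl; nra).
    assert (P1 : 0 <= (K + 1) ^ a1) by (apply pow_le; lra).
    assert (P2 : 0 <= (K + 1) ^ (a + 3)) by (apply pow_le; lra).
    assert (P3 : 0 <= W ^ (7 * s - a)) by (apply pow_le; lra).
    assert (P4 : 0 <= kap * kap) by nra.
    eapply Rle_trans with (W ^ a1 * (W ^ 2 * (W ^ (a + 3) * (2 * W ^ (7 * s - a))))).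
    + apply Rmult_le_compat; [assumption| |assumption|].
      { apply Rmult_le_pos; [assumption|]. apply Rmult_le_pos; [assumption|lra]. }
      apply Rmult_le_compat; [assumption| |assumption|].
      { apply Rmult_le_pos; [assumption|lra]. }
      apply Rmult_le_compat_r; [lra|assumption].
    + replace (W ^ a1 * (W ^ 2 * (W ^ (a + 3) * (2 * W ^ (7 * s - a)))))
        with (2 * W ^ (a1 + (2 + (a + 3 + (7 * s - a))))) by (rewrite !pow_add; ring).
      apply Rmult_le_compat_l; [lra|]. apply Hmono. lia.
Qed.

Lemma polynomial_growth : bounded_density alpha ->
  exists C0 mu : R, 0 < C0 /\ 0 < mu /\
    forall E x n, tame E -> (1 <= n)%nat ->
      cnorm alpha lambda E x (Z.of_nat n) <= C0 * Rpower (INR n) mu.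
Proof.
  intros Hbd. destruct (bounded_density_quot_sum Hbd) as [B HB].
  set (W := kap * (K + 1)). assert (HW : 1 <= W) by (unfold W; nra).
  assert (Hw : exists w, W <= 2 ^ w).
  { destruct (nfloor_ex W) as [m [_ Hm]]; [lra|]. exists (S m).
    eapply Rle_trans; [apply Rlt_le, Hm|]. rewrite <- S_INR.
    clear. induction (S m) as [|i IH]; [simpl; lra|].
    rewrite S_INR. simpl. pose proof (pow_R1_Rle 2 i ltac:(lra)). lra. }
  destruct Hw as [w Hw].
  (* For i = log2 n the level 2 i + 1 suffices, with exponent at most 7 B (2 i + 2) = 14 B + 14 B i;
     then use W <= 2^w and 2^i <= n. The successor keeps mu positive. *)
  exists (2 * W ^ (14 * B)), (INR (S (w * (14 * B)))).
  assert (HWp : forall m, 0 < W ^ m) by (intros; apply pow_lt; lra).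
  repeat split.
  - pose proof (HWp (14 * B)%nat). lra.
  - apply lt_0_INR. lia.
  - intros E x n Ht Hn.
    assert (Hn1 : 1 <= INR n) by (change 1 with (INR 1); apply le_INR; lia).
    rewrite Rpower_pow by lra.
    set (i := Nat.log2 n). destruct (Nat.log2_spec n) as [Hi1 Hi2]; [lia|]. fold i in Hi1, Hi2.
    assert (Hle : (Z.of_nat n <= cfq alpha (S (S (2 * i + 1))))%Z).
    { pose proof (cfq_pow2 (S i)) as Hp. replace (S (2 * S i)) with (S (S (2 * i + 1))) in Hp by lia.
      apply Nat2Z.inj_lt in Hi2. rewrite Nat2Z.inj_pow in Hi2. simpl (Z.of_nat 2) in Hi2. lia. }
    eapply Rle_trans. apply (cbound_all E (2 * i + 1) Ht). lia. fold W.
    assert (Hi3 : 2 ^ i <= INR n).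
    { apply le_INR in Hi1. rewrite pow_INR in Hi1. exact Hi1. }
    assert (H1 : W ^ (7 * quot_sum (2 * i + 1) - Z.to_nat (quot alpha (2 * i + 1))) <= W ^ (14 * B + 14 * B * i)).
    { apply Rle_pow; [assumption|]. specialize (HB (2 * i + 1)%nat). nia. }
    assert (H2 : W ^ (14 * B * i) <= INR n ^ (w * (14 * B))).
    { eapply Rle_trans. apply pow_incr with (y := 2 ^ w). lra.
      rewrite <- pow_mult. replace (w * (14 * B * i))%nat with (i * (w * (14 * B)))%nat by ring.
      rewrite pow_mult. apply pow_incr. split; [apply pow_le; lra|assumption]. }
    assert (H3 : INR n ^ (w * (14 * B)) <= INR n ^ S (w * (14 * B))) by (apply Rle_pow; [assumption|lia]).
    rewrite pow_add in H1. pose proof (HWp (14 * B)%nat). nra.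
Qed.
End Bound.
End Density.

(** * Sums over the integers *)

(** Split into two half-line series just as [l2] and [l2norm2] are, so that these become instances
    by conversion. *)
Definition ex_sumZ (g : Z -> R) : Prop :=
  ex_series (fun k : nat => g (Z.of_nat k)) /\
  ex_series (fun k : nat => g (- Z.of_nat (S k))%Z).

Definition sumZ (g : Z -> R) : R :=
  Series (fun k : nat => g (Z.of_nat k)) + Series (fun k : nat => g (- Z.of_nat (S k))%Z).

Lemma ex_sumZ_plus f g : ex_sumZ f -> ex_sumZ g -> ex_sumZ (fun n => f n + g n).
Proof. intros [H1 H2] [H3 H4]. split; now apply (ex_series_plus (V := R_NormedModule)). Qed.

Lemma sumZ_plus f g : ex_sumZ f -> ex_sumZ g -> sumZ (fun n => f n + g n) = sumZ f + sumZ g.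
Proof.
  intros [H1 H2] [H3 H4]. unfold sumZ.
  rewrite (Series_plus _ _ H1 H3), (Series_plus _ _ H2 H4). ring.
Qed.

Lemma ex_sumZ_scal c f : ex_sumZ f -> ex_sumZ (fun n => c * f n).
Proof. intros [H1 H2]. split; now apply (ex_series_scal (V := R_NormedModule)). Qed.

Lemma sumZ_scal c f : sumZ (fun n => c * f n) = c * sumZ f.
Proof. unfold sumZ. rewrite !Series_scal_l. ring. Qed.

Lemma sumZ_ext f g : (forall n, f n = g n) -> sumZ f = sumZ g.
Proof. intros H. unfold sumZ. f_equal; apply Series_ext; intros; apply H. Qed.

Lemma ex_sumZ_ext f g : (forall n, f n = g n) -> ex_sumZ f -> ex_sumZ g.
Proof.
  intros H [H1 H2]. split; [eapply ex_series_ext, H1|eapply ex_series_ext, H2]; intros; apply H.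
Qed.

Lemma ex_sumZ_le f g : (forall n, Rabs (f n) <= g n) -> ex_sumZ g -> ex_sumZ f.
Proof.
  intros H [H1 H2].
  split; [eapply (ex_series_le (V := R_CompleteNormedModule)), H1
         |eapply (ex_series_le (V := R_CompleteNormedModule)), H2]; intros; apply H.
Qed.

Lemma sumZ_le f g : (forall n, 0 <= f n <= g n) -> ex_sumZ g -> sumZ f <= sumZ g.
Proof. intros H [H1 H2]. unfold sumZ. apply Rplus_le_compat; apply Series_le; intros; auto. Qed.

Lemma sumZ_const0 : sumZ (fun _ => 0) = 0.
Proof.
  transitivity (sumZ (fun _ => 0 * 0)); [apply sumZ_ext; intros; ring|].
  rewrite (sumZ_scal 0 (fun _ => 0)). ring.
Qed.

Lemma sumZ_ge0 f : (forall n, 0 <= f n) -> ex_sumZ f -> 0 <= sumZ f.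
Proof.
  intros H Hex. rewrite <- sumZ_const0. apply sumZ_le; [|assumption].
  intros n. split; [lra|apply H].
Qed.

Lemma ex_sumZ_succ g : ex_sumZ g <-> ex_sumZ (fun n => g (n + 1)%Z).
Proof.
  unfold ex_sumZ.
  rewrite (ex_series_incr_1 (fun k => g (Z.of_nat k))).
  rewrite (ex_series_incr_1 (fun k => g (- Z.of_nat (S k) + 1)%Z)).
  split; intros [H1 H2]; (split; [eapply ex_series_ext; [|exact H1]|eapply ex_series_ext; [|exact H2]]);
    intros n; cbv beta; f_equal; lia.
Qed.

Lemma sumZ_succ g : ex_sumZ g -> sumZ (fun n => g (n + 1)%Z) = sumZ g.
Proof.
  intros Hg. pose proof (proj1 (ex_sumZ_succ g) Hg) as [_ H2]. destruct Hg as [H1 _].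
  unfold sumZ.
  rewrite (Series_incr_1 (fun k => g (Z.of_nat k)) H1).
  rewrite (Series_incr_1 (fun k => g (- Z.of_nat (S k) + 1)%Z) H2).
  rewrite (Series_ext (fun k => g (Z.of_nat k + 1)%Z) (fun k => g (Z.of_nat (S k))))
    by (intros; f_equal; lia).
  rewrite (Series_ext (fun k => g (- Z.of_nat (S (S k)) + 1)%Z) (fun k => g (- Z.of_nat (S k))%Z))
    by (intros; f_equal; lia).
  simpl. ring.
Qed.

Lemma sumZ_shift s g : ex_sumZ g ->
  ex_sumZ (fun n => g (n + s)%Z) /\ sumZ (fun n => g (n + s)%Z) = sumZ g.
Proof.
  intros Hg. revert s. apply Z.bi_induction.
  - intros ? ? ->. reflexivity.
  - split.
    + eapply ex_sumZ_ext, Hg. intros; f_equal; lia.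
    + apply sumZ_ext. intros; f_equal; lia.
  - intros s.
    assert (Hi : forall n, g (n + 1 + s)%Z = g (n + Z.succ s)%Z) by (intros; f_equal; lia).
    split; intros [H1 H2].
    + split.
      * eapply ex_sumZ_ext; [exact Hi|]. apply (proj1 (ex_sumZ_succ (fun n => g (n + s)%Z)) H1).
      * rewrite <- H2, <- (sumZ_succ _ H1). symmetry. now apply sumZ_ext.
    + assert (H3 : ex_sumZ (fun n => g (n + s)%Z)).
      { apply (proj2 (ex_sumZ_succ (fun n => g (n + s)%Z))).
        eapply ex_sumZ_ext; [|exact H1]. intros n. symmetry. apply Hi. }
      split; [assumption|]. rewrite <- H2, <- (sumZ_succ _ H3). now apply sumZ_ext.
Qed.

Definition psumZ (N : nat) (g : Z -> R) : R :=
  sum_n (fun k : nat => g (Z.of_nat k)) N + sum_n (fun k : nat => g (- Z.of_nat (S k))%Z) N.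

Lemma sum_n_le_Series (a : nat -> R) N :
  (forall k, 0 <= a k) -> ex_series a -> sum_n a N <= Series a.
Proof.
  intros Ha Hex.
  apply (is_lim_seq_incr_compare (sum_n a) (Series a)).
  - apply Series_correct in Hex. exact Hex.
  - intros n. rewrite sum_Sn. unfold plus; simpl. pose proof (Ha (S n)). lra.
Qed.

Lemma psumZ_le_sumZ N g : (forall n, 0 <= g n) -> ex_sumZ g -> psumZ N g <= sumZ g.
Proof.
  intros Hg [H1 H2]. apply Rplus_le_compat; apply sum_n_le_Series; auto.
Qed.

Lemma sum_n_ge0 (a : nat -> R) N : (forall k, 0 <= a k) -> 0 <= sum_n a N.
Proof.
  intros Ha. induction N as [|N IH].
  - rewrite sum_O. apply Ha.
  - rewrite sum_Sn. unfold plus; simpl. pose proof (Ha (S N)). lra.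
Qed.

Lemma term_le_sumZ n g : (forall n, 0 <= g n) -> ex_sumZ g -> g n <= sumZ g.
Proof.
  intros Hg Hex. destruct (sumZ_shift n g Hex) as [H1 <-].
  eapply Rle_trans; [|apply (psumZ_le_sumZ 0)]; [|auto|assumption].
  unfold psumZ. rewrite !sum_O. change (Z.of_nat 0) with 0%Z. rewrite Z.add_0_l.
  pose proof (Hg (- Z.of_nat 1 + n)%Z). lra.
Qed.

Lemma ex_series_bounded (a : nat -> R) Q : (forall k, 0 <= a k) ->
  (forall N, sum_n a N <= Q) -> ex_series a.
Proof.
  intros Ha HQ. apply (ex_finite_lim_seq_incr (sum_n a) Q).
  - intros n. rewrite sum_Sn. unfold plus; simpl. pose proof (Ha (S n)). lra.
  - exact HQ.
Qed.

Lemma sumZ_bounded g Q : (forall n, 0 <= g n) -> (forall N, psumZ N g <= Q) ->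
  ex_sumZ g /\ sumZ g <= Q.
Proof.
  intros Hg HQ. unfold psumZ in HQ.
  assert (Hex : ex_sumZ g).
  { split; apply ex_series_bounded with (Q := Q); auto; intros N; specialize (HQ N);
      pose proof (sum_n_ge0 (fun k => g (Z.of_nat k)) N (fun k => Hg _));
      pose proof (sum_n_ge0 (fun k => g (- Z.of_nat (S k))%Z) N (fun k => Hg _)); lra. }
  split; [assumption|]. destruct Hex as [H1 H2].
  apply Series_correct in H1. apply Series_correct in H2.
  pose proof (is_lim_seq_plus' _ _ _ _ H1 H2) as H.
  apply (is_lim_seq_le _ _ _ _ HQ H (is_lim_seq_const Q)).
Qed.

Section ListSums.
Fixpoint lsum (h : Z -> R) (l : list Z) : R :=
  match l with nil => 0 | s :: t => h s + lsum h t end.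

Lemma lsum_ge0 h l : (forall s, 0 <= h s) -> 0 <= lsum h l.
Proof. intros H. induction l as [|s t IH]; simpl; [lra|]. pose proof (H s). lra. Qed.

Lemma lsum_In h l s : (forall s, 0 <= h s) -> In s l -> h s <= lsum h l.
Proof.
  intros H Hin. induction l as [|t l IH]; simpl in *; [easy|].
  pose proof (lsum_ge0 h l H). pose proof (H t).
  destruct Hin as [->|Hin]; [lra|]. specialize (IH Hin). lra.
Qed.

(** Cauchy-Schwarz by induction; the step is 2 h A <= n h^2 + A^2 / n. *)
Lemma lsum_sqr h l : lsum h l ^ 2 <= INR (length l) * lsum (fun s => h s ^ 2) l.
Proof.
  induction l as [|s t IH]; [simpl; lra|].
  change (lsum h (s :: t)) with (h s + lsum h t).
  change (lsum (fun s => h s ^ 2) (s :: t)) with (h s ^ 2 + lsum (fun s => h s ^ 2) t).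
  change (length (s :: t)) with (S (length t)). rewrite S_INR.
  set (n := INR (length t)) in *. set (A := lsum h t) in *.
  set (Q := lsum (fun s => h s ^ 2) t) in *.
  assert (HQ : 0 <= Q) by (apply lsum_ge0; intros; nra).
  assert (Hn : 0 <= n) by apply pos_INR.
  destruct (Req_dec n 0) as [Hn0|Hn0].
  - assert (HA : A = 0).
    { apply Rsqr_0_uniq. rewrite Hn0, Rmult_0_l in IH. unfold Rsqr. pose proof (pow2_ge_0 A). lra. }
    rewrite HA, Hn0. nra.
  - assert (2 * h s * A <= n * h s ^ 2 + Q).
    { pose proof (pow2_ge_0 (n * h s - A)).
      apply Rmult_le_reg_l with n; [lra|]. clearbody n A Q. set (x := h s) in *. nra. }
    nra.
Qed.

Lemma sumZ_lsum (g : Z -> R) l : ex_sumZ g ->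
  ex_sumZ (fun p => lsum (fun s => g (p + s)%Z) l) /\
  sumZ (fun p => lsum (fun s => g (p + s)%Z) l) = INR (length l) * sumZ g.
Proof.
  intros Hg. induction l as [|s t [IH1 IH2]].
  - change (INR (length nil)) with 0. simpl lsum. rewrite sumZ_const0. split; [|ring].
    apply (ex_sumZ_ext (fun n => 0 * g n)); [intros; ring|]. now apply ex_sumZ_scal.
  - destruct (sumZ_shift s g Hg) as [H1 H2]. simpl lsum. split.
    + now apply ex_sumZ_plus.
    + rewrite sumZ_plus, H2, IH2 by assumption.
      change (length (s :: t)) with (S (length t)). rewrite S_INR. ring.
Qed.
End ListSums.

(** Square, apply Cauchy-Schwarz and sum over p; every shift preserves the sum. The condition on X
    lets the left side absorb the resulting 2 |S|^2 ||u||^2. *)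
Lemma l2_shift_domination (u f : Z -> C) (S S' : list Z) (X K : R) :
  l2 u -> l2 f -> 0 <= X -> 0 <= K ->
  (forall p, X * Cmod (u p) <=
     lsum (fun s => Cmod (u (p + s)%Z)) S + K * lsum (fun s => Cmod (f (p + s)%Z)) S') ->
  2 * INR (length S) ^ 2 + 1 <= X ^ 2 ->
  l2norm2 u <= (2 * K ^ 2 * INR (length S') ^ 2) * l2norm2 f.
Proof.
  intros Hu Hf HX0 HK0 H HX.
  change (ex_sumZ (fun n => Cmod (u n) ^ 2)) in Hu.
  change (ex_sumZ (fun n => Cmod (f n) ^ 2)) in Hf.
  change (l2norm2 u) with (sumZ (fun n => Cmod (u n) ^ 2)).
  change (l2norm2 f) with (sumZ (fun n => Cmod (f n) ^ 2)).
  destruct (sumZ_lsum _ S Hu) as [Eu Su]. destruct (sumZ_lsum _ S' Hf) as [Ef Sf].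
  set (a := INR (length S)) in *. set (b := INR (length S')) in *.
  assert (Hle : sumZ (fun p => X ^ 2 * Cmod (u p) ^ 2) <=
    sumZ (fun p => (2 * a) * lsum (fun s => Cmod (u (p + s)%Z) ^ 2) S
                   + (2 * K ^ 2 * b) * lsum (fun s => Cmod (f (p + s)%Z) ^ 2) S')).
  { apply sumZ_le.
    - intros p. split; [nra|]. specialize (H p).
      pose proof (lsum_sqr (fun s => Cmod (u (p + s)%Z)) S) as H1.
      pose proof (lsum_sqr (fun s => Cmod (f (p + s)%Z)) S') as H2.
      fold a in H1. fold b in H2.
      pose proof (Cmod_ge_0 (u p)).
      set (y := X * Cmod (u p)) in *.
      set (s1 := lsum (fun s => Cmod (u (p + s)%Z)) S) in *.
      set (s2 := lsum (fun s => Cmod (f (p + s)%Z)) S') in *.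
      replace (X ^ 2 * Cmod (u p) ^ 2) with (y ^ 2) by (unfold y; ring).
      assert (0 <= y) by (unfold y; nra).
      assert (y ^ 2 <= (s1 + K * s2) ^ 2) by (apply pow_incr; lra).
      assert ((s1 + K * s2) ^ 2 <= 2 * s1 ^ 2 + 2 * K ^ 2 * s2 ^ 2)
        by (pose proof (pow2_ge_0 (s1 - K * s2)); lra).
      assert (K ^ 2 * s2 ^ 2 <= K ^ 2 * (b * lsum (fun s => Cmod (f (p + s)%Z) ^ 2) S'))
        by (apply Rmult_le_compat_l; [apply pow2_ge_0|assumption]).
      lra.
    - apply ex_sumZ_plus; now apply ex_sumZ_scal. }
  rewrite sumZ_plus in Hle by now apply ex_sumZ_scal.
  rewrite !sumZ_scal, Su, Sf in Hle.
  assert (0 <= sumZ (fun n => Cmod (u n) ^ 2)) by (apply sumZ_ge0; [intros; apply pow2_ge_0|assumption]).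
  nra.
Qed.

(** * Inverting a bounded-below normal Jacobi operator *)

Definition jac (a u : Z -> C) : Z -> C :=
  fun n => (u (n + 1)%Z + u (n - 1)%Z + a n * u n)%C.

Definition re2 (z w : C) : R := fst z * fst w + snd z * snd w.
Definition ip (u v : Z -> C) : R := sumZ (fun n => re2 (u n) (v n)).

Ltac ex_sumZ_tac :=
  first [ assumption
        | apply ex_sumZ_plus; ex_sumZ_tac
        | apply ex_sumZ_scal; ex_sumZ_tac ].

Lemma Cmod_sqr z : Cmod z ^ 2 = re2 z z.
Proof.
  unfold Cmod, re2. rewrite pow2_sqrt; [ring|].
  pose proof (pow2_ge_0 (fst z)); pose proof (pow2_ge_0 (snd z)); lra.
Qed.

Lemma l2norm2_ip u : l2norm2 u = ip u u.
Proof.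
  apply (sumZ_ext (fun n => Cmod (u n) ^ 2) (fun n => re2 (u n) (u n))).
  intros n. apply Cmod_sqr.
Qed.

Lemma l2_iff u : l2 u <-> ex_sumZ (fun n => Cmod (u n) ^ 2).
Proof. reflexivity. Qed.

Lemma l2norm2_eq u : l2norm2 u = sumZ (fun n => Cmod (u n) ^ 2).
Proof. reflexivity. Qed.

Lemma l2norm2_ge0 u : l2 u -> 0 <= l2norm2 u.
Proof. intros H. apply (sumZ_ge0 (fun n => Cmod (u n) ^ 2)); [intros; apply pow2_ge_0|exact H]. Qed.

Lemma l2_le u g : (forall n, Cmod (u n) ^ 2 <= g n) -> ex_sumZ g -> l2 u /\ l2norm2 u <= sumZ g.
Proof.
  intros H Hg. rewrite l2_iff, l2norm2_eq. split.
  - apply ex_sumZ_le with (2 := Hg). intros n.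
    rewrite Rabs_pos_eq by apply pow2_ge_0. apply H.
  - apply sumZ_le; [|assumption]. intros n. split; [apply pow2_ge_0|apply H].
Qed.

Lemma re2_le z w : Rabs (re2 z w) <= Cmod z ^ 2 + Cmod w ^ 2.
Proof.
  rewrite !Cmod_sqr. unfold re2. apply Rabs_le.
  pose proof (pow2_ge_0 (fst z - fst w)); pose proof (pow2_ge_0 (snd z - snd w)).
  pose proof (pow2_ge_0 (fst z + fst w)); pose proof (pow2_ge_0 (snd z + snd w)).
  pose proof (pow2_ge_0 (fst z)); pose proof (pow2_ge_0 (fst w)).
  pose proof (pow2_ge_0 (snd z)); pose proof (pow2_ge_0 (snd w)).
  split; nra.
Qed.

Lemma ex_ip u v : l2 u -> l2 v -> ex_sumZ (fun n => re2 (u n) (v n)).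
Proof.
  intros Hu Hv. apply ex_sumZ_le with (fun n => Cmod (u n) ^ 2 + Cmod (v n) ^ 2).
  - intros n. apply re2_le.
  - now apply ex_sumZ_plus.
Qed.

Lemma l2_shift s u : l2 u -> l2 (fun n => u (n + s)%Z).
Proof. intros Hu. apply (sumZ_shift s (fun n => Cmod (u n) ^ 2) Hu). Qed.

Lemma l2_scal_add u v (r : R) : l2 u -> l2 v ->
  l2 (fun n => u n + RtoC r * v n)%C /\
  l2norm2 (fun n => u n + RtoC r * v n)%C <= 2 * l2norm2 u + 2 * r ^ 2 * l2norm2 v.
Proof.
  intros Hu Hv.
  destruct (l2_le (fun n => u n + RtoC r * v n)%C
    (fun n => 2 * Cmod (u n) ^ 2 + 2 * r ^ 2 * Cmod (v n) ^ 2)) as [H1 H2].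
  - intros n. rewrite !Cmod_sqr. unfold re2. destruct (u n) as [x y], (v n) as [z t]; simpl.
    pose proof (pow2_ge_0 (x - r * z)); pose proof (pow2_ge_0 (y - r * t)). nra.
  - apply ex_sumZ_plus; now apply ex_sumZ_scal.
  - split; [assumption|]. eapply Rle_trans; [exact H2|].
    rewrite sumZ_plus, !sumZ_scal by now apply ex_sumZ_scal.
    rewrite !l2norm2_eq. lra.
Qed.

Lemma ip_expand u v (r : R) : l2 u -> l2 v ->
  l2norm2 (fun n => u n + RtoC r * v n)%C = l2norm2 u + 2 * r * ip u v + r ^ 2 * l2norm2 v.
Proof.
  intros Hu Hv. rewrite !l2norm2_ip. unfold ip.
  pose proof (ex_ip u u Hu Hu) as E1. pose proof (ex_ip u v Hu Hv) as E2.
  pose proof (ex_ip v v Hv Hv) as E3.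
  rewrite <- !sumZ_scal, <- !sumZ_plus;
    try solve [ex_sumZ_tac].
  apply sumZ_ext. intros n. unfold re2. destruct (u n), (v n); simpl. ring.
Qed.

Lemma jac_l2 a M u : (forall n, Cmod (a n) <= M) -> l2 u ->
  l2 (jac a u) /\ l2norm2 (jac a u) <= 3 * (2 + M ^ 2) * l2norm2 u.
Proof.
  intros Ha Hu.
  destruct (sumZ_shift 1 (fun n => Cmod (u n) ^ 2) Hu) as [E1 S1].
  destruct (sumZ_shift (-1) (fun n => Cmod (u n) ^ 2) Hu) as [E2 S2].
  cbv beta in E1, E2, S1, S2.
  destruct (l2_le (jac a u) (fun n => 3 * Cmod (u (n + 1)%Z) ^ 2 +
    (3 * Cmod (u (n + -1)%Z) ^ 2 + (3 * M ^ 2) * Cmod (u n) ^ 2))) as [H1 H2].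
  - intros n. unfold jac. change (n - 1)%Z with (n + -1)%Z.
    set (x := u (n + 1)%Z). set (y := u (n + -1)%Z). set (z := u n).
    pose proof (Cmod_triangle (x + y) (a n * z)). pose proof (Cmod_triangle x y).
    rewrite Cmod_mult in *. pose proof (Ha n).
    pose proof (Cmod_ge_0 x); pose proof (Cmod_ge_0 y); pose proof (Cmod_ge_0 z).
    pose proof (Cmod_ge_0 (a n)). pose proof (Cmod_ge_0 (x + y + a n * z)).
    assert (Cmod (a n) * Cmod z <= M * Cmod z) by nra.
    set (p := Cmod x) in *. set (q := Cmod y) in *. set (w := M * Cmod z) in *.
    replace (3 * M ^ 2 * Cmod z ^ 2) with (3 * w ^ 2) by (unfold w; ring).
    assert (Cmod (x + y + a n * z) ^ 2 <= (p + q + w) ^ 2) by (apply pow_incr; lra).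
    pose proof (pow2_ge_0 (p - q)); pose proof (pow2_ge_0 (p - w)); pose proof (pow2_ge_0 (q - w)).
    nra.
  - apply ex_sumZ_plus; [now apply ex_sumZ_scal|].
    apply ex_sumZ_plus; now apply ex_sumZ_scal.
  - split; [assumption|]. eapply Rle_trans; [exact H2|].
    rewrite !sumZ_plus, !sumZ_scal; try solve [ex_sumZ_tac].
    rewrite S1, S2, l2norm2_eq. lra.
Qed.

(** The two shifts are adjoint to each other, and conjugating the diagonal handles the rest. *)
Lemma jac_adjoint a u v M : (forall n, Cmod (a n) <= M) -> l2 u -> l2 v ->
  ip u (jac (fun n => Cconj (a n)) v) = ip (jac a u) v.
Proof.
  intros Ha Hu Hv. unfold ip.
  pose proof (ex_ip _ _ Hu (l2_shift 1 v Hv)) as E1.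
  pose proof (ex_ip _ _ Hu (l2_shift (-1) v Hv)) as E2.
  pose proof (ex_ip _ _ (l2_shift 1 u Hu) Hv) as E3.
  pose proof (ex_ip _ _ (l2_shift (-1) u Hu) Hv) as E4.
  assert (Hau : l2 (fun n => a n * u n)%C).
  { destruct (l2_le (fun n => a n * u n)%C (fun n => M ^ 2 * Cmod (u n) ^ 2)) as [H _]; [|now apply ex_sumZ_scal|exact H].
    intros n. rewrite Cmod_mult, Rpow_mult_distr. apply Rmult_le_compat_r; [apply pow2_ge_0|].
    apply pow_incr. split; [apply Cmod_ge_0|apply Ha]. }
  pose proof (ex_ip _ _ Hau Hv) as E5. cbv beta in E1, E2, E3, E4, E5.
  transitivity (sumZ (fun n => re2 (u n) (v (n + 1)%Z)) +
    (sumZ (fun n => re2 (u n) (v (n + -1)%Z)) + sumZ (fun n => re2 (a n * u n)%C (v n)))).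
  { rewrite <- !sumZ_plus; try solve [ex_sumZ_tac].
    apply sumZ_ext. intros n. unfold jac, re2. change (n - 1)%Z with (n + -1)%Z.
    destruct (u n), (v (n + 1)%Z), (v (n + -1)%Z), (v n), (a n). simpl. ring. }
  transitivity (sumZ (fun n => re2 (u (n + 1)%Z) (v n)) +
    (sumZ (fun n => re2 (u (n + -1)%Z) (v n)) + sumZ (fun n => re2 (a n * u n)%C (v n)))).
  2: { rewrite <- !sumZ_plus; try solve [ex_sumZ_tac].
    apply sumZ_ext. intros n. unfold jac, re2. change (n - 1)%Z with (n + -1)%Z.
    destruct (v n), (u (n + 1)%Z), (u (n + -1)%Z), (u n), (a n). simpl. ring. }
  rewrite <- (proj2 (sumZ_shift (-1) _ E1)), <- (proj2 (sumZ_shift 1 _ E2)).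
  rewrite (sumZ_ext (fun n => re2 (u (n + -1)%Z) (v (n + -1 + 1)%Z)) (fun n => re2 (u (n + -1)%Z) (v n)))
    by (intros; do 2 f_equal; lia).
  rewrite (sumZ_ext (fun n => re2 (u (n + 1)%Z) (v (n + 1 + -1)%Z)) (fun n => re2 (u (n + 1)%Z) (v n)))
    by (intros; do 2 f_equal; lia).
  ring.
Qed.

(** Pointwise convergence suffices: [jac] is local, hence continuous for it, and norm bounds pass to
    the limit by [l2_fatou]. *)
Definition pconv (s : nat -> Z -> C) (u : Z -> C) : Prop :=
  forall n, is_lim_seq (fun N => fst (s N n)) (fst (u n)) /\
            is_lim_seq (fun N => snd (s N n)) (snd (u n)).

Lemma pconv_unique s u v : pconv s u -> pconv s v -> u = v.
Proof.
  intros Hu Hv. extensionality n. destruct (Hu n) as [H1 H2], (Hv n) as [H3 H4].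
  apply is_lim_seq_unique in H1, H2, H3, H4.
  apply injective_projections; congruence.
Qed.

Lemma pconv_ext s t u : (forall N, s N = t N) -> pconv s u -> pconv t u.
Proof.
  intros H Hs n. destruct (Hs n) as [H1 H2].
  split; [eapply is_lim_seq_ext, H1|eapply is_lim_seq_ext, H2]; intros N; simpl; now rewrite H.
Qed.

Lemma is_lim_seq_scal' (c l : R) w :
  is_lim_seq w l -> is_lim_seq (fun n => c * w n) (c * l).
Proof. exact (is_lim_seq_scal_l w c (Finite l)). Qed.

Lemma pconv_jac a s u : pconv s u -> pconv (fun N => jac a (s N)) (jac a u).
Proof.
  intros H n. destruct (H (n + 1)%Z) as [H1 H2], (H (n - 1)%Z) as [H3 H4], (H n) as [H5 H6].
  unfold jac; simpl. split.
  - apply is_lim_seq_plus'; [now apply is_lim_seq_plus'|].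
    apply is_lim_seq_minus'; now apply is_lim_seq_scal'.
  - apply is_lim_seq_plus'; [now apply is_lim_seq_plus'|].
    apply is_lim_seq_plus'; now apply is_lim_seq_scal'.
Qed.

Lemma pconv_scal (r : R) s u : pconv s u ->
  pconv (fun N n => RtoC r * s N n)%C (fun n => RtoC r * u n)%C.
Proof.
  intros H n. destruct (H n) as [H1 H2]. split.
  - apply is_lim_seq_ext with (fun N => r * fst (s N n)).
    { intros N. destruct (s N n). simpl. ring. }
    replace (fst (RtoC r * u n)%C) with (r * fst (u n)) by (destruct (u n); simpl; ring).
    now apply is_lim_seq_scal'.
  - apply is_lim_seq_ext with (fun N => r * snd (s N n)).
    { intros N. destruct (s N n). simpl. ring. }
    replace (snd (RtoC r * u n)%C) with (r * snd (u n)) by (destruct (u n); simpl; ring).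
    now apply is_lim_seq_scal'.
Qed.

Lemma l2_fatou s u Q : pconv s u -> (forall N, l2 (s N) /\ l2norm2 (s N) <= Q) ->
  l2 u /\ l2norm2 u <= Q.
Proof.
  intros Hc Hs. apply (sumZ_bounded (fun n => Cmod (u n) ^ 2)); [intros; apply pow2_ge_0|].
  intros K.
  assert (Hsq : forall n, is_lim_seq (fun N => Cmod (s N n) ^ 2) (Cmod (u n) ^ 2)).
  { intros n. destruct (Hc n) as [H1 H2].
    apply is_lim_seq_ext with (fun N => re2 (s N n) (s N n)).
    { intros N. symmetry. apply Cmod_sqr. }
    rewrite Cmod_sqr. unfold re2. apply is_lim_seq_plus'; now apply is_lim_seq_mult'. }
  assert (Hsum : forall (h : nat -> Z) m, is_lim_seq (fun N => sum_n (fun k => Cmod (s N (h k)) ^ 2) m)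
    (sum_n (fun k => Cmod (u (h k)) ^ 2) m)).
  { intros h m. induction m as [|m IH].
    - rewrite sum_O. apply is_lim_seq_ext with (fun N => Cmod (s N (h O)) ^ 2); [|apply Hsq].
      intros N. now rewrite sum_O.
    - rewrite sum_Sn.
      apply is_lim_seq_ext with (fun N => sum_n (fun k => Cmod (s N (h k)) ^ 2) m + Cmod (s N (h (S m))) ^ 2).
      { intros N. now rewrite sum_Sn. }
      exact (is_lim_seq_plus' _ _ _ _ IH (Hsq (h (S m)))). }
  pose proof (is_lim_seq_plus' _ _ _ _ (Hsum (fun k => Z.of_nat k) K)
    (Hsum (fun k => - Z.of_nat (S k))%Z K)) as Hl.
  refine (is_lim_seq_le _ _ (Finite _) (Finite Q) _ Hl (is_lim_seq_const Q)).
  intros N. destruct (Hs N) as [H1 H2]. eapply Rle_trans; [|exact H2].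
  apply (psumZ_le_sumZ K (fun n => Cmod (s N n) ^ 2)); [intros; apply pow2_ge_0|exact H1].
Qed.

Section NormalInverse.
Context (a : Z -> C) (M c : R) (kappa : C).
Local Notation a' := (fun n => Cconj (a n)).
Context (Ha : forall n, Cmod (a n) <= M)
  (Hnormal : forall n, Cconj (a n) = (a n + kappa)%C)
  (Hc : 1 <= c)
  (Hlow : forall u, l2 u -> l2norm2 u <= c * l2norm2 (jac a u)).

Lemma jac_lin (b u v : Z -> C) (r : R) :
  jac b (fun n => u n + RtoC r * v n)%C = (fun n => jac b u n + RtoC r * jac b v n)%C.
Proof. extensionality n. unfold jac. ring. Qed.

Lemma jac_scal (b u : Z -> C) (r : R) :
  jac b (fun n => RtoC r * u n)%C = (fun n => RtoC r * jac b u n)%C.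
Proof. extensionality n. unfold jac. ring. Qed.

Lemma jac_conj u : jac a' u = (fun n => jac a u n + kappa * u n)%C.
Proof. extensionality n. unfold jac. rewrite Hnormal. ring. Qed.

(** Normality: the adjoint differs from [jac a] by the scalar kappa. *)
Lemma jac_commute u : jac a (jac a' u) = jac a' (jac a u).
Proof. rewrite !jac_conj. extensionality n. unfold jac. ring. Qed.

Lemma conj_bound n : Cmod (a' n) <= M.
Proof. cbv beta. rewrite Cmod_conj. apply Ha. Qed.

Definition jbd : R := 3 * (2 + M ^ 2).

Lemma jbd_ge : 2 <= jbd.
Proof. unfold jbd. pose proof (pow2_ge_0 M). lra. Qed.

Lemma jac_conj_norm u : l2 u -> l2norm2 (jac a' u) = l2norm2 (jac a u).
Proof.
  intros Hu. destruct (jac_l2 a M u Ha Hu) as [H1 _].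
  destruct (jac_l2 a' M u conj_bound Hu) as [H2 _].
  rewrite !l2norm2_ip.
  rewrite <- (jac_adjoint a u (jac a u) M Ha Hu H1).
  rewrite <- (jac_adjoint a' u (jac a' u) M conj_bound Hu H2).
  rewrite <- jac_commute. do 2 f_equal. extensionality n. apply Cconj_conj.
Qed.

Definition nrm (u : Z -> C) := jac a' (jac a u).
Definition damp (u : Z -> C) : Z -> C := (fun n => u n + RtoC (- / jbd) * nrm u n)%C.
Definition rho : R := 1 - / (c * jbd).

Lemma rho_bounds : 0 < rho < 1.
Proof.
  unfold rho. pose proof jbd_ge.
  assert (2 <= c * jbd) by nra.
  assert (0 < / (c * jbd)) by (apply Rinv_0_lt_compat; lra).
  assert (/ (c * jbd) <= / 2) by (apply Rinv_le_contravar; lra). lra.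
Qed.

Lemma nrm_l2 u : l2 u -> l2 (nrm u) /\ l2norm2 (nrm u) <= jbd * l2norm2 (jac a u).
Proof.
  intros Hu. destruct (jac_l2 a M u Ha Hu) as [H1 _].
  exact (jac_l2 a' M _ conj_bound H1).
Qed.

(** With N = [nrm] and J = [jbd], ||u - N u / J||^2 = ||u||^2 - 2 ||A u||^2 / J + ||N u||^2 / J^2,
    which is at most ||u||^2 - ||A u||^2 / J; the lower bound for A = [jac a] then gives the
    contraction. *)
Lemma damp_l2 u : l2 u -> l2 (damp u) /\ l2norm2 (damp u) <= rho * l2norm2 u.
Proof.
  intros Hu. destruct (jac_l2 a M u Ha Hu) as [H1 _]. destruct (nrm_l2 u Hu) as [H2 H3].
  split; [now apply (l2_scal_add u (nrm u))|].
  unfold damp. rewrite ip_expand by assumption. unfold nrm at 1.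
  rewrite (jac_adjoint a u (jac a u) M Ha Hu H1), <- l2norm2_ip.
  specialize (Hlow u Hu). pose proof jbd_ge as Hj. pose proof (l2norm2_ge0 _ H1) as Hge.
  set (X := l2norm2 u) in *. set (Y := l2norm2 (jac a u)) in *. set (Z0 := l2norm2 (nrm u)) in *.
  assert (HZ : (- / jbd) ^ 2 * Z0 <= / jbd * Y).
  { replace (/ jbd * Y) with ((- / jbd) ^ 2 * (jbd * Y)) by (field; lra).
    apply Rmult_le_compat_l; [apply pow2_ge_0|assumption]. }
  assert (HX : / (c * jbd) * X <= / jbd * Y).
  { replace (/ jbd * Y) with (/ (c * jbd) * (c * Y)) by (field; lra).
    apply Rmult_le_compat_l; [|assumption]. apply Rlt_le, Rinv_0_lt_compat. nra. }
  unfold rho. lra.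
Qed.

Fixpoint damp_iter (k : nat) (u : Z -> C) : Z -> C :=
  match k with O => u | S i => damp (damp_iter i u) end.

(** The factor [RtoC 1] puts the sum in the form of [l2_scal_add], [jac_lin] and [nrm_lin]. *)
Fixpoint neumann (N : nat) (u : Z -> C) : Z -> C :=
  match N with
  | O => u
  | S i => fun n => (neumann i u n + RtoC 1 * damp_iter (S i) u n)%C
  end.

Lemma damp_iter_l2 k u : l2 u -> l2 (damp_iter k u) /\ l2norm2 (damp_iter k u) <= rho ^ k * l2norm2 u.
Proof.
  intros Hu. induction k as [|k [IH1 IH2]].
  - simpl. split; [assumption|lra].
  - simpl damp_iter. destruct (damp_l2 _ IH1) as [H1 H2]. split; [assumption|].
    pose proof rho_bounds. simpl. nra.
Qed.

Lemma neumann_l2 N u : l2 u -> l2 (neumann N u).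
Proof.
  intros Hu. induction N as [|N IH]; [assumption|].
  apply l2_scal_add; [assumption|apply damp_iter_l2; assumption].
Qed.

Lemma nrm_lin u v r : nrm (fun n => u n + RtoC r * v n)%C = (fun n => nrm u n + RtoC r * nrm v n)%C.
Proof. unfold nrm. now rewrite jac_lin, jac_lin. Qed.

Lemma jac_damp b u : (forall v, jac b (nrm v) = nrm (jac b v)) -> jac b (damp u) = damp (jac b u).
Proof. intros H. unfold damp. now rewrite jac_lin, H. Qed.

Lemma jac_neumann b N u : (forall v, jac b (nrm v) = nrm (jac b v)) ->
  jac b (neumann N u) = neumann N (jac b u).
Proof.
  intros H.
  assert (Hi : forall k, jac b (damp_iter k u) = damp_iter k (jac b u)).
  { induction k as [|k IH]; [reflexivity|]. simpl. now rewrite jac_damp, IH. }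
  induction N as [|N IH]; [reflexivity|]. simpl. rewrite jac_lin, IH.
  change (damp (damp_iter N u)) with (damp_iter (S N) u). now rewrite Hi.
Qed.

Lemma nrm_commute_a v : jac a (nrm v) = nrm (jac a v).
Proof. unfold nrm. now rewrite jac_commute. Qed.

Lemma nrm_commute_conj v : jac a' (nrm v) = nrm (jac a' v).
Proof. unfold nrm. now rewrite jac_commute. Qed.

(** A telescoping sum, since [nrm] is [jbd] times the identity minus [damp]. *)
Lemma nrm_neumann N u :
  nrm (neumann N u) = (fun n => RtoC jbd * (u n - damp_iter (S N) u n))%C.
Proof.
  assert (Hj : RtoC jbd <> RtoC 0).
  { intros H. apply RtoC_inj in H. pose proof jbd_ge. lra. }
  assert (Hd : forall v, nrm v = (fun n => RtoC jbd * (v n - damp v n))%C).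
  { intros v. extensionality n. unfold damp. rewrite RtoC_opp, RtoC_inv by (pose proof jbd_ge; lra).
    field. exact Hj. }
  induction N as [|N IH].
  - apply Hd.
  - simpl neumann. rewrite nrm_lin, IH. extensionality n.
    rewrite (Hd (damp (damp_iter N u))). simpl. ring.
Qed.

Lemma damp_iter_pointwise k u n : l2 u ->
  Cmod (damp_iter k u n) <= sqrt rho ^ k * sqrt (l2norm2 u).
Proof.
  intros Hu. destruct (damp_iter_l2 k u Hu) as [H1 H2]. pose proof rho_bounds as Hr.
  pose proof (l2norm2_ge0 u Hu).
  rewrite <- (sqrt_pow2 (Cmod (damp_iter k u n))) by apply Cmod_ge_0.
  assert (E : sqrt rho ^ k = sqrt (rho ^ k)).
  { induction k as [|i IH]; simpl; [now rewrite sqrt_1|].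
    rewrite sqrt_mult; [|lra|apply pow_le; lra]. rewrite IH; [reflexivity| |]; now apply damp_iter_l2. }
  rewrite E, <- sqrt_mult by (assumption || apply pow_le; lra).
  apply sqrt_le_1_alt. eapply Rle_trans; [|exact H2].
  apply (term_le_sumZ n (fun n => Cmod (damp_iter k u n) ^ 2)); [intros; apply pow2_ge_0|exact H1].
Qed.

Lemma sqrt_rho_lt1 : 0 <= sqrt rho < 1.
Proof.
  pose proof rho_bounds. split; [apply sqrt_pos|].
  rewrite <- sqrt_1. apply sqrt_lt_1; lra.
Qed.

Lemma damp_iter_pconv0 u : l2 u -> pconv (fun k => damp_iter k u) (fun _ => RtoC 0).
Proof.
  intros Hu n. pose proof sqrt_rho_lt1 as Hs.
  assert (Hg : is_lim_seq (fun k => sqrt rho ^ k * sqrt (l2norm2 u)) 0).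
  { replace 0 with (0 * sqrt (l2norm2 u)) by ring.
    apply is_lim_seq_mult'; [|apply is_lim_seq_const].
    apply is_lim_seq_geom. rewrite Rabs_pos_eq; lra. }
  assert (Hcomp : forall w : nat -> R, (forall k, Rabs (w k) <= Cmod (damp_iter k u n)) -> is_lim_seq w 0).
  { intros w Hw. apply is_lim_seq_abs_0.
    apply is_lim_seq_le_le with (u := fun _ => 0) (w := fun k => sqrt rho ^ k * sqrt (l2norm2 u));
      [|apply is_lim_seq_const|exact Hg].
    intros k. split; [apply Rabs_pos|]. eapply Rle_trans; [apply Hw|now apply damp_iter_pointwise]. }
  split; apply Hcomp; intros k; (eapply Rle_trans; [|apply Rmax_Cmod]); [apply Rmax_l|apply Rmax_r].
Qed.

Definition neumann_sum (u : Z -> C) : Z -> C :=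
  fun n => (Series (fun k => fst (damp_iter k u n)), Series (fun k => snd (damp_iter k u n))).

Lemma neumann_pconv u : l2 u -> pconv (fun N => neumann N u) (neumann_sum u).
Proof.
  intros Hu n. pose proof sqrt_rho_lt1 as Hs.
  assert (Hg : ex_series (fun k => sqrt rho ^ k * sqrt (l2norm2 u))).
  { apply ex_series_scal_r. apply ex_series_geom. rewrite Rabs_pos_eq; lra. }
  assert (Hcomp : forall w : nat -> R, (forall k, Rabs (w k) <= Cmod (damp_iter k u n)) ->
    is_lim_seq (sum_n w) (Series w)).
  { intros w Hw. apply (Series_correct w).
    apply (ex_series_le (V := R_CompleteNormedModule)) with (2 := Hg).
    intros k. eapply Rle_trans; [apply Hw|now apply damp_iter_pointwise]. }
  split.
  - apply is_lim_seq_ext with (sum_n (fun k => fst (damp_iter k u n))).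
    { induction n0 as [|N IH]; [now rewrite sum_O|].
      rewrite sum_Sn, IH. simpl. unfold plus; simpl. ring. }
    apply Hcomp. intros k. eapply Rle_trans; [apply Rmax_l|apply Rmax_Cmod].
  - apply is_lim_seq_ext with (sum_n (fun k => snd (damp_iter k u n))).
    { induction n0 as [|N IH]; [now rewrite sum_O|].
      rewrite sum_Sn, IH. simpl. unfold plus; simpl. ring. }
    apply Hcomp. intros k. eapply Rle_trans; [apply Rmax_r|apply Rmax_Cmod].
Qed.

Lemma nrm_neumann_pconv u : l2 u ->
  pconv (fun N => nrm (neumann N u)) (fun n => RtoC jbd * u n)%C.
Proof.
  intros Hu.
  apply pconv_ext with (fun N n => RtoC jbd * (u n - damp_iter (S N) u n))%C.
  { intros N. symmetry. apply nrm_neumann. }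
  apply (pconv_scal jbd (fun N n => u n - damp_iter (S N) u n)%C u).
  intros n. destruct (damp_iter_pconv0 u Hu n) as [H1 H2].
  apply is_lim_seq_incr_1 in H1. apply is_lim_seq_incr_1 in H2.
  split.
  - replace (fst (u n)) with (fst (u n) - fst (RtoC 0)) by (simpl; ring).
    apply is_lim_seq_minus'; [apply is_lim_seq_const|exact H1].
  - replace (snd (u n)) with (snd (u n) - snd (RtoC 0)) by (simpl; ring).
    apply is_lim_seq_minus'; [apply is_lim_seq_const|exact H2].
Qed.

(** Instead of summing norms, the lower bound is applied twice to a partial sum: ||v||^2 <= c^2
    ||nrm v||^2, and [nrm] of the partial sum telescopes. The constant 8 arises from two uses of
    [l2_scal_add]. *)
Lemma neumann_sum_l2 u : l2 u ->
  l2 (neumann_sum u) /\ l2norm2 (neumann_sum u) <= c * c * (8 * jbd ^ 2) * l2norm2 u.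
Proof.
  intros Hu. apply l2_fatou with (s := fun N => neumann N u); [now apply neumann_pconv|].
  intros N. pose proof (neumann_l2 N u Hu) as HN. split; [assumption|].
  destruct (jac_l2 a M _ Ha HN) as [H1 _].
  pose proof (Hlow _ HN) as L1. pose proof (Hlow _ H1) as L2.
  rewrite <- (jac_conj_norm _ H1) in L2. change (jac a' (jac a (neumann N u))) with (nrm (neumann N u)) in L2.
  destruct (damp_iter_l2 (S N) u Hu) as [H2 H3].
  assert (L3 : l2norm2 (nrm (neumann N u)) <= 8 * jbd ^ 2 * l2norm2 u).
  { rewrite nrm_neumann.
    assert (Hz0 : l2 (fun _ => RtoC 0)).
    { apply (l2_le (fun _ => RtoC 0) (fun n => Cmod (u n) ^ 2)); [|exact Hu].
      intros n. rewrite Cmod_0. pose proof (pow2_ge_0 (Cmod (u n))). lra. }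
    assert (Ez0 : l2norm2 (fun _ => RtoC 0) = 0).
    { rewrite l2norm2_eq. transitivity (sumZ (fun _ => 0)); [|apply sumZ_const0].
      apply sumZ_ext. intros n. rewrite Cmod_0. ring. }
    destruct (l2_scal_add u (damp_iter (S N) u) (-1) Hu H2) as [H4 H5].
    destruct (l2_scal_add (fun _ => RtoC 0) (fun n => u n + RtoC (-1) * damp_iter (S N) u n)%C jbd Hz0 H4) as [_ H6].
    rewrite Ez0 in H6.
    replace (fun n : Z => (RtoC jbd * (u n - damp_iter (S N) u n))%C)
      with (fun n : Z => (RtoC 0 + RtoC jbd * (u n + RtoC (-1) * damp_iter (S N) u n))%C).
    2: { extensionality n. apply injective_projections; simpl; ring. }
    eapply Rle_trans; [exact H6|].
    assert (Hr : rho ^ S N <= 1) by (rewrite <- (pow1 (S N)); apply pow_incr; pose proof rho_bounds; lra).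
    pose proof (l2norm2_ge0 u Hu). pose proof (pow2_ge_0 jbd).
    set (X := l2norm2 u) in *. set (Y := l2norm2 (fun n => u n + RtoC (-1) * damp_iter (S N) u n)%C) in *.
    assert (Y <= 4 * X) by nra.
    assert (jbd ^ 2 * Y <= jbd ^ 2 * (4 * X)) by (apply Rmult_le_compat_l; assumption). lra. }
  rewrite !Rmult_assoc in *. nra.
Qed.

(** With A = [jac a], this is the inverse of [nrm] applied to the adjoint of A; [neumann_sum]
    inverts [nrm] up to the factor [jbd]. *)
Definition green (f : Z -> C) : Z -> C :=
  fun n => (RtoC (/ jbd) * neumann_sum (jac a' f) n)%C.

Lemma jbd_cancel (w : Z -> C) : (fun n => RtoC (/ jbd) * (RtoC jbd * w n))%C = w.
Proof.
  extensionality n. rewrite Cmult_assoc, <- RtoC_mult, Rinv_l by (pose proof jbd_ge; lra). ring.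
Qed.

Lemma green_left u : l2 u -> green (jac a u) = u.
Proof.
  intros Hu. destruct (nrm_l2 u Hu) as [H2 _]. unfold green.
  change (jac a' (jac a u)) with (nrm u).
  assert (E : neumann_sum (nrm u) = (fun n => RtoC jbd * u n)%C).
  { apply pconv_unique with (fun N => neumann N (nrm u)); [now apply neumann_pconv|].
    apply pconv_ext with (fun N => nrm (neumann N u)); [|now apply nrm_neumann_pconv].
    intros N. unfold nrm at 1. rewrite (jac_neumann a) by exact nrm_commute_a.
    now rewrite (jac_neumann a') by exact nrm_commute_conj. }
  rewrite E. apply jbd_cancel.
Qed.

Lemma green_right f : l2 f -> jac a (green f) = f.
Proof.
  intros Hf. destruct (jac_l2 a' M f conj_bound Hf) as [H1 _]. unfold green.
  rewrite jac_scal.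
  assert (E : jac a (neumann_sum (jac a' f)) = (fun n => RtoC jbd * f n)%C).
  { apply pconv_unique with (fun N => jac a (neumann N (jac a' f))).
    - apply pconv_jac. now apply neumann_pconv.
    - apply pconv_ext with (fun N => nrm (neumann N f)); [|now apply nrm_neumann_pconv].
      intros N. rewrite <- (jac_neumann a') by exact nrm_commute_conj.
      now rewrite jac_commute. }
  rewrite E. apply jbd_cancel.
Qed.

Lemma green_l2 f : l2 f ->
  l2 (green f) /\ l2norm2 (green f) <= 16 * (c * c) * jbd * l2norm2 f.
Proof.
  intros Hf. destruct (jac_l2 a' M f conj_bound Hf) as [H1 H2]. fold jbd in H2.
  destruct (neumann_sum_l2 _ H1) as [H3 H4]. pose proof jbd_ge as Hj.
  destruct (l2_le (green f) (fun n => (/ jbd) ^ 2 * Cmod (neumann_sum (jac a' f) n) ^ 2)) as [H5 H6].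
  - intros n. unfold green. rewrite Cmod_mult, Cmod_R, Rabs_pos_eq, Rpow_mult_distr; [lra|].
    apply Rlt_le, Rinv_0_lt_compat. lra.
  - now apply ex_sumZ_scal.
  - split; [assumption|]. rewrite sumZ_scal, <- l2norm2_eq in H6.
    eapply Rle_trans; [exact H6|].
    eapply Rle_trans; [apply Rmult_le_compat_l; [apply pow2_ge_0|exact H4]|].
    replace ((/ jbd) ^ 2 * (c * c * (8 * jbd ^ 2) * l2norm2 (jac a' f)))
      with (8 * (c * c) * l2norm2 (jac a' f)) by (field; lra).
    pose proof (l2norm2_ge0 f Hf).
    assert (0 <= c * c) by nra.
    assert (8 * (c * c) * l2norm2 (jac a' f) <= 8 * (c * c) * (jbd * l2norm2 f))
      by (apply Rmult_le_compat_l; [lra|exact H2]).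
    assert (0 <= (c * c) * (jbd * l2norm2 f)) by (apply Rmult_le_pos; nra). lra.
Qed.
End NormalInverse.

(** * Energies outside the spectrum *)

Lemma letter_sturm alpha theta n : 0 < alpha < 1 ->
  sturm alpha theta n = letter alpha (theta + IZR n * alpha).
Proof.
  intros H01. unfold sturm, letter, frac.
  rewrite (Rplus_comm (IZR n * alpha) theta). set (x := theta + IZR n * alpha).
  pose proof (Int_part_le x) as Hx.
  destruct (Rle_dec (1 - alpha) (x - IZR (Int_part x))).
  - destruct (Rlt_dec (x - IZR (Int_part x)) 1); [|lra].
    rewrite (Int_part_unique (x + alpha) (Int_part x + 1)) by (rewrite plus_IZR; lra).
    now replace (Int_part x + 1 - Int_part x)%Z with 1%Z by ring.
  - rewrite (Int_part_unique (x + alpha) (Int_part x)) by lra.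
    now rewrite Z.sub_diag.
Qed.

Lemma sturm_abs alpha theta n : Rabs (sturm alpha theta n) <= 1.
Proof.
  unfold sturm. destruct (Rle_dec _ _); [destruct (Rlt_dec _ _)|];
    rewrite ?Rabs_R1, ?Rabs_R0; lra.
Qed.

Lemma step_norm alpha lambda E x : 0 < alpha < 1 ->
  M2norm (step alpha lambda E x) <= Cmod E + Rabs lambda + 2.
Proof.
  intros H01. unfold step, transfer, M2norm; simpl.
  pose proof (letter_sturm alpha x 0 H01) as Hl. rewrite Rmult_0_l, Rplus_0_r in Hl.
  pose proof (sturm_abs alpha x 0) as Hs. rewrite Hl in Hs.
  pose proof (Cmod_triangle E (- RtoC (lambda * letter alpha x))) as Ht.
  rewrite Cmod_opp, Cmod_R, Rabs_mult in Ht. unfold Cminus.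
  rewrite Cmod_0, Cmod_1, Cmod_R, (Rabs_left (-1)) by lra.
  pose proof (Rabs_pos lambda). nra.
Qed.

Definition shifted (lambda alpha theta : R) (E : C) (u : Z -> C) : Z -> C :=
  fun n => Cminus (Hop lambda alpha theta u n) (Cmult E (u n)).

Lemma in_resolvent_of_lower_bound lambda alpha theta E c :
  (forall u, l2 u -> l2norm2 u <= c * l2norm2 (shifted lambda alpha theta E u)) ->
  in_resolvent lambda alpha theta E.
Proof.
  intros H.
  set (a := fun n => (RtoC (lambda * sturm alpha theta n) - E)%C).
  assert (Ej : forall u, shifted lambda alpha theta E u = jac a u).
  { intros u. extensionality n. unfold shifted, Hop, jac, a. ring. }
  set (M := Rabs lambda + Cmod E).
  assert (Ha : forall n, Cmod (a n) <= M).
  { intros n. unfold a, M, Cminus. eapply Rle_trans. apply Cmod_triangle.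
    rewrite Cmod_opp, Cmod_R, Rabs_mult.
    pose proof (sturm_abs alpha theta n). pose proof (Rabs_pos lambda). nra. }
  assert (Hn : forall n, Cconj (a n) = (a n + (E - Cconj E))%C).
  { intros n. unfold a. destruct E as [e1 e2]. apply injective_projections; simpl; ring. }
  (* The inversion needs a constant of at least 1 to have a contraction rate in (0, 1). *)
  set (c1 := Rmax 1 c). assert (Hc1 : 1 <= c1) by apply Rmax_l.
  assert (Hlow : forall u, l2 u -> l2norm2 u <= c1 * l2norm2 (jac a u)).
  { intros u Hu. eapply Rle_trans; [apply H; assumption|]. rewrite Ej.
    apply Rmult_le_compat_r; [|apply Rmax_r].
    apply l2norm2_ge0. now apply (jac_l2 a M u Ha). }
  exists (green a M). split; [|split; [|split]].
  - intros u Hu. now apply (green_l2 a M c1 _ Ha Hn Hc1 Hlow).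
  - exists (16 * (c1 * c1) * jbd M). intros u Hu.
    now apply (green_l2 a M c1 _ Ha Hn Hc1 Hlow).
  - intros u Hu. change (green a M (shifted lambda alpha theta E u) = u). rewrite Ej.
    now apply (green_left a M c1 _ Ha Hn Hc1 Hlow).
  - intros u Hu. change (shifted lambda alpha theta E (green a M u) = u). rewrite Ej.
    now apply (green_right a M c1 _ Ha Hn Hc1 Hlow).
Qed.

Lemma shifted_l2 lambda alpha theta E u : l2 u -> l2 (shifted lambda alpha theta E u).
Proof.
  intros Hu.
  set (a := fun n => (RtoC (lambda * sturm alpha theta n) - E)%C).
  assert (Ej : shifted lambda alpha theta E u = jac a u).
  { extensionality n. unfold shifted, Hop, jac, a. ring. }
  rewrite Ej. apply (jac_l2 a (Rabs lambda + Cmod E)); [|assumption].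
  intros n. unfold a, Cminus. eapply Rle_trans. apply Cmod_triangle.
  rewrite Cmod_opp, Cmod_R, Rabs_mult.
  pose proof (sturm_abs alpha theta n). pose proof (Rabs_pos lambda). nra.
Qed.

Lemma large_energy_resolvent lambda alpha theta E :
  Rabs lambda + 3 <= Cmod E -> in_resolvent lambda alpha theta E.
Proof.
  intros HE. eapply in_resolvent_of_lower_bound. intros u Hu.
  (* Diagonal dominance: there are two neighbours, and 2 * 2^2 + 1 = 3^2 explains the margin 3. *)
  apply (l2_shift_domination u _ (1 :: -1 :: nil)%Z (0 :: nil)%Z (Cmod E - Rabs lambda) 1).
  - assumption.
  - now apply shifted_l2.
  - lra.
  - lra.
  - intros p. simpl lsum. rewrite Z.add_0_r. change (p + -1)%Z with (p - 1)%Z.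
    assert (Eu : (E * u p = (u (p + 1)%Z + u (p - 1)%Z)
       + (RtoC (lambda * sturm alpha theta p) * u p + - shifted lambda alpha theta E u p))%C).
    { unfold shifted, Hop. ring. }
    apply (f_equal Cmod) in Eu. rewrite Cmod_mult in Eu.
    pose proof (Cmod_triangle (u (p + 1)%Z + u (p - 1)%Z)
      (RtoC (lambda * sturm alpha theta p) * u p + - shifted lambda alpha theta E u p)) as H1.
    pose proof (Cmod_triangle (u (p + 1)%Z) (u (p - 1)%Z)) as H2.
    pose proof (Cmod_triangle (RtoC (lambda * sturm alpha theta p) * u p)
      (- shifted lambda alpha theta E u p)) as H3.
    rewrite Cmod_opp, Cmod_mult, Cmod_R, Rabs_mult in H3.
    assert (Rabs lambda * Rabs (sturm alpha theta p) * Cmod (u p) <= Rabs lambda * Cmod (u p)).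
    { pose proof (sturm_abs alpha theta p). pose proof (Rabs_pos lambda).
      apply Rmult_le_compat_r; [apply Cmod_ge_0|]. nra. }
    lra.
  - simpl length. change (INR 2) with (1 + 1).
    assert (3 <= Cmod E - Rabs lambda) by lra. nra.
Qed.

Definition vn (z : C * C) : R := Cmod (fst z) + Cmod (snd z).
Definition vsub (z w : C * C) : C * C := ((fst z - fst w)%C, (snd z - snd w)%C).

Lemma vn_ge0 z : 0 <= vn z.
Proof. unfold vn. pose proof (Cmod_ge_0 (fst z)); pose proof (Cmod_ge_0 (snd z)); lra. Qed.

Lemma vn_apply A z : vn (M2apply A z) <= M2norm A * vn z.
Proof.
  unfold vn, M2apply, M2norm. destruct z as [s t]; simpl.
  pose proof (Cmod_mul_add (m11 A) s (m12 A) t). pose proof (Cmod_mul_add (m21 A) s (m22 A) t).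
  pose proof (Cmod_ge_0 (m11 A)); pose proof (Cmod_ge_0 (m12 A)).
  pose proof (Cmod_ge_0 (m21 A)); pose proof (Cmod_ge_0 (m22 A)).
  pose proof (Cmod_ge_0 s); pose proof (Cmod_ge_0 t). nra.
Qed.

Lemma M2apply_mul A B z : M2apply (M2mul A B) z = M2apply A (M2apply B z).
Proof. unfold M2apply, M2mul; simpl. f_equal; ring. Qed.

Section Escape.
Context (alpha lambda theta : R) (E : C) (Hirr : irrational alpha) (H01 : 0 < alpha < 1).
Context (u : Z -> C).
Local Notation f := (shifted lambda alpha theta E u).
Local Notation pos n := (theta + IZR n * alpha).
Definition pairv (n : Z) : C * C := (u n, u (n - 1)%Z).
Local Notation U := pairv.
Local Notation kap := (Cmod E + Rabs lambda + 2).

Lemma kap_ge1 : 1 <= kap.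
Proof. pose proof (Cmod_ge_0 E). pose proof (Rabs_pos lambda). lra. Qed.

Lemma pairv_step n : vsub (U (n + 1)) (M2apply (step alpha lambda E (pos n)) (U n)) = (f n, RtoC 0).
Proof.
  unfold vsub, pairv, M2apply, step, transfer, shifted, Hop; simpl.
  rewrite (letter_sturm alpha theta n H01).
  replace (n + 1 - 1)%Z with n by ring.
  apply injective_projections; simpl fst; simpl snd; [|ring].
  replace (RtoC (-1)) with (- RtoC 1)%C by (apply injective_projections; simpl; ring). ring.
Qed.

(** Variation of constants: each step adds an error of at most eps, and later steps amplify it by at
    most kap each. *)
Lemma pairv_propagate p m eps : 0 <= eps ->
  (forall i, (0 <= i < Z.of_nat m)%Z -> Cmod (f (p + i)%Z) <= eps) ->
  vn (vsub (U (p + Z.of_nat m)) (M2apply (coc alpha lambda E (pos p) (Z.of_nat m)) (U p)))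
    <= INR m * kap ^ m * eps.
Proof.
  intros He. pose proof kap_ge1 as Hk. induction m as [|m IH]; intros H.
  - change (Z.of_nat 0) with 0%Z. rewrite coc_0, Z.add_0_r.
    unfold vn, vsub, M2apply, M2id; simpl.
    replace (u p - (1 * u p + 0 * u (p - 1)%Z))%C with (RtoC 0) by ring.
    replace (u (p - 1)%Z - (0 * u p + 1 * u (p - 1)%Z))%C with (RtoC 0) by ring.
    rewrite Cmod_0. lra.
  - specialize (IH ltac:(intros i Hi; apply H; lia)).
    rewrite Nat2Z.inj_succ. unfold Z.succ.
    rewrite coc_succ, Z.add_assoc, M2apply_mul.
    set (n := (p + Z.of_nat m)%Z) in *.
    replace (pos p + IZR (Z.of_nat m) * alpha) with (pos n) by (unfold n; rewrite plus_IZR; ring).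
    set (T := step alpha lambda E (pos n)). set (w := M2apply (coc alpha lambda E (pos p) (Z.of_nat m)) (U p)) in *.
    assert (Es : vsub (U (n + 1)) (M2apply T w) =
      ((fst (M2apply T (vsub (U n) w)) + f n)%C, snd (M2apply T (vsub (U n) w)))).
    { pose proof (pairv_step n) as Hs. fold T in Hs.
      pose proof (f_equal fst Hs) as Hs1. pose proof (f_equal snd Hs) as Hs2.
      cbn [fst snd vsub] in Hs1, Hs2. unfold vsub. f_equal.
      - rewrite <- Hs1. unfold M2apply. cbn [fst snd]. ring.
      - transitivity ((snd (U (n + 1)) - snd (M2apply T (U n))) +
          (snd (M2apply T (U n)) - snd (M2apply T w)))%C; [ring|].
        rewrite Hs2. unfold M2apply. cbn [fst snd]. ring. }
    rewrite Es. unfold vn at 1. cbn [fst snd].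
    pose proof (Cmod_triangle (fst (M2apply T (vsub (U n) w))) (f n)) as Ht.
    assert (Hf : Cmod (f n) <= eps) by (apply H; lia).
    pose proof (vn_apply T (vsub (U n) w)) as Hv. unfold vn at 1 in Hv.
    assert (HT : M2norm T <= kap) by (apply step_norm; assumption).
    pose proof (vn_ge0 (vsub (U n) w)) as Hv0. pose proof (M2norm_ge0 T).
    assert (Hp : 1 <= kap ^ S m) by (apply pow_R1_Rle; lra).
    rewrite S_INR. simpl pow in *. set (P := kap ^ m) in *.
    set (V := vn (vsub (U n) w)) in *.
    assert (M2norm T * V <= kap * (INR m * P * eps)).
    { apply Rmult_le_compat; assumption. }
    pose proof (Rmult_le_compat_r eps 1 (kap * P) He Hp).
    assert (Hgoal : kap * (INR m * P * eps) + kap * P * eps = (INR m + 1) * (kap * P) * eps) by ring.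
    lra.
Qed.

Lemma pairv_back p : vn (U p) <= kap * (vn (U (p + 1)) + Cmod (f p)).
Proof.
  set (T := step alpha lambda E (pos p)).
  assert (Eu : U p = M2apply (M2adj T) (vsub (U (p + 1)) (f p, RtoC 0))).
  { pose proof (pairv_step p) as Hs. fold T in Hs.
    assert (Hw : vsub (U (p + 1)) (f p, RtoC 0) = M2apply T (U p)).
    { rewrite <- Hs. unfold vsub; simpl.
      apply injective_projections; simpl fst; simpl snd; ring. }
    rewrite Hw, <- M2apply_mul, M2mul_adj_l by apply det_step.
    unfold M2apply, M2id, pairv; simpl. apply injective_projections; simpl fst; simpl snd; ring. }
  rewrite Eu at 1. eapply Rle_trans. apply vn_apply. rewrite M2norm_adj.
  assert (HT : M2norm T <= kap) by (apply step_norm; assumption).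
  apply Rmult_le_compat; [apply M2norm_ge0|apply vn_ge0|assumption|].
  unfold vn, vsub; simpl. unfold Cminus.
  pose proof (Cmod_triangle (u (p + 1)%Z) (- f p)) as H1.
  pose proof (Cmod_triangle (u (p + 1 - 1)%Z) (- RtoC 0)) as H2.
  rewrite Cmod_opp in H1, H2. rewrite Cmod_0 in H2. lra.
Qed.

(** The propagation error for the right half of the square, plus that for the left half carried
    through an inverse of norm at most 2 kap^m. *)
Definition center_cost (m : nat) : R := INR m * kap ^ m * (1 + 2 * kap ^ m).

(* For f = 0 this is the identity U(p+q) + U(p-q) = tr * U(p) across a square centered at p. *)
Lemma pairv_center q pp p m eps : q = Z.of_nat m -> traceable alpha q pp -> 0 <= eps ->
  (forall i, (- q <= i < q)%Z -> Cmod (f (p + i)%Z) <= eps) ->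
  (forall i, (p - q <= i <= p)%Z -> ~ bad alpha q pp (pos i)) ->
  Cmod (trc alpha lambda E q pp) * vn (U p) <= vn (U (p + q)) + vn (U (p - q)) + center_cost m * eps.
Proof.
  intros Hq Htr He Hf Hb.
  set (P := coc alpha lambda E (pos p) q).
  assert (EP : P = coc alpha lambda E (pos (p - q)) q).
  { unfold P. replace (pos p) with (pos (p - q) + IZR q * alpha) by (rewrite minus_IZR; ring).
    apply coc_period with (p := pp); [lia|]. intros i Hi.
    replace (pos (p - q) + IZR i * alpha) with (pos (p - q + i)) by (rewrite plus_IZR; ring).
    apply Hb. lia. }
  assert (Et : M2tr P = trc alpha lambda E q pp).
  { apply tr_trc; [assumption..|apply Hb; lia]. }
  assert (e1 : vn (vsub (U (p + q)) (M2apply P (U p))) <= INR m * kap ^ m * eps).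
  { unfold P. rewrite Hq. apply pairv_propagate; [assumption|]. intros i Hi. apply Hf. lia. }
  assert (e2 : vn (vsub (U p) (M2apply P (U (p - q)))) <= INR m * kap ^ m * eps).
  { assert (e : forall i, (0 <= i < Z.of_nat m)%Z -> Cmod (f (p - q + i)%Z) <= eps).
    { intros i Hi. replace (p - q + i)%Z with (p + (i - q))%Z by ring. apply Hf. lia. }
    pose proof (pairv_propagate (p - q) m eps He e) as e2.
    rewrite <- Hq, <- EP in e2. replace (p - q + q)%Z with p in e2 by ring. exact e2. }
  set (d1 := vsub (U (p + q)) (M2apply P (U p))) in *.
  set (d2 := vsub (U p) (M2apply P (U (p - q)))) in *.
  assert (Hadj : M2apply (M2adj P) (U p) =
    ((fst (M2apply (M2adj P) d2) + fst (U (p - q)))%C, (snd (M2apply (M2adj P) d2) + snd (U (p - q)))%C)).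
  { assert (Hinv : M2apply (M2adj P) (M2apply P (U (p - q))) = U (p - q)).
    { rewrite <- M2apply_mul, M2mul_adj_l by apply det_coc.
      unfold M2apply, M2id, pairv; simpl. apply injective_projections; simpl fst; simpl snd; ring. }
    pose proof (f_equal fst Hinv) as I1. pose proof (f_equal snd Hinv) as I2.
    rewrite <- I1, <- I2. unfold d2.
    set (w := M2apply P (U (p - q))). unfold M2apply, vsub.
    apply injective_projections; cbn [fst snd]; ring. }
  assert (HP : M2norm P <= 2 * kap ^ m).
  { unfold P. rewrite Hq. apply (cnorm_le_pow alpha lambda kap). intros y. now apply step_norm. }
  pose proof (vn_apply (M2adj P) d2) as Hv2. rewrite M2norm_adj in Hv2.
  assert (Hc1 : (M2tr P * fst (U p) = (fst (U (p + q)) + fst (U (p - q)))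
      + (- fst d1 + fst (M2apply (M2adj P) d2)))%C).
  { apply (f_equal fst) in Hadj. cbn [fst snd] in Hadj.
    transitivity (fst (M2apply P (U p)) + fst (M2apply (M2adj P) (U p)))%C.
    - unfold M2tr, M2apply, M2adj. cbn [fst snd m11 m12 m21 m22]. ring.
    - rewrite Hadj. unfold d1, vsub. cbn [fst snd]. ring. }
  assert (Hc2 : (M2tr P * snd (U p) = (snd (U (p + q)) + snd (U (p - q)))
      + (- snd d1 + snd (M2apply (M2adj P) d2)))%C).
  { apply (f_equal snd) in Hadj. cbn [fst snd] in Hadj.
    transitivity (snd (M2apply P (U p)) + snd (M2apply (M2adj P) (U p)))%C.
    - unfold M2tr, M2apply, M2adj. cbn [fst snd m11 m12 m21 m22]. ring.
    - rewrite Hadj. unfold d1, vsub. cbn [fst snd]. ring. }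
  assert (T4 : forall a b c d : C, Cmod ((a + b) + (- c + d))%C <= Cmod a + Cmod b + (Cmod c + Cmod d)).
  { intros a b c d. pose proof (Cmod_triangle (a + b) (- c + d)). pose proof (Cmod_triangle a b).
    pose proof (Cmod_triangle (- c) d) as H3. rewrite Cmod_opp in H3. lra. }
  apply (f_equal Cmod) in Hc1. apply (f_equal Cmod) in Hc2. rewrite Cmod_mult in Hc1, Hc2.
  pose proof (T4 (fst (U (p + q))) (fst (U (p - q))) (fst d1) (fst (M2apply (M2adj P) d2))) as F1.
  pose proof (T4 (snd (U (p + q))) (snd (U (p - q))) (snd d1) (snd (M2apply (M2adj P) d2))) as F2.
  rewrite <- Hc1 in F1. rewrite <- Hc2 in F2. rewrite Et in F1, F2.
  unfold center_cost. pose proof (vn_ge0 d2).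
  assert (Hk0 : 0 <= kap ^ m) by (apply pow_le; pose proof kap_ge1; lra).
  assert (Hd2 : M2norm P * vn d2 <= 2 * kap ^ m * (INR m * kap ^ m * eps)).
  { apply Rmult_le_compat; [apply M2norm_ge0|assumption..]. }
  unfold vn in *.
  assert (Hfin : INR m * kap ^ m * (1 + 2 * kap ^ m) * eps
    = INR m * kap ^ m * eps + 2 * kap ^ m * (INR m * kap ^ m * eps)) by ring.
  lra.
Qed.
End Escape.

Section Resolvent.
Context (alpha : R) (Hirr : irrational alpha) (H01 : 0 < alpha < 1).

Lemma cfq_ge2 j : (3 <= j)%nat -> (2 <= cfq alpha j <= cfq alpha (S j))%Z.
Proof.
  intros Hj. destruct j as [|[|[|i]]]; try lia.
  pose proof (cfq_double alpha Hirr H01 i). pose proof (cfq_ge1 alpha Hirr H01 i).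
  pose proof (cfq_ge1 alpha Hirr H01 (S i)).
  rewrite (cfq_rec alpha (S (S i))). pose proof (quot_ge1 alpha Hirr H01 (S (S i))). nia.
Qed.

(* A position b that is bad for q excludes bad positions for r from (b - r, b + q); the
   endpoints p = b and p = b + q are avoided by moving to p + 1. *)
Lemma square_center theta j p : (3 <= j)%nat ->
  let r := (cfq alpha j + cfq alpha (S j))%Z in
  exists c, (c = p \/ c = p + 1)%Z /\
    ((forall i, (c - cfq alpha (S j) <= i <= c)%Z -> ~ bad alpha (cfq alpha (S j)) (cfp alpha (S j)) (theta + IZR i * alpha)) \/
     (forall i, (c - r <= i <= c)%Z -> ~ bad alpha r (cfp alpha j + cfp alpha (S j)) (theta + IZR i * alpha))).
Proof.
  intros Hj r. destruct (cfq_ge2 j Hj) as [Hq' Hqq].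
  set (q := cfq alpha (S j)) in *. set (pp := cfp alpha (S j)).
  destruct (classic (exists b, (p - q <= b <= p)%Z /\ bad alpha q pp (theta + IZR b * alpha)))
    as [(b & Hb & Hbad)|Hno].
  2: { exists p. split; [now left|]. left. intros i Hi Hc. apply Hno. now exists i. }
  assert (Hr : forall c, (b < c < b + q)%Z ->
    forall i, (c - r <= i <= c)%Z -> ~ bad alpha r (cfp alpha j + cfp alpha (S j)) (theta + IZR i * alpha)).
  { intros c Hc i Hi Hbi.
    apply (bad_bad_far alpha _ _ _ _ (theta + IZR b * alpha) (i - b)
      (cf_adjacent_mediant alpha Hirr H01 j) Hbad).
    - replace (theta + IZR b * alpha + IZR (i - b) * alpha) with (theta + IZR i * alpha)
        by (rewrite minus_IZR; ring). exact Hbi.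
    - fold q. fold r. lia. }
  destruct (Z.eq_dec p (b + q)) as [Hp|Hp].
  (* The window now runs from b + 1 to b + q + 1, while the next bad position is at least q + q' >=
     q + 2 beyond b. *)
  - exists (p + 1)%Z. split; [now right|]. left. intros i Hi Hc.
    assert (cfq alpha (S (S j)) <= i - b)%Z.
    { apply (bad_cf_spacing alpha Hirr H01 j (theta + IZR b * alpha)); [exact Hbad| |lia].
      replace (theta + IZR b * alpha + IZR (i - b) * alpha) with (theta + IZR i * alpha)
        by (rewrite minus_IZR; ring). exact Hc. }
    rewrite (cfq_rec alpha j) in H. pose proof (quot_ge1 alpha Hirr H01 j). fold q in H. nia.
  - destruct (Z.eq_dec p b) as [Hp'|Hp'].
    + exists (p + 1)%Z. split; [now right|]. right. apply Hr. lia.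
    + exists p. split; [now left|]. right. apply Hr. lia.
Qed.

Definition zrange (n : nat) : list Z := map (fun i : nat => (Z.of_nat i - Z.of_nat n)%Z) (seq 0 (2 * n + 1)).

Lemma In_zrange n i : (- Z.of_nat n <= i <= Z.of_nat n)%Z -> In i (zrange n).
Proof.
  intros H. unfold zrange. apply in_map_iff. exists (Z.to_nat (i + Z.of_nat n)).
  split; [lia|]. apply in_seq. lia.
Qed.

(** Offsets of the entries of U(c + s) and U(c - s), for U = [pairv u]. *)
Definition pairs_around (c s : Z) : list Z := (c + s :: c + s - 1 :: c - s :: c - s - 1 :: nil)%Z.

Lemma lsum_app h l l' : lsum h (l ++ l') = lsum h l + lsum h l'.
Proof. induction l as [|s t IH]; simpl; [ring|rewrite IH; ring]. Qed.

Lemma escape_in_resolvent lambda E theta k :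
  escapes alpha lambda E k -> in_resolvent lambda alpha theta E.
Proof.
  intros Hesc. set (kap := Cmod E + Rabs lambda + 2).
  assert (Hkap : 1 <= kap).
  { unfold kap. pose proof (Cmod_ge_0 E). pose proof (Rabs_pos lambda). lra. }
  (* Four choices of center and length with four entries each give 16 shifts, and 2 * 16^2 + 1 = 513
     <= 23^2. The factor kap pays for the step back from p + 1 to p; index 3 ensures lengths of at
     least 2. *)
  destruct (escapes_large alpha Hirr H01 lambda E k 3 (23 * kap) Hesc) as (j & Hj & Hx & Hz).
  set (q := cfq alpha (S j)). set (r := (cfq alpha j + cfq alpha (S j))%Z).
  destruct (cfq_ge2 j Hj) as [Hq' Hqq].
  set (mq := Z.to_nat q). set (mr := Z.to_nat r).
  assert (Eq : q = Z.of_nat mq) by (unfold mq, q; lia).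
  assert (Er : r = Z.of_nat mr) by (unfold mr, r; lia).
  set (K := center_cost lambda E mq + center_cost lambda E mr + 23 * kap).
  assert (Hcost : forall m, 0 <= center_cost lambda E m).
  { intros m. unfold center_cost. fold kap.
    assert (0 <= kap ^ m) by (apply pow_le; lra).
    pose proof (pos_INR m). apply Rmult_le_pos; [apply Rmult_le_pos|]; lra. }
  pose proof (Hcost mq) as Hcq. pose proof (Hcost mr) as Hcr.
  set (S0 := (pairs_around 0 q ++ pairs_around 1 q ++ pairs_around 0 r ++ pairs_around 1 r)).
  (* The center is p or p + 1, so f enters up to distance r + 1 from p. *)
  set (S1 := zrange (mr + 1)).
  eapply in_resolvent_of_lower_bound. intros u Hu.
  apply (l2_shift_domination u _ S0 S1 23 K); [assumption|now apply shifted_l2|lra|unfold K; lra| |].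
  2: { change (INR (length S0)) with (INR 16). rewrite INR_IZR_INZ. simpl. lra. }
  intros p. set (f := shifted lambda alpha theta E u).
  set (eps := lsum (fun s => Cmod (f (p + s)%Z)) S1).
  assert (He : 0 <= eps) by (apply lsum_ge0; intros; apply Cmod_ge_0).
  assert (Hf : forall i, (- r <= i - p <= r + 1)%Z -> Cmod (f i) <= eps).
  { intros i Hi. replace i with (p + (i - p))%Z by ring.
    apply (lsum_In (fun s => Cmod (f (p + s)%Z))); [intros; apply Cmod_ge_0|].
    apply In_zrange. lia. }
  set (h := fun s => Cmod (u (p + s)%Z)).
  assert (Hh : forall s, 0 <= h s) by (intros; apply Cmod_ge_0).
  assert (Hpair : forall c s, lsum h (pairs_around c s) =
    vn (pairv u (p + c + s)) + vn (pairv u (p + c - s))).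
  { intros c s. unfold pairs_around, vn, pairv, h; simpl.
    replace (p + (c + s))%Z with (p + c + s)%Z by ring.
    replace (p + (c + s - 1))%Z with (p + c + s - 1)%Z by ring.
    replace (p + (c - s))%Z with (p + c - s)%Z by ring.
    replace (p + (c - s - 1))%Z with (p + c - s - 1)%Z by ring. ring. }
  assert (Hall : forall c s, (c = 0 \/ c = 1)%Z -> (s = q \/ s = r) ->
    vn (pairv u (p + c + s)) + vn (pairv u (p + c - s)) <= lsum h S0).
  { intros c s Hc Hs. unfold S0. rewrite !lsum_app.
    pose proof (lsum_ge0 h (pairs_around 0 q) Hh). pose proof (lsum_ge0 h (pairs_around 1 q) Hh).
    pose proof (lsum_ge0 h (pairs_around 0 r) Hh). pose proof (lsum_ge0 h (pairs_around 1 r) Hh).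
    rewrite <- Hpair. destruct Hc as [->| ->], Hs as [->| ->]; lra. }
  assert (Hcenter : exists c, (c = 0 \/ c = 1)%Z /\
    23 * kap * vn (pairv u (p + c)) <= lsum h S0 + (center_cost lambda E mq + center_cost lambda E mr) * eps).
  { destruct (square_center theta j p Hj) as (c & Hc & Hgood). exists (c - p)%Z. split; [lia|].
    replace (p + (c - p))%Z with c by ring.
    pose proof (vn_ge0 (pairv u c)) as Hv0.
    assert (Hcq' : 0 <= center_cost lambda E mq * eps) by (apply Rmult_le_pos; assumption).
    assert (Hcr' : 0 <= center_cost lambda E mr * eps) by (apply Rmult_le_pos; assumption).
    destruct Hgood as [Hg|Hg].
    - pose proof (pairv_center alpha lambda theta E Hirr H01 u q (cfp alpha (S j)) c mq eps Eq
        (cfq_traceable alpha Hirr H01 j) He) as H.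
      specialize (H ltac:(intros i Hi; apply Hf; unfold r, q in *; lia) Hg).
      change (trc alpha lambda E q (cfp alpha (S j))) with (trx alpha lambda E (S j)) in H.
      pose proof (Hall (c - p)%Z q ltac:(lia) (or_introl eq_refl)) as Ha.
      replace (p + (c - p) + q)%Z with (c + q)%Z in Ha by ring.
      replace (p + (c - p) - q)%Z with (c - q)%Z in Ha by ring.
      assert (23 * kap * vn (pairv u c) <= Cmod (trx alpha lambda E (S j)) * vn (pairv u c))
        by (apply Rmult_le_compat_r; assumption).
      lra.
    - destruct j as [|j']; [lia|].
      pose proof (pairv_center alpha lambda theta E Hirr H01 u r (cfp alpha (S j') + cfp alpha (S (S j'))) c mr eps Er
        (cf_mediant_traceable alpha Hirr H01 j') He) as H.
      specialize (H ltac:(intros i Hi; apply Hf; unfold r, q in *; lia) Hg).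
      change (trc alpha lambda E r (cfp alpha (S j') + cfp alpha (S (S j')))) with (trz alpha lambda E (S j')) in H.
      pose proof (Hall (c - p)%Z r ltac:(lia) (or_intror eq_refl)) as Ha.
      replace (p + (c - p) + r)%Z with (c + r)%Z in Ha by ring.
      replace (p + (c - p) - r)%Z with (c - r)%Z in Ha by ring.
      assert (23 * kap * vn (pairv u c) <= Cmod (trz alpha lambda E (S j')) * vn (pairv u c))
        by (apply Rmult_le_compat_r; assumption).
      lra. }
  destruct Hcenter as (c & Hc & Hcen).
  assert (Hback : vn (pairv u p) <= kap * (vn (pairv u (p + c)) + eps)).
  { pose proof (vn_ge0 (pairv u (p + c))). destruct Hc as [->| ->].
    - rewrite Z.add_0_r in *. nra.
    - eapply Rle_trans. apply (pairv_back alpha lambda theta E H01 u p).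
      apply Rmult_le_compat_l; [fold kap; lra|].
      assert (Cmod (f p) <= eps) by (apply Hf; unfold r; lia). fold f. lra. }
  assert (Hup : Cmod (u p) <= vn (pairv u p)).
  { unfold vn, pairv; simpl. pose proof (Cmod_ge_0 (u (p - 1)%Z)). lra. }
  unfold K. nra.
Qed.
End Resolvent.

Theorem theorem3 (alpha lambda : R) :
  0 < alpha < 1 ->
  (forall p q : Z, (q > 0)%Z -> alpha <> IZR p / IZR q) ->
  bounded_density alpha ->
  lambda <> 0 ->
  exists C0 mu : R, 0 < C0 /\ 0 < mu /\
    forall (theta : R) (E : C) (n : nat),
      0 <= theta < 1 -> Sigma lambda alpha E -> (1 <= n)%nat ->
      opnorm (transfer_word lambda E (sturm_word alpha theta n))
        <= C0 * Rpower (INR n) mu.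
Proof.
  intros H01 Hirr Hbd _.
  (* Larger energies lie in the resolvent set by [large_energy_resolvent]; fixing B before E makes
     all constants uniform. *)
  set (B := Rabs lambda + 3). assert (HB : 0 <= B) by (unfold B; pose proof (Rabs_pos lambda); lra).
  set (K0 := 33 + lambda * lambda + B).
  set (K := 5 + lambda * lambda + 3 * (K0 * K0)).
  set (kap := B + Rabs lambda + 2).
  destruct (polynomial_growth alpha Hirr H01 lambda K kap) as (C0 & mu & HC & Hmu & H).
  - unfold K. nra.
  - unfold kap. pose proof (Rabs_pos lambda). lra.
  - assumption.
  - exists C0, mu. repeat split; try assumption.
    intros theta E n _ (theta' & _ & Hs) Hn.
    assert (HE : Cmod E <= B).
    { destruct (Rle_dec (Cmod E) B) as [|Hgt]; [assumption|].
      exfalso. apply Hs. apply large_energy_resolvent. unfold B in Hgt. lra. }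
    assert (Hne : forall k, ~ escapes alpha lambda E k).
    { intros k Hk. apply Hs. now apply escape_in_resolvent with (k := k). }
    pose proof (traces_bounded alpha Hirr H01 lambda E B Hne HE) as Ht.
    eapply Rle_trans. apply opnorm_le_M2norm.
    (* The word starts with the letter of index 1, hence the base point theta + alpha. *)
    replace (transfer_word lambda E (sturm_word alpha theta n))
      with (coc alpha lambda E (theta + alpha) (Z.of_nat n)).
    + apply H; [|assumption]. repeat split; [|intros i; apply Ht..].
      intros y. eapply Rle_trans; [now apply step_norm|]. unfold kap. lra.
    + unfold coc. replace (0 <=? Z.of_nat n)%Z with true by (symmetry; apply Z.leb_le; lia).
      rewrite Nat2Z.id. clear Hn.
      induction n as [|n IH]; [reflexivity|].
      unfold transfer_word, sturm_word in *. rewrite seq_S, map_app, fold_left_app.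
      cbn [map fold_left steps]. change (1 + n)%nat with (S n). rewrite <- IH. unfold step.
      rewrite (letter_sturm alpha theta (Z.of_nat (S n)) H01).
      replace (theta + IZR (Z.of_nat (S n)) * alpha) with (theta + alpha + INR n * alpha)
        by (rewrite <- INR_IZR_INZ, S_INR; ring).
      reflexivity.
Qed.
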